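(* Let $H$ be a separable real Hilbert space, $\Lambda\ge0$, let $(P_m)_{m\ge0}$ be increasing finite-rank orthogonal projections with $P_m\uparrow I$, $\vartheta_m\downarrow0$, and $R_m=I-P_m$. Let $\mathscr Q_{\Lambda,\boldsymbol\vartheta}$ be the set of continuous paths $q:[0,T]\to\mathcal S_1(H)_{\rm sa}$ with $q_0=0$ and, for all $s\le t$ and $m$, $0\preceq q_{s,t}$, $\operatorname{Tr}q_{s,t}\le\Lambda(t-s)$, $\operatorname{Tr}(R_mq_{s,t}R_m)\le\vartheta_m(t-s)$. Let $\mathscr A_{\Lambda,\boldsymbol\vartheta}$ be the space of Lebesgue-a.e. equivalence classes of strongly measurable $a:[0,T]\to\mathcal S_1(H)_{\rm sa}$ satisfying, for a.e. $t$, $$0\preceq a_t,\qquad\operatorname{Tr}a_t\le\Lambda,\qquad\operatorname{Tr}(R_ma_tR_m)\le\vartheta_m\quad(m\ge0),$$ equipped with the metric $\int_0^T\|a_t-\widetilde a_t\|_1dt$. This is a closed, hence complete, subset of $L^1([0,T];\mathcal S_1(H)_{\rm sa})$. The Bochner integration map $(\mathcal Ia)_t:=\int_0^ta_rdr$ is a bijection $\mathscr A_{\Lambda,\boldsymbol\vartheta}\to\mathscr Q_{\Lambda,\boldsymbol\vartheta}$. When $\mathscr Q_{\Lambda,\boldsymbol\vartheta}$ carries the trace-variation metric it is an isometric bijection, and in particular that metric space is complete: if $q=\mathcal Ia$, $\widetilde q=\mathcal I\widetilde a$, then $$\|q-\widetilde q\|_{1\text{-var};\mathcal S_1}=\int_0^T\|a_t-\widetilde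 a_t\|_1dt,\qquad\|q-\widetilde q\|_{\infty;\mathcal S_1}\le\int_0^T\|a_t-\widetilde a_t\|_1dt.$$ For $s\in[0,T]$ define, up to a.e. equality, $(r_sa)_t=\mathbf 1_{\{t<s\}}a_t$, $(\theta_sa)_v=\mathbf 1_{\{v<T-s\}}a_{s+v}$, $(a\otimes_s\widetilde a)_t=\mathbf 1_{\{t<s\}}a_t+\mathbf 1_{\{t>s\}}\widetilde a_{t-s}$. Then $$\mathcal I(r_sa)=r_s\mathcal I(a),\qquad\mathcal I(\theta_sa)=\theta_s\mathcal I(a),\qquad\mathcal I(a\otimes_s\widetilde a)=\mathcal I(a)\otimes_s\mathcal I(\widetilde a),$$ and all three density operations preserve $\mathscr A_{\Lambda,\boldsymbol\vartheta}$. If $\Gamma\in\mathcal S_1(H)_+$, the additional condition $0\preceq q_{s,t}\preceq(t-s)\Gamma$ for all $s\le t$ is equivalent, under $q=\mathcal Ia$, to $0\preceq a_t\preceq\Gamma$ for a.e. $t$.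
   Context: $0<T<\infty$. $\mathcal S_1(H)$: trace-class operators with norm $\|\cdot\|_1$; sa, $+$: self-adjoint, positive; $\preceq$ the operator order; $q_{s,t}=q_t-q_s$. On paths: $(r_sq)_t=q_{t\wedge s}$, $(\theta_sq)_v=q_{s+(v\wedge(T-s))}-q_s$, $(q\otimes_s\widetilde q)_t=q_{t\wedge s}+\widetilde q_{(t-s)_+}$. *)

(* Defs.v *)
From HB Require Import structures.
From mathcomp Require Import all_boot all_order all_algebra.
From mathcomp Require Import all_classical all_reals all_analysis.

Set Implicit Arguments.
Unset Strict Implicit.
Unset Printing Implicit Defensive.

Import Order.TTheory GRing.Theory Num.Theory.
Import numFieldNormedType.Exports.

Local Open Scope classical_set_scope.
Local Open Scope ring_scope.

HB.mixin Record isHilbert (R : realType) H of CompleteNormedModule R H := {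
  inner : H -> H -> R;
  innerC : forall x y, inner x y = inner y x;
  inner_linearl : forall y a x x',
    inner (a *: x + x') y = a * inner x y + inner x' y;
  inner_norm : forall x, inner x x = `|x| ^+ 2
}.

#[short(type="hilbertType")]
HB.structure Definition Hilbert (R : realType) :=
  {H of CompleteNormedModule R H & isHilbert R H}.

Definition separable (X : topologicalType) :=
  exists2 D : set X, countable D & dense D.

(** Metric notions on a set [S] of representatives, [eqv] being the equality
    of the represented points. *)

Definition metric_on (R : realType) (X : Type) (S : set X)
    (eqv : X -> X -> Prop) (d : X -> X -> \bar R) :=
  forall x y z, S x -> S y -> S z ->
  [/\ (0 <= d x y < +oo)%E, d x y = 0%E <-> eqv x y, d x y = d y x
    & (d x z <= d x y + d y z)%E].

Definition closed_in (R : realType) (X : Type) (S S' : set X)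
    (d : X -> X -> \bar R) :=
  S `<=` S' /\
  forall x, S' x ->
    (forall e : R, 0 < e -> exists2 y, S y & (d x y < e%:E)%E) -> S x.

Definition complete_on (R : realType) (X : Type) (S : set X)
    (d : X -> X -> \bar R) :=
  forall u : nat -> X, (forall n, S (u n)) ->
    (forall e : R, 0 < e ->
       exists k, forall m n, (k <= m)%N -> (k <= n)%N ->
         (d (u m) (u n) < e%:E)%E) ->
  exists2 x, S x & d (u n) x @[n --> \oo] --> 0%E.

(** Operators on a real Hilbert space are represented by functions [H -> H],
    with the pointwise vector space structure. *)

Definition selfadjoint (R : realType) (H : hilbertType R) (A : H -> H) :=
  forall x y, inner (A x) y = inner x (A y).

Definition bounded_op (R : realType) (H : hilbertType R) (A : H -> H) :=
  linear A /\ continuous A.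

Definition op_le (R : realType) (H : hilbertType R) (A B : H -> H) :=
  selfadjoint (B - A) /\ forall x, 0 <= inner ((B - A) x) x.

Definition orthonormal_basis (R : realType) (H : hilbertType R) (B : set H) :=
  (forall x y, B x -> B y -> inner x y = (x == y)%:R) /\
  (forall x, (forall e, B e -> inner x e = 0) -> x = 0).

(** A fixed orthonormal basis; traces do not depend on this choice. *)
Definition onb (R : realType) (H : hilbertType R) : set H :=
  xget set0 [set B | @orthonormal_basis R H B].

(** [P] is [|A| = (A^* A)^(1/2)]; the last clause is [P^2 = A^* A]. *)
Definition is_abs_op (R : realType) (H : hilbertType R) (A P : H -> H) :=
  [/\ bounded_op P, op_le 0 P
    & forall x y, inner (P (P x)) y = inner (A x) (A y)].

Definition abs_op (R : realType) (H : hilbertType R) (A : H -> H) : H -> H :=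
  xget 0 [set P | is_abs_op A P].

Definition trace (R : realType) (H : hilbertType R) (A : H -> H) : \bar R :=
  let f e := (inner (A e) e)%:E in
  (\esum_(e in @onb R H) f^\+ e - \esum_(e in @onb R H) f^\- e)%E.
Arguments trace {R H} A%_ring_scope.

Definition trace_norm (R : realType) (H : hilbertType R) (A : H -> H) : \bar R :=
  trace (abs_op A).
Arguments trace_norm {R H} A%_ring_scope.

Definition trace_class (R : realType) (H : hilbertType R) : set (H -> H) :=
  [set A | bounded_op A /\ (trace_norm A < +oo)%E].
Arguments trace_class {R} H.

Definition trace_class_sa (R : realType) (H : hilbertType R) : set (H -> H) :=
  [set A | trace_class H A /\ selfadjoint A].
Arguments trace_class_sa {R} H.

Definition orthogonal_projection (R : realType) (H : hilbertType R)
    (P : H -> H) :=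
  [/\ bounded_op P, selfadjoint P & forall x, P (P x) = P x].

Definition finite_rank (R : realType) (H : hilbertType R) (P : H -> H) :=
  exists (n : nat) (v : 'I_n -> H),
    forall x, exists c : 'I_n -> R, P x = \sum_(i < n) c i *: v i.

(** [(I - P) A (I - P)] *)
Definition compress (R : realType) (H : hilbertType R) (P A : H -> H) : H -> H :=
  (idfun - P) \o A \o (idfun - P).
Arguments compress {R H} (P A)%_ring_scope.

(** Strong measurability and the Bochner integral for functions from subsets of
    the line to the normed space of self-adjoint trace-class operators.
    Strongly measurable means pointwise limit, everywhere on [D], of simple
    functions; every a.e. class of a.e. limits has such a representative, and
    [t |-> trace_norm (f t)] is then Borel measurable on [D]. *)

Definition simple_fun (R : realType) (H : hilbertType R) (f : R -> H -> H) :=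
  [/\ forall t, trace_class_sa H (f t), finite_set (range f)
    & forall A, measurable (f @^-1` [set A])].

Definition simple_integral (R : realType) (H : hilbertType R)
    (D : set R) (f : R -> H -> H) : H -> H :=
  \sum_(A \in range f)
     fine (lebesgue_measure (D `&` f @^-1` [set A])) *: A.

Definition strongly_measurable (R : realType) (H : hilbertType R)
    (D : set R) (f : R -> H -> H) :=
  (forall t, D t -> trace_class_sa H (f t)) /\
  exists2 u : nat -> R -> H -> H, forall n, simple_fun (u n)
    & forall t, D t -> trace_norm (u n t - f t) @[n --> \oo] --> 0%E.

Definition L1_dist (R : realType) (H : hilbertType R) (D : set R)
    (f g : R -> H -> H) : \bar R :=
  (\int[lebesgue_measure]_(t in D) trace_norm (f t - g t))%E.
Arguments L1_dist {R H} D%_classical_set_scope (f g)%_ring_scope.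

Definition L1 (R : realType) (H : hilbertType R) (D : set R) :
    set (R -> H -> H) :=
  [set f | strongly_measurable D f /\ (L1_dist D f 0 < +oo)%E].

Definition is_bochner_integral (R : realType) (H : hilbertType R) (D : set R)
    (f : R -> H -> H) (A : H -> H) :=
  [/\ strongly_measurable D f, trace_class_sa H A
    & exists u : nat -> R -> H -> H,
      [/\ forall n, simple_fun (u n),
          L1_dist D f (u n) @[n --> \oo] --> 0%E
        & trace_norm (simple_integral D (u n) - A) @[n --> \oo] --> 0%E]].

Definition bochner_integral (R : realType) (H : hilbertType R) (D : set R)
    (f : R -> H -> H) : H -> H :=
  xget 0 [set A | is_bochner_integral D f A].

Definition integration_map (R : realType) (H : hilbertType R)
    (a : R -> H -> H) : R -> H -> H :=
  fun t => bochner_integral `[0, t] a.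

Definition ae_on (R : realType) (D : set R) (P : R -> Prop) :=
  {ae @lebesgue_measure R, forall t, D t -> P t}.

Definition density_space (R : realType) (H : hilbertType R) (T Lambda : R)
    (P : nat -> H -> H) (theta : nat -> R) : set (R -> H -> H) :=
  [set a | strongly_measurable `[0, T] a /\
    ae_on `[0, T] (fun t =>
      [/\ op_le 0 (a t), (trace (a t) <= Lambda%:E)%E
        & forall m, (trace (compress (P m) (a t)) <= (theta m)%:E)%E])].

Definition path_space (R : realType) (H : hilbertType R) (T Lambda : R)
    (P : nat -> H -> H) (theta : nat -> R) : set (R -> H -> H) :=
  [set q : R -> H -> H | [/\ forall t : R, t \in `[0, T] -> trace_class_sa H (q t),
      forall t : R, t \in `[0, T] ->
        trace_norm (q s - q t) @[s --> within `[0, T] (nbhs t)] --> 0%E,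
      q 0 = 0
    & forall s t : R, 0 <= s -> s <= t -> t <= T ->
      [/\ op_le 0 (q t - q s),
          (trace (q t - q s) <= (Lambda * (t - s))%:E)%E
        & forall m, (trace (compress (P m) (q t - q s))
                       <= (theta m * (t - s))%:E)%E]]].

Definition one_var_dist (R : realType) (H : hilbertType R) (T : R)
    (q q' : R -> H -> H) : \bar R :=
  let d t := q t - q' t in
  ereal_sup [set let F := d \o nth T (0 :: p) in
      (\sum_(0 <= n < size p) trace_norm (F n.+1 - F n))%E
    | p in itv_partition 0 T].

Definition sup_dist (R : realType) (H : hilbertType R) (T : R)
    (q q' : R -> H -> H) : \bar R :=
  ereal_sup [set trace_norm (q t - q' t) | t in `[0, T]].

Definition path_stop (R : realType) (H : hilbertType R) (s : R)
    (q : R -> H -> H) : R -> H -> H :=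
  fun t => q (Num.min t s).

Definition path_shift (R : realType) (H : hilbertType R) (T s : R)
    (q : R -> H -> H) : R -> H -> H :=
  fun v => q (s + Num.min v (T - s)) - q s.

Definition path_concat (R : realType) (H : hilbertType R) (s : R)
    (q q' : R -> H -> H) : R -> H -> H :=
  fun t => q (Num.min t s) + q' (Num.max (t - s) 0).

Definition density_stop (R : realType) (H : hilbertType R) (s : R)
    (a : R -> H -> H) : R -> H -> H :=
  fun t => if t < s then a t else 0.

Definition density_shift (R : realType) (H : hilbertType R) (T s : R)
    (a : R -> H -> H) : R -> H -> H :=
  fun v => if v < T - s then a (s + v) else 0.

Definition density_concat (R : realType) (H : hilbertType R) (s : R)
    (a a' : R -> H -> H) : R -> H -> H :=
  fun t => (if t < s then a t else 0) + (if s < t then a' (t - s) else 0).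

(* Main.v *)
Require Import Defs.
From HB Require Import structures.
From mathcomp Require Import all_boot all_order all_algebra.
From mathcomp Require Import finmap.
From mathcomp Require Import all_classical all_reals all_analysis.
From mathcomp Require Import measurable_realfun.
From mathcomp Require Import ring lra.

Set Implicit Arguments.
Unset Strict Implicit.
Unset Printing Implicit Defensive.

Import Order.TTheory GRing.Theory Num.Theory.
Import numFieldNormedType.Exports.

Local Open Scope classical_set_scope.
Local Open Scope ring_scope.

(** Write [A] for the density space, [Q] for the path space and [I] for the
    integration map.  The theorem is a Lebesgue differentiation theorem for paths
    with values in trace-class operators.  Instead of the general fact that a
    separable dual space has the Radon-Nikodym property, the proof uses the order:
    positivity reduces all scalar questions to monotone functions, and the tail
    bounds [theta] supply the compactness needed to pass from matrix entries to
    the trace norm.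

    Trace norms are always bounded through domination ([trace_norm_sandwich]): if
    [- S <= D <= S] with [S] positive, then the trace norm of [D] is at most the
    trace of [S].  The proof compares [|D|] with the pinching of [S] by the
    projection that splits [D] into its positive and negative parts.  From it come
    the triangle inequality, the completeness of the space of self-adjoint
    trace-class operators ([trace_class_complete]) and the tightness estimate
    [tight_dist]: for positive operators with trace at most [Lambda] and
    compression to the range of [I - P m] of trace at most [theta m], convergence
    in trace norm is convergence of the matrix entries in the range of each [P m].

    All constraints, on densities as well as on increments of paths, are countable
    systems of inequalities between a finite combination of values [<A x, x>] and a
    multiple of the length of the time interval ([countably_linear]).  Such a
    system passes from a density to the increments of its integral by integration,
    and back by differentiating countably many scalar functions at almost every
    time ([constraint_transfer]).  This shows that [I] maps [A] into [Q], and it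
    also gives the final equivalence for an operator bound [G].

    For surjectivity ([path_surj]), the functions [t |-> <q t x, x>] are
    nondecreasing and Lipschitz, so they have densities ([lipschitz_density]), and
    their slopes along uniform partitions converge almost everywhere
    ([grid_slope_ae]).  The operator-valued slopes of [q] are positive and satisfy
    the tail bounds, so by tightness they converge in trace norm at almost every
    time; their limit is the density.

    For the isometry ([integration_isometry]), the variation of [I a - I c] is at
    most the [L1] distance by the triangle inequality for integrals.  Conversely,
    the variation sum along a uniform partition is at least the [L1] distance of
    the slopes of [I a] and [I c], which converge to [a] and [c] in trace norm
    almost everywhere and are bounded.  The paths are complete because the
    variation is lower semicontinuous under pointwise convergence
    ([path_complete]); completeness of the densities follows from the isometry, and
    closedness in [L1] from completeness.

    The identities for stopping, shifting and concatenating densities reduce to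
    one fact: densities that agree up to a translation have integrals with the
    same increments ([increment_shift]). *)

(** * Inner products and operators *)

Section InnerProduct.
Context {R : realType} {H : hilbertType R}.
Implicit Types (x y z : H) (a : R).

Lemma innerDl x y z : inner (x + y) z = inner x z + inner y z.
Proof. by rewrite -[x in x + y]scale1r inner_linearl mul1r. Qed.

Lemma inner0l z : inner (0 : H) z = 0.
Proof. by apply/(addrI (inner 0 z)); rewrite -innerDl !addr0. Qed.

Lemma innerZl a x z : inner (a *: x) z = a * inner x z.
Proof. by rewrite -[a *: x]addr0 inner_linearl inner0l addr0. Qed.

Lemma innerNl x z : inner (- x) z = - inner x z.
Proof. by rewrite -scaleN1r innerZl mulN1r. Qed.

Lemma innerBl x y z : inner (x - y) z = inner x z - inner y z.
Proof. by rewrite innerDl innerNl. Qed.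

Lemma innerDr x y z : inner z (x + y) = inner z x + inner z y.
Proof. by rewrite innerC innerDl !(innerC z). Qed.

Lemma inner0r z : inner z (0 : H) = 0.
Proof. by rewrite innerC inner0l. Qed.

Lemma innerZr a x z : inner z (a *: x) = a * inner z x.
Proof. by rewrite innerC innerZl (innerC z). Qed.

Lemma innerNr x z : inner z (- x) = - inner z x.
Proof. by rewrite innerC innerNl (innerC z). Qed.

Lemma innerBr x y z : inner z (x - y) = inner z x - inner z y.
Proof. by rewrite innerDr innerNr. Qed.

Lemma inner_suml I (r : seq I) (Q : pred I) (F : I -> H) z :
  inner (\sum_(i <- r | Q i) F i) z = \sum_(i <- r | Q i) inner (F i) z.
Proof.
by elim/big_rec2 : _ => [|i u v _ <-]; rewrite ?inner0l// innerDl.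
Qed.

Lemma inner_sumr I (r : seq I) (Q : pred I) (F : I -> H) z :
  inner z (\sum_(i <- r | Q i) F i) = \sum_(i <- r | Q i) inner z (F i).
Proof. by rewrite innerC inner_suml; apply: eq_bigr => i _; rewrite innerC. Qed.

Lemma inner_ge0 x : 0 <= inner x x.
Proof. by rewrite inner_norm sqr_ge0. Qed.

Lemma inner_eq0 x : inner x x = 0 -> x = 0.
Proof. by rewrite inner_norm => /eqP; rewrite sqrf_eq0 normr_eq0 => /eqP. Qed.

Lemma inner_ext x y : (forall z, inner x z = inner y z) -> x = y.
Proof.
move=> xy; apply/eqP; rewrite -subr_eq0; apply/eqP/inner_eq0.
by rewrite innerBl xy subrr.
Qed.

End InnerProduct.


(** For [c > 0] evaluate at the vertex [- b / c]; for [c = 0] an affine function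
    bounded below is constant. *)
Lemma quad_ge0_discr (R : realType) (a b c : R) : 0 <= c ->
  (forall r, 0 <= a + r * b *+ 2 + r ^+ 2 * c) -> b ^+ 2 <= a * c.
Proof.
rewrite le_eqVlt => /predU1P[<-|c_gt0] h; last first.
  have := h (- b / c).
  have -> : a + - b / c * b *+ 2 + (- b / c) ^+ 2 * c = a - b ^+ 2 / c.
    by rewrite mulr2n; field; lra.
  by rewrite subr_ge0 ler_pdivrMr.
rewrite mulr0; have [->|b0] := eqVneq b 0; first by rewrite expr0n.
have := h (- (a + 1) / b); rewrite mulr0 addr0.
have -> : - (a + 1) / b * b = - (a + 1) by field.
have := h 0; rewrite mulr2n; lra.
Qed.

Lemma cauchy_seq_cvg (R : realType) (V : completeNormedModType R)
    (x : nat -> V) :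
  (forall e : R, 0 < e -> exists k, forall m n, (k <= m)%N -> (k <= n)%N ->
     `|x m - x n| < e) -> cvgn x.
Proof.
move=> h; apply/cauchy_cvgP/cauchy_exP => e /h[k hk].
exists (x k); exists k => // n /= kn.
by rewrite -ball_normE /=; apply: hk.
Qed.

Lemma dominated_steps_cvg (R : realType) (V : completeNormedModType R)
    (x : nat -> V) (y : nat -> R) :
  (forall n, `|x n.+1 - x n| <= y n.+1 - y n) -> cvgn y -> cvgn x.
Proof.
move=> xy cy.
have tele m n : (n <= m)%N -> `|x m - x n| <= y m - y n.
  elim: m => [|m IHm]; first by rewrite leqn0 => /eqP ->; rewrite !subrr normr0.
  rewrite leq_eqVlt => /predU1P[<-|/IHm h]; first by rewrite !subrr normr0.
  have -> : x m.+1 - x n = (x m.+1 - x m) + (x m - x n).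
    by rewrite addrA subrK.
  by apply: (le_trans (ler_normD _ _)); have := xy m; lra.
apply: cauchy_seq_cvg => e e0.
have /cvgrPdist_lt/(_ _ (divr_gt0 e0 (ltr0n _ 2))) [k _ hk] := cy.
exists k => m n km kn.
wlog nm : m n km kn / (n <= m)%N.
  by move=> wlg; have [/wlg|/ltnW/wlg] := leqP n m; rewrite 1?distrC; apply.
apply: (le_lt_trans (tele _ _ nm)).
have := hk _ km; have := hk _ kn; rewrite /= !ltr_norml.
by move=> /andP[? ?] /andP[? ?]; lra.
Qed.

Lemma subrBB (V : zmodType) (A B C D : V) : (A - B) - (C - D) = (A - C) - (B - D).
Proof. by rewrite !opprB addrACA [RHS]addrACA [- B - C]addrC. Qed.

Section Operators.
Context {R : realType} {H : hilbertType R}.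
Implicit Types (x y z : H) (a c : R) (A B C : H -> H).

Section LinearFacts.
Variable A : H -> H.
Hypothesis lA : linear A.

Lemma linop0 : A 0 = 0.
Proof. by have := lA (-1) 0 0; rewrite !scaleN1r oppr0 addr0 addNr. Qed.

Lemma linopD x y : A (x + y) = A x + A y.
Proof. by rewrite -[x in LHS]scale1r lA scale1r. Qed.

Lemma linopZ a x : A (a *: x) = a *: A x.
Proof. by rewrite -[a *: x]addr0 lA linop0 addr0. Qed.

Lemma linopN x : A (- x) = - A x.
Proof. by rewrite -scaleN1r linopZ scaleN1r. Qed.

Lemma linopB x y : A (x - y) = A x - A y.
Proof. by rewrite linopD linopN. Qed.

Lemma linop_sum I (r : seq I) (Q : pred I) (F : I -> H) :
  A (\sum_(i <- r | Q i) F i) = \sum_(i <- r | Q i) A (F i).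
Proof. by elim/big_rec2 : _ => [|i u v _ <-]; rewrite ?linop0// linopD. Qed.

End LinearFacts.

Lemma bounded_opP A :
  bounded_op A <-> linear A /\ exists2 c, 0 < c & forall x, `|A x| <= c * `|x|.
Proof.
split => [[lA cA]|[lA [c c0 bA]]].
  split=> //; have [f fA] : exists f : {linear H -> H}, f = A :> (H -> H).
    by exists (HB.pack_for {linear H -> H} A (GRing.isLinear.Build _ _ _ _ A lA)).
  have /linear_boundedP/pinfty_ex_gt0[c c0 bA] : bounded_near f (nbhs 0).
    by apply/linear_bounded_continuous; rewrite fA.
  by exists c => // x; rewrite -fA.
split=> // x; apply/cvgrPdist_le => e e0.
near=> y; rewrite -linopB//; apply: (le_trans (bA _)).
rewrite -ler_pdivlMl// mulrC; near: y.
by have /cvgrPdist_le := @cvg_id _ (nbhs x); apply; rewrite divr_gt0.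
Unshelve. all: by end_near. Qed.

Lemma bounded_op_lin A : bounded_op A -> linear A.
Proof. by case. Qed.

Lemma bounded_op_bound A : bounded_op A ->
  exists2 c, 0 < c & forall x, `|A x| <= c * `|x|.
Proof. by move=> /bounded_opP[]. Qed.

Lemma bounded_op0 : bounded_op (0 : H -> H).
Proof.
apply/bounded_opP; split => [a x y|]; first by rewrite /= scaler0 addr0.
by exists 1 => // x; rewrite normr0 mulr_ge0.
Qed.

Lemma bounded_op_id : bounded_op (idfun : H -> H).
Proof.
by apply/bounded_opP; split => [a x y|]//; exists 1 => // x; rewrite mul1r.
Qed.

Lemma bounded_opD A B : bounded_op A -> bounded_op B -> bounded_op (A + B).
Proof.
move=> /bounded_opP[lA [c c0 bA]] /bounded_opP[lB [d d0 bB]].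
apply/bounded_opP; split => [a x y|].
  by rewrite !fctE lA lB scalerDr addrACA.
exists (c + d) => [|x]; first by rewrite addr_gt0.
by rewrite mulrDl (le_trans (ler_normD _ _))// lerD.
Qed.

Lemma bounded_opZ a A : bounded_op A -> bounded_op (a *: A).
Proof.
move=> /bounded_opP[lA [c c0 bA]].
apply/bounded_opP; split => [b x y|].
  by rewrite /= !fctE lA scalerDr !scalerA (mulrC a).
exists ((`|a| + 1) * c) => [|x]; first by rewrite mulr_gt0 ?ltr_wpDl.
rewrite /= normrZ -mulrA ler_pM//.
by rewrite lerDl.
Qed.

Lemma bounded_opN A : bounded_op A -> bounded_op (- A).
Proof. by rewrite -scaleN1r; exact: bounded_opZ. Qed.

Lemma bounded_opB A B : bounded_op A -> bounded_op B -> bounded_op (A - B).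
Proof. by move=> bA bB; apply: bounded_opD => //; exact: bounded_opN. Qed.

Lemma bounded_op_comp A B : bounded_op A -> bounded_op B -> bounded_op (A \o B).
Proof.
move=> [lA cA] [lB cB]; split => [a x y|]; first by rewrite /= lB lA.
by move=> x; apply: continuous_comp; [exact: cB | exact: cA].
Qed.

Lemma selfadjoint0 : selfadjoint (0 : H -> H).
Proof. by move=> x y; rewrite inner0l inner0r. Qed.

Lemma selfadjointD A B : selfadjoint A -> selfadjoint B -> selfadjoint (A + B).
Proof. by move=> sA sB x y; rewrite !fctE innerDl innerDr sA sB. Qed.

Lemma selfadjointZ a A : selfadjoint A -> selfadjoint (a *: A).
Proof. by move=> sA x y; rewrite /= innerZl innerZr sA. Qed.

Lemma selfadjointN A : selfadjoint A -> selfadjoint (- A).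
Proof. by move=> sA x y; rewrite !fctE innerNl innerNr sA. Qed.

Lemma selfadjointB A B : selfadjoint A -> selfadjoint B -> selfadjoint (A - B).
Proof. by move=> sA sB; apply: selfadjointD => //; exact: selfadjointN. Qed.

Definition positive_op A :=
  [/\ bounded_op A, selfadjoint A & forall x, 0 <= inner (A x) x].

Lemma positive_op0 : positive_op (0 : H -> H).
Proof.
split; [exact: bounded_op0|exact: selfadjoint0|by move=> x; rewrite inner0l].
Qed.

Lemma positive_opD A B : positive_op A -> positive_op B -> positive_op (A + B).
Proof.
move=> [bA sA pA] [bB sB pB]; split; first exact: bounded_opD.
  exact: selfadjointD.
by move=> x; rewrite fctE innerDl addr_ge0.
Qed.

Lemma positive_opZ a A : 0 <= a -> positive_op A -> positive_op (a *: A).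
Proof.
move=> a0 [bA sA pA]; split; first exact: bounded_opZ.
  exact: selfadjointZ.
by move=> x; rewrite /= innerZl mulr_ge0.
Qed.

Lemma positive_op_conj A B : bounded_op B -> selfadjoint B ->
  positive_op A -> positive_op (B \o A \o B).
Proof.
move=> bB sB [bA sA pA]; split.
- by do 2 apply: bounded_op_comp => //.
- by move=> x y /=; rewrite sB sA sB.
- by move=> x /=; rewrite sB.
Qed.

Lemma op_le0P A : bounded_op A -> op_le 0 A <-> positive_op A.
Proof.
move=> bA; rewrite /op_le subr0; split => [[sA pA]|[_ sA pA]]; first by split.
by split.
Qed.

(** The discriminant inequality for [r |-> <A (x + r y), x + r y>]. *)
Lemma positive_op_CS A x y : positive_op A ->
  inner (A x) y ^+ 2 <= inner (A x) x * inner (A y) y.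
Proof.
move=> [[lA _] sA pA]; apply: quad_ge0_discr => // r.
have := pA (x + r *: y); rewrite linopD// linopZ//.
rewrite !(innerDl, innerDr, innerZl, innerZr) [inner (A y) x]sA [inner y _]innerC.
by rewrite [X in 0 <= X -> _](_ : _ = inner (A x) x + r * inner (A x) y *+ 2 +
  r ^+ 2 * inner (A y) y)//; ring.
Qed.

Lemma inner_CS x y : `|inner x y| <= `|x| * `|y|.
Proof.
have pid : positive_op idfun.
  by split=> //; [exact: bounded_op_id|move=> z; exact: inner_ge0].
have := positive_op_CS x y pid; rewrite /= !inner_norm -exprMn => h.
by rewrite -(@ler_pXn2r _ 2)// ?nnegrE ?mulr_ge0// real_normK// num_real.
Qed.

Lemma inner_polar A x y : linear A -> selfadjoint A ->
  inner (A x) y =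
  (inner (A (x + y)) (x + y) - inner (A x) x - inner (A y) y) / 2.
Proof.
move=> lA sA; rewrite linopD// !(innerDl, innerDr).
by rewrite [inner (A y) x]sA [inner y (A x)]innerC; field.
Qed.

Lemma quadratic_form_ext A B : linear A -> selfadjoint A -> linear B ->
  selfadjoint B -> (forall x, inner (A x) x = inner (B x) x) -> A = B.
Proof.
move=> lA sA lB sB AB; apply/funext => x; apply: inner_ext => y.
by rewrite (inner_polar x y lA sA) (inner_polar x y lB sB) !AB.
Qed.

Lemma positive_op_ker A x : positive_op A -> inner (A x) x = 0 -> A x = 0.
Proof.
move=> pA h; apply: inner_eq0; apply/eqP; rewrite -sqrf_eq0 eq_le sqr_ge0 andbT.
by have := positive_op_CS x (A x) pA; rewrite h mul0r.
Qed.

End Operators.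

(** * Orthonormal sequences *)

Section Orthonormal.
Context {R : realType} {H : hilbertType R}.
Implicit Types (x y z : H).

(** An orthonormal sequence padded with zero vectors: this lets one sequence
    enumerate an orthonormal set of any finite or countable size. *)
Definition ortho_seq (b : nat -> H) :=
  (forall i j, i != j -> inner (b i) (b j) = 0) /\
  (forall i, b i = 0 \/ inner (b i) (b i) = 1).

Definition complete_seq (b : nat -> H) :=
  forall x, (forall i, inner x (b i) = 0) -> x = 0.

Definition fourier (b : nat -> H) n x := \sum_(i < n) inner x (b i) *: b i.

Lemma cvg_innerl (x_ : nat -> H) x : x_ n @[n --> \oo] --> x ->
  forall y, inner (x_ n) y @[n --> \oo] --> inner x y.
Proof.
move=> /cvgrPdist_le xx y; apply/cvgrPdist_le => /= e e0.
have : 0 < e / (`|y| + 1) by rewrite divr_gt0// ltr_wpDl.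
move=> /xx; apply: filterS => n /= h; rewrite -innerBl.
apply: le_trans (inner_CS _ _) _.
have y0 : 0 <= `|y| by [].
apply: (@le_trans _ _ (e / (`|y| + 1) * `|y|)); first by rewrite ler_wpM2r.
by rewrite mulrAC ler_pdivrMr ?ltr_wpDl// ler_pM2l// lerDl.
Qed.

Lemma inner_fourier b n x j : ortho_seq b ->
  inner (fourier b n x) (b j) = if (j < n)%N then inner x (b j) else 0.
Proof.
move=> [ob nb]; rewrite inner_suml; under eq_bigr do rewrite innerZl.
have bb : inner x (b j) * inner (b j) (b j) = inner x (b j).
  by case: (nb j) => ->; rewrite ?inner0r ?mulr1 ?mulr0.
case: ifPn => jn.
  rewrite (bigD1 (Ordinal jn))//= bb big1 ?addr0// => i ij.
  by rewrite ob ?mulr0//; apply: contraNneq ij => ij; apply/eqP/val_inj.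
rewrite big1// => i _; rewrite ob ?mulr0//.
by apply: contraNneq jn => <-.
Qed.

Lemma inner_fourier_self b n x : inner x (fourier b n x) =
  \sum_(i < n) inner x (b i) ^+ 2.
Proof.
by rewrite inner_sumr; apply: eq_bigr => i _; rewrite innerZr -expr2.
Qed.

Lemma norm_fourier b n x : ortho_seq b ->
  `|fourier b n x| ^+ 2 = \sum_(i < n) inner x (b i) ^+ 2.
Proof.
move=> ob; rewrite -inner_norm [in X in inner _ X]/fourier inner_sumr.
apply: eq_bigr => i _.
by rewrite innerZr inner_fourier// ltn_ord expr2.
Qed.

Lemma dist_fourier b n x : ortho_seq b ->
  `|x - fourier b n x| ^+ 2 = `|x| ^+ 2 - \sum_(i < n) inner x (b i) ^+ 2.
Proof.
move=> ob; rewrite -inner_norm !(innerBl, innerBr) inner_fourier_self.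
rewrite [inner (fourier _ _ _) x]innerC inner_fourier_self !inner_norm.
by rewrite norm_fourier// subrr subr0.
Qed.

Lemma bessel b n x : ortho_seq b ->
  \sum_(i < n) inner x (b i) ^+ 2 <= `|x| ^+ 2.
Proof. by move=> ob; rewrite -subr_ge0 -dist_fourier// sqr_ge0. Qed.

(** By Bessel's inequality the partial sums are Cauchy, and their limit has the
    same coefficients as [x]. *)
Lemma cvg_fourier b x : ortho_seq b -> complete_seq b ->
  fourier b n x @[n --> \oo] --> x.
Proof.
move=> ob cb.
pose s n := \sum_(i < n) inner x (b i) ^+ 2.
have s_nd : nondecreasing_seq s.
  by apply/nondecreasing_seqP => n; rewrite /s big_ord_recr/= lerDl sqr_ge0.
have s_cvg : cvgn s.
  apply: nondecreasing_is_cvgn => //; exists (`|x| ^+ 2) => _ [n _ <-].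
  exact: bessel.
have sE m n : (n <= m)%N ->
    `|fourier b m x - fourier b n x| ^+ 2 = s m - s n.
  move=> nm; rewrite -inner_norm !(innerBl, innerBr).
  have -> : inner (fourier b n x) (fourier b m x) = s n.
    rewrite [in X in inner _ X]/fourier inner_sumr /s.
    rewrite (big_ord_widen _ (fun i => inner x (b i) ^+ 2) nm) [RHS]big_mkcond/=.
    apply: eq_bigr => i _; rewrite innerZr inner_fourier//.
    by case: ifP; rewrite ?mulr0// expr2.
  have -> : inner (fourier b m x) (fourier b n x) = s n.
    rewrite [in X in inner _ X]/fourier inner_sumr /s.
    apply: eq_bigr => i _; rewrite innerZr inner_fourier//.
    by rewrite (leq_trans _ nm)// expr2.
  by rewrite !inner_norm !norm_fourier// -/(s m) -/(s n) subrr subr0.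
have cf : cvgn (fourier b ^~ x).
  apply: cauchy_seq_cvg => e e0.
  have e2 : 0 < e ^+ 2 / 2 by rewrite divr_gt0// exprn_gt0.
  have /cvgrPdist_lt/(_ _ e2) [k _ hk] := s_cvg.
  exists k => m n km kn.
  wlog nm : m n km kn / (n <= m)%N.
    by move=> wlg; have [/wlg|/ltnW/wlg] := leqP n m; rewrite 1?distrC; apply.
  rewrite -(@ltr_pXn2r _ 2)// ?nnegrE ?(ltW e0)// sE//.
  have := hk _ km; have := hk _ kn; rewrite /= !ltr_norml.
  by move=> /andP[? ?] /andP[? ?]; lra.
suff e : x = limn (fourier b ^~ x) by rewrite [X in _ --> X]e.
apply/eqP; rewrite -subr_eq0; apply/eqP/cb => j; rewrite innerBl.
apply/eqP; rewrite subr_eq0 eq_sym; apply/eqP.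
have := @cvg_innerl _ _ cf (b j); move/cvg_lim => <- //.
apply: lim_near_cst => //; exists j.+1 => // n /= jn.
by rewrite inner_fourier// jn.
Qed.

Lemma parseval b x : ortho_seq b -> complete_seq b ->
  (\sum_(i <oo) (inner x (b i) ^+ 2)%:E = (`|x| ^+ 2)%:E)%E.
Proof.
move=> ob cb; apply/cvg_lim => //.
under eq_fun do rewrite big_mkord sumEFin.
apply: cvg_EFin; first exact: nearW.
rewrite -inner_norm.
have := @cvg_innerl _ x (cvg_fourier ob cb) x.
by under eq_fun do rewrite innerC inner_fourier_self.
Qed.


Section GramSchmidt.
Variable d : nat -> H.

(** Since [0^-1 = 0], a vector that depends on the previous ones is normalized to
    [0], which is what [ortho_seq] allows. *)
Definition normalize x := `|x|^-1 *: x.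

Fixpoint gs_seq n : seq H := if n is k.+1 then
  rcons (gs_seq k)
        (normalize (d k - \sum_(e <- gs_seq k) inner (d k) e *: e))
  else [::].

Definition gram_schmidt n : H := nth 0 (gs_seq n.+1) n.

Lemma size_gs_seq n : size (gs_seq n) = n.
Proof. by elim: n => //= n IHn; rewrite size_rcons IHn. Qed.

Lemma gs_seqE n : gs_seq n = mkseq gram_schmidt n.
Proof.
elim: n => // n IHn; rewrite mkseqS -IHn /=; congr rcons.
by rewrite /gram_schmidt/= nth_rcons size_gs_seq ltnn eqxx.
Qed.

Lemma gram_schmidtE n : gram_schmidt n =
  normalize (d n - \sum_(i < n) inner (d n) (gram_schmidt i) *: gram_schmidt i).
Proof.
rewrite {1}/gram_schmidt/= nth_rcons size_gs_seq ltnn eqxx gs_seqE.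
have iotaE : iota 0 n = index_iota 0 n by rewrite /index_iota subn0.
by rewrite /mkseq big_map iotaE big_mkord.
Qed.

Lemma normalize_norm x : normalize x = 0 \/
  inner (normalize x) (normalize x) = 1.
Proof.
rewrite /normalize; have [->|x0] := eqVneq x 0; first by left; rewrite scaler0.
right; rewrite innerZl innerZr inner_norm expr2.
by rewrite mulKf ?mulVf ?normr_eq0.
Qed.

Lemma gram_schmidt_ortho : ortho_seq gram_schmidt.
Proof.
have nb i : gram_schmidt i = 0 \/
    inner (gram_schmidt i) (gram_schmidt i) = 1.
  by rewrite gram_schmidtE; exact: normalize_norm.
split=> // i j.
wlog : i j / (j < i)%N.
  move=> wlg ij; have [/wlg|/wlg|e] := ltngtP j i; first exact.
    by rewrite innerC eq_sym => ->.
  by rewrite e eqxx in ij.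
elim/ltn_ind: i j => i IH j ji _.
rewrite {1}gram_schmidtE /normalize innerZl; set c := _^-1.
rewrite innerBl inner_suml; under eq_bigr do rewrite innerZl.
rewrite (bigD1 (Ordinal ji))//= [\sum_(_ < _ | _) _]big1 => [|k kj]; last first.
  rewrite (_ : inner (gram_schmidt k) (gram_schmidt j) = 0) ?mulr0//.
  have {}kj : (k != j :> nat) by apply: contraNneq kj => kj; apply/eqP/val_inj.
  have [kj'|jk|e] := ltngtP (k : nat) j; last by rewrite e eqxx in kj.
    by rewrite innerC IH// eq_sym.
  by rewrite IH.
by case: (nb j) => ->; rewrite ?inner0r ?mulr1 addr0 ?mulr0 subrr mulr0.
Qed.

Lemma gram_schmidt_fourier n : d n = fourier gram_schmidt n.+1 (d n).
Proof.
rewrite /fourier big_ord_recr/=.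
set w := d n - fourier gram_schmidt n (d n).
have bw : gram_schmidt n = normalize w by rewrite gram_schmidtE.
have dw : inner (d n) (gram_schmidt n) = inner w (gram_schmidt n).
  rewrite /w innerBl inner_fourier ?ltnn ?subr0//; exact: gram_schmidt_ortho.
apply/eqP; rewrite addrC -subr_eq; apply/eqP; rewrite -/(fourier _ n _) -/w dw.
rewrite bw /normalize innerZr inner_norm expr2 scalerA.
have [->|w0] := eqVneq w 0; first by rewrite scaler0.
by rewrite mulKf ?normr_eq0// mulfV ?normr_eq0// scale1r.
Qed.

(** Gram-Schmidt only forms linear combinations of the data. *)
Lemma gram_schmidt_fix (P : H -> H) : linear P -> (forall i, P (d i) = d i) ->
  forall i, P (gram_schmidt i) = gram_schmidt i.
Proof.
move=> lP Pd; elim/ltn_ind => n IH; rewrite gram_schmidtE; set w := _ - _.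
suff Pw : P w = w by rewrite /normalize linopZ// Pw.
rewrite /w linopB// Pd linop_sum//; congr (_ - _).
by apply: eq_bigr => i _; rewrite linopZ// IH.
Qed.

End GramSchmidt.

Lemma separable_dense_seq : separable H ->
  exists d : nat -> H, forall x (e : R), 0 < e -> exists n, `|x - d n| < e.
Proof.
move=> [D /countable_injP[f fI] dD].
exists (fun n => xget 0 [set x | D x /\ f x = n]) => x e e0.
have [||y [xy Dy]] := dD (ball x e).
- by exists x; exact: ballxx.
- exact: ball_open.
exists (f y); case: xgetP => [z _ [Dz fzy]|/(_ y)/=]; last by case.
have -> : z = y by apply: fI; rewrite ?inE.
by move: xy; rewrite -ball_normE.
Qed.

(** The nonzero vectors that Gram-Schmidt produces from a dense sequence form a
    basis, so the choice made in the definition of [onb] is not vacuous. *)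
Lemma separable_has_onb : separable H -> @orthonormal_basis R H (@onb R H).
Proof.
move=> /separable_dense_seq[d dd]; apply: xgetPex.
pose b := gram_schmidt d; have [ob nb] := gram_schmidt_ortho d.
exists (range b `\ 0); split => [_ _ [[i _ <-] i0] [[j _ <-] j0]|x xb].
  have [->|ij] := eqVneq (b i) (b j); first by case: (nb j).
  by apply: ob; apply: contra_neq ij => ->.
have {}xb i : inner x (b i) = 0.
  have [->|/eqP i0] := eqVneq (b i) 0; first by rewrite inner0r.
  by apply: xb; split => //; exists i.
have xd n : inner x (d n) = 0.
  rewrite gram_schmidt_fourier inner_sumr big1// => i _.
  by rewrite innerZr xb mulr0.
apply: contrapT => /eqP x0.
have [n xdn] := dd x `|x| ltac:(by rewrite normr_gt0).
have := inner_CS x (x - d n); rewrite innerBr xd subr0 inner_norm.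
rewrite ger0_norm ?sqr_ge0// expr2 ler_pM2l ?normr_gt0//.
by move/(lt_le_trans xdn); rewrite ltxx.
Qed.

(** Distinct basis vectors are at distance [sqrt 2], so sending [e] to the index of
    a point of a dense sequence within [1 / 2] of [e] is injective; indices that
    are not reached receive the vector [0]. *)
Lemma onb_enum : separable H -> exists b : nat -> H,
  [/\ ortho_seq b, complete_seq b &
   forall F : H -> \bar R, (forall x, 0 <= F x)%E -> F 0 = 0%E ->
     (\esum_(e in @onb R H) F e = \sum_(i <oo) F (b i))%E].
Proof.
move=> sH; have [oB cB] := separable_has_onb sH.
have [d dd] := separable_dense_seq sH.
set B := @onb R H in oB cB *.
have /choice[h hE] (e : H) : exists n, `|e - d n| < 2^-1.
  by apply: dd; rewrite invr_gt0.
have hI e e' : B e -> B e' -> h e = h e' -> e = e'.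
  move=> Be Be' hh; apply/eqP; apply: contraT => /[dup] ee' /negbTE ee'F.
  have : `|e - e'| ^+ 2 = 2.
    rewrite -inner_norm !(innerBl, innerBr) !oB// !eqxx [e' == e]eq_sym ee'F.
    by rewrite /=; lra.
  have : `|e - e'| < 1.
    rewrite -(subrK (d (h e)) e) -addrA; apply: (le_lt_trans (ler_normD _ _)).
    have := hE e; have := hE e'; rewrite distrC -hh => ? ?.
    by rewrite [ltRHS](splitr 1) mul1r ltrD.
  move=> h1 h2; have : `|e - e'| ^+ 2 <= 1 by rewrite expr_le1// ltW.
  by rewrite h2; lra.
pose b n := xget 0 [set e | B e /\ h e = n].
have bh e : B e -> b (h e) = e.
  by move=> Be; rewrite /b; case: xgetP => [z _ [? ?]|/(_ e)/=];
    [exact: hI|case].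
have bP n : b n = 0 \/ (B (b n) /\ h (b n) = n).
  by rewrite /b; case: xgetP => [z _ [? ?]|]; [right|left].
exists b; split.
- split=> [i j ij|i]; last first.
    case: (bP i) => [->|[Bi _]]; first by left.
    by right; rewrite oB// eqxx.
  case: (bP i) => [->|[Bi hi]]; first by rewrite inner0l.
  case: (bP j) => [->|[Bj hj]]; first by rewrite inner0r.
  rewrite oB//; have [e|//] := eqVneq (b i) (b j).
  by move: ij; rewrite -hi e hj eqxx.
- by move=> x xb; apply: cB => e Be; rewrite -(bh e Be).
move=> F F0 F00; rewrite nneseries_esumT//.
rewrite (@reindex_esum _ _ _ (h @` B) B b); last first.
  split => [_ [e Be <-]|i j|e Be].
  - by rewrite bh.
  - by rewrite !inE => -[e Be <-] [e' Be' <-]; rewrite !bh// => ->.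
  - by exists (h e); [exists e|rewrite bh].
rewrite esum_mkcond; apply: eq_esum => i _.
case: ifPn => // /negP; rewrite inE => hi.
case: (bP i) => [->|[Bi h_i]]; first by [].
by exfalso; apply: hi; exists (b i).
Qed.

(** Gram-Schmidt applied to a finite family spanning the range. *)
Lemma finite_rank_projection P : orthogonal_projection P -> finite_rank P ->
  exists n (f : nat -> H), ortho_seq f /\ forall x, P x = fourier f n x.
Proof.
move=> [[lP cP] sP PP] [n [v Pv]].
pose d i := if insub i is Some j then P (v j) else 0 : H.
have Pd i : P (d i) = d i.
  by rewrite /d; case: insubP => [j _ _|_]; rewrite ?linop0.
exists n, (gram_schmidt d); split; first exact: gram_schmidt_ortho.
move=> x; have Pb := gram_schmidt_fix lP Pd.
have [c xc] := Pv x.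
have Pxd : P x = \sum_(i < n) c i *: d i.
  rewrite -PP xc linop_sum//; apply: eq_bigr => i _; rewrite linopZ//.
  by rewrite /d valK.
have d_fourier (i : 'I_n) : fourier (gram_schmidt d) n (d i) = d i.
  rewrite [in RHS]gram_schmidt_fourier /fourier.
  rewrite (big_ord_widen n (fun j => inner (d i) (gram_schmidt d j) *:
    gram_schmidt d j) (ltn_ord i)) [RHS]big_mkcond/=.
  apply: eq_bigr => j _; case: ifPn => //; rewrite -leqNgt => ij.
  have [->|nj] := eqVneq (gram_schmidt d j) 0; first by rewrite scaler0.
  rewrite gram_schmidt_fourier inner_fourier; last exact: gram_schmidt_ortho.
  by rewrite ltnNge ij scale0r.
have -> : fourier (gram_schmidt d) n x = fourier (gram_schmidt d) n (P x).
  by apply: eq_bigr => i _; rewrite sP Pb.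
rewrite {2}Pxd /fourier.
under [RHS]eq_bigr do rewrite inner_suml scaler_suml.
rewrite exchange_big/= Pxd; apply: eq_bigr => i _.
rewrite -[in LHS](d_fourier i) /fourier scaler_sumr; apply: eq_bigr => j _.
by rewrite innerZl scalerA.
Qed.

End Orthonormal.

(** * Square roots and absolute values *)

Section SquareRoot.
Context {R : realType} {H : hilbertType R}.
Implicit Types (x y z : H) (A B C D P : H -> H).

Lemma seq_cvg_unique (u : nat -> H) (l l' : H) :
  u n @[n --> \oo] --> l -> u n @[n --> \oo] --> l' -> l = l'.
Proof. by move=> /cvg_lim <- // /cvg_lim <-. Qed.

Lemma cvg_dist_le (u : nat -> H) (l : H) (r : nat -> R) :
  (forall n, `|l - u n| <= r n) -> r n @[n --> \oo] --> 0 ->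
  u n @[n --> \oo] --> l.
Proof.
move=> ur /cvgrPdist_le r0; apply/cvgrPdist_le => /= e /r0; apply: filterS => n.
rewrite /= sub0r normrN => h; apply: (le_trans (ur n)).
exact: le_trans (ler_norm _) h.
Qed.

(** If [Y = (D + Y^2) / 2] then [(I - Y)^2 = I - D].  The iterates are dominated in operator norm by the iterates of the
    scalar equation with [D = 1], which increase and stay below [1]. *)
Section Iteration.
Variable D : H -> H.
Hypotheses (bD : bounded_op D) (sD : selfadjoint D)
  (D1 : forall x, `|D x| <= `|x|).

Fixpoint sqrt_iter n x : H := if n is k.+1 then
  2^-1 *: (D x + sqrt_iter k (sqrt_iter k x)) else 0.

Fixpoint scalar_iter n : R := if n is k.+1 then
  2^-1 * (1 + scalar_iter k ^+ 2) else 0.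

Lemma scalar_iter_bound n : 0 <= scalar_iter n <= 1.
Proof.
elim: n => [|n /andP[h0 h1]] /=; first by rewrite lexx ler01.
apply/andP; split; first by rewrite mulr_ge0 ?invr_ge0 ?addr_ge0 ?sqr_ge0.
by rewrite ler_pdivrMl// mulr1; nra.
Qed.

Lemma scalar_iter_cvg : cvgn scalar_iter.
Proof.
apply: nondecreasing_is_cvgn.
  apply/nondecreasing_seqP => n /=.
  by rewrite ler_pdivlMl//; have := sqr_ge0 (1 - scalar_iter n); nra.
by exists 1 => _ [n _ <-]; have /andP[] := scalar_iter_bound n.
Qed.

Lemma sqrt_iter_lin n : linear (sqrt_iter n).
Proof.
elim: n => [|n IHn] a x y /=; first by rewrite scaler0 addr0.
rewrite (bounded_op_lin bD) !IHn addrACA -scalerDr [LHS]scalerDr.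
by rewrite !scalerA (mulrC a).
Qed.

Lemma sqrt_iter_sa n : selfadjoint (sqrt_iter n).
Proof.
elim: n => [|n IHn] x y /=; first by rewrite inner0l inner0r.
by rewrite innerZl innerZr innerDl innerDr sD IHn IHn.
Qed.

Lemma sqrt_iter_norm n x : `|sqrt_iter n x| <= scalar_iter n * `|x|.
Proof.
elim: n x => [|n IHn] x /=; first by rewrite normr0 mul0r.
rewrite normrZ gtr0_norm ?invr_gt0// -mulrA ler_pM2l ?invr_gt0//.
rewrite (le_trans (ler_normD _ _))// mulrDl mul1r lerD//.
rewrite expr2 -mulrA (le_trans (IHn _))// ler_wpM2l//.
by have /andP[] := scalar_iter_bound n.
Qed.

Lemma sqrt_iterS n x :
  sqrt_iter n.+1 x = 2^-1 *: (D x + sqrt_iter n (sqrt_iter n x)).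
Proof. by []. Qed.

Lemma sqrt_iter_step n x : `|sqrt_iter n.+1 x - sqrt_iter n x| <=
  (scalar_iter n.+1 - scalar_iter n) * `|x|.
Proof.
elim: n x => [|n IHn] x.
  rewrite /= !subr0 addr0 normrZ gtr0_norm ?invr_gt0//.
  by rewrite expr0n addr0 mulr1 ler_pM2l ?invr_gt0.
have -> : sqrt_iter n.+2 x - sqrt_iter n.+1 x =
    2^-1 *: (sqrt_iter n.+1 (sqrt_iter n.+1 x - sqrt_iter n x) +
             (sqrt_iter n.+1 (sqrt_iter n x) - sqrt_iter n (sqrt_iter n x))).
  rewrite (linopB (sqrt_iter_lin n.+1)) addrA subrK.
  rewrite (sqrt_iterS n.+1) [X in _ - X = _]sqrt_iterS -scalerBr.
  by rewrite opprD addrACA subrr add0r.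
have -> : scalar_iter n.+2 - scalar_iter n.+1 =
   2^-1 * (scalar_iter n.+1 * (scalar_iter n.+1 - scalar_iter n) +
     (scalar_iter n.+1 - scalar_iter n) * scalar_iter n).
  have yS k : scalar_iter k.+1 = 2^-1 * (1 + scalar_iter k ^+ 2) by [].
  by rewrite (yS n.+1) [X in _ - X = _]yS -mulrBr; congr (_ * _); ring.
rewrite normrZ gtr0_norm ?invr_gt0// -mulrA ler_pM2l ?invr_gt0//.
rewrite (le_trans (ler_normD _ _))// mulrDl lerD//.
  rewrite (le_trans (sqrt_iter_norm _ _))// -mulrA ler_wpM2l//.
  by have /andP[] := scalar_iter_bound n.+1.
rewrite (le_trans (IHn _))// -mulrA ler_wpM2l ?sqrt_iter_norm//.
by have := le_trans (normr_ge0 _) (sqrt_iter_norm n.+1 x);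
  have := le_trans (normr_ge0 _) (IHn x); have [->|x0] := eqVneq x 0;
  [rewrite subr_ge0 /=; have := sqr_ge0 (1 - scalar_iter n); nra
  |rewrite pmulr_lge0 ?normr_gt0].
Qed.

Definition sqrt_lim x : H := limn (sqrt_iter ^~ x).

Lemma sqrt_iter_cvg x : sqrt_iter n x @[n --> \oo] --> sqrt_lim x.
Proof.
apply: (@dominated_steps_cvg _ _ _ (fun n => scalar_iter n * `|x|)) => [n|].
  by rewrite -mulrBl sqrt_iter_step.
by apply: is_cvgMl; exact: scalar_iter_cvg.
Qed.

Lemma sqrt_lim_lin : linear sqrt_lim.
Proof.
move=> a x y; apply: (seq_cvg_unique (@sqrt_iter_cvg (a *: x + y))).
under eq_fun do rewrite sqrt_iter_lin.
by apply: cvgD; [apply: cvgZr|]; exact: sqrt_iter_cvg.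
Qed.

Lemma sqrt_lim_sa : selfadjoint sqrt_lim.
Proof.
move=> x y; have := @cvg_innerl _ _ _ _ (@sqrt_iter_cvg x) y.
under eq_fun do rewrite sqrt_iter_sa innerC.
move=> /cvg_lim <- //; rewrite [RHS]innerC.
by apply/cvg_lim => //; exact: (@cvg_innerl _ _ _ _ (@sqrt_iter_cvg y) x).
Qed.


Lemma sqrt_lim_norm x : `|sqrt_lim x| <= `|x|.
Proof.
have /cvg_norm h := @sqrt_iter_cvg x.
apply: (cvgr_to_le h); apply: nearW => n.
rewrite (le_trans (sqrt_iter_norm _ _))// ler_piMl//.
by have /andP[] := scalar_iter_bound n.
Qed.

Lemma sqrt_limE x : sqrt_lim x = 2^-1 *: (D x + sqrt_lim (sqrt_lim x)).
Proof.
have := @sqrt_iter_cvg x; rewrite -cvg_shiftS => h.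
apply: (seq_cvg_unique h) => /=.
apply: cvgZr; apply: cvgD; first exact: cvg_cst.
pose r n := `|sqrt_iter n x - sqrt_lim x| +
  `|sqrt_iter n (sqrt_lim x) - sqrt_lim (sqrt_lim x)|.
have r0 : r n @[n --> \oo] --> 0.
  have e z : `|sqrt_iter n z - sqrt_lim z| @[n --> \oo] --> (0 : R).
    rewrite -(normr0 H); apply: cvg_norm; rewrite -(subrr (sqrt_lim z)).
    by apply: cvgB; [exact: sqrt_iter_cvg|exact: cvg_cst].
  by rewrite -(addr0 (0 : R)); apply: cvgD; exact: e.
apply: (cvg_dist_le _ r0) => n; rewrite distrC.
have -> : sqrt_iter n (sqrt_iter n x) - sqrt_lim (sqrt_lim x) =
    sqrt_iter n (sqrt_iter n x - sqrt_lim x) +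
    (sqrt_iter n (sqrt_lim x) - sqrt_lim (sqrt_lim x)).
  by rewrite (linopB (sqrt_iter_lin n)) addrA subrK.
rewrite (le_trans (ler_normD _ _))// lerD//.
rewrite (le_trans (sqrt_iter_norm _ _))// ler_piMl//.
by have /andP[] := scalar_iter_bound n.
Qed.

Lemma sqrt_lim_comm C : bounded_op C -> (forall x, C (D x) = D (C x)) ->
  forall x, C (sqrt_lim x) = sqrt_lim (C x).
Proof.
move=> [lC cC] CD x.
have h n z : C (sqrt_iter n z) = sqrt_iter n (C z).
  elim: n z => [|n IHn] z /=; first by rewrite linop0.
  by rewrite linopZ// linopD// CD !IHn.
apply: seq_cvg_unique (@sqrt_iter_cvg (C x)).
under eq_fun do rewrite -h.
exact: (continuous_cvg _ (cC _) (@sqrt_iter_cvg x)).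
Qed.

End Iteration.

(** Cauchy-Schwarz for the form of [D] at [x] and [D x]. *)
Lemma positive_op_contraction D : positive_op D ->
  (forall x, inner (D x) x <= `|x| ^+ 2) -> forall x, `|D x| <= `|x|.
Proof.
move=> pD D1 x.
have [->|Dx0] := eqVneq (D x) 0; first by rewrite normr0.
rewrite -(@ler_pXn2r _ 2)// ?nnegrE//.
have := positive_op_CS x (D x) pD; rewrite inner_norm.
move=> h; have {h} : (`|D x| ^+ 2) ^+ 2 <= `|x| ^+ 2 * `|D x| ^+ 2.
  apply: (le_trans h); apply: ler_pM => //; by have [_ _] := pD; apply.
by rewrite expr2 ler_pM2r// exprn_gt0// normr_gt0.
Qed.

(** With [c] a bound for [B] and [D = I - B / c], take [P = sqrt c (I - Y)] where
    [Y = (D + Y^2) / 2].  As a limit of polynomials in [B], [P] commutes with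
    everything that commutes with [B]. *)
Lemma positive_op_sqrt B : positive_op B -> exists P,
  [/\ positive_op P, forall x, P (P x) = B x &
   forall C, bounded_op C -> (forall x, C (B x) = B (C x)) ->
     forall x, C (P x) = P (C x)].
Proof.
move=> pB; have [bB sB B0] := pB.
have [c c0 Bc] := bounded_op_bound bB.
pose D : H -> H := idfun - c^-1 *: B.
have bD : bounded_op D.
  by apply: bounded_opB; [exact: bounded_op_id|exact: bounded_opZ].
have sD : selfadjoint D.
  by apply: selfadjointB => //; exact: selfadjointZ.
have DE x : inner (D x) x = `|x| ^+ 2 - c^-1 * inner (B x) x.
  by rewrite /D !fctE innerBl /= innerZl inner_norm.
have pD : positive_op D.
  split => // x; rewrite DE subr_ge0 ler_pdivrMl//.
  rewrite (le_trans (ler_norm _))// (le_trans (inner_CS _ _))//.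
  by rewrite expr2 mulrA ler_wpM2r.
have D1 : forall x, `|D x| <= `|x|.
  apply: positive_op_contraction => // x.
  by rewrite DE gerBl mulr_ge0 ?invr_ge0 ?(ltW c0).
pose Y := sqrt_lim D.
have lY : linear Y by exact: sqrt_lim_lin.
have sY : selfadjoint Y by exact: sqrt_lim_sa.
have Y1 x : `|Y x| <= `|x| by exact: sqrt_lim_norm.
have bY : bounded_op Y.
  by apply/bounded_opP; split => //; exists 1 => // x; rewrite mul1r.
have YE x : Y (Y x) = 2 *: Y x - D x.
  rewrite [in RHS]/Y sqrt_limE// scalerA mulfV// scale1r -/Y.
  by rewrite addrC addKr.
pose P : H -> H := Num.sqrt c *: (idfun - Y).
have PE x : P x = Num.sqrt c *: (x - Y x) by [].
exists P; split.
- apply: positive_opZ; first exact: sqrtr_ge0.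
  split; first by apply: bounded_opB => //; exact: bounded_op_id.
    exact: selfadjointB.
  move=> x; rewrite !fctE innerBl inner_norm subr_ge0.
  rewrite (le_trans (ler_norm _))// (le_trans (inner_CS _ _))//.
  by rewrite expr2 ler_wpM2r.
- move=> x; rewrite !PE (linopZ lY) (linopB lY) -scalerBr scalerA -expr2.
  rewrite sqr_sqrtr ?(ltW c0)// YE.
  have -> : Y x - (2 *: Y x - D x) = D x - Y x.
    by rewrite scaler_nat mulr2n opprB addrC opprD addrA subrK.
  rewrite opprB addrA subrK /D !fctE /= opprB addrCA subrr addr0.
  by rewrite scalerA mulfV ?gt_eqF// scale1r.
- move=> C bC CB x; have [lC _] := bC.
  rewrite !PE linopZ// linopB// sqrt_lim_comm// => z.
  by rewrite /D !fctE /= linopB// linopZ// CB.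
Qed.

(** Two positive roots that commute agree: for [y = P1 x - P2 x] one has
    [P1 y + P2 y = 0], hence [P1 y = P2 y = 0] and [|y|^2 = 0].  Any positive root
    commutes with its square, hence with the root constructed above. *)
Lemma positive_op_sqrt_unique P P' : positive_op P -> positive_op P' ->
  (forall x, P (P x) = P' (P' x)) -> P = P'.
Proof.
have main P1 P2 : positive_op P1 -> positive_op P2 ->
    (forall x, P1 (P1 x) = P2 (P2 x)) ->
    (forall x, P1 (P2 x) = P2 (P1 x)) -> P1 = P2.
  move=> p1 p2 P12 cP; have [b1 s1 p1'] := p1; have [b2 s2 p2'] := p2.
  apply/funext => x; apply/eqP; rewrite -subr_eq0; apply/eqP/inner_eq0.
  pose y := P1 x - P2 x.
  have y0 : P1 y + P2 y = 0.
    rewrite /y (linopB (bounded_op_lin b1)) (linopB (bounded_op_lin b2)) P12 cP.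
    by rewrite addrA subrK subrr.
  have : inner (P1 y) y + inner (P2 y) y = 0 by rewrite -innerDl y0 inner0l.
  have := p1' y; have := p2' y => h2 h1 h.
  have P1y : P1 y = 0 by apply: positive_op_ker => //; lra.
  have P2y : P2 y = 0 by apply: positive_op_ker => //; lra.
  rewrite -[X in inner X _]/y innerBr -s1 -s2 P1y P2y !inner0l subrr//.
move=> pP pP' PP'.
have [Q [pQ QE Qc]] : exists Q, [/\ positive_op Q,
    forall x, Q (Q x) = P (P x) &
   forall C, bounded_op C -> (forall x, C (P (P x)) = P (P (C x))) ->
     forall x, C (Q x) = Q (C x)].
  apply: (@positive_op_sqrt (P \o P)); have [bP sP _] := pP; split.
  - exact: bounded_op_comp.
  - by move=> x y /=; rewrite !sP.
  - by move=> x /=; rewrite sP inner_ge0.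
have -> : P = Q.
  by apply: main => // x; apply: Qc => //; case: pP.
apply/esym; apply: main => // [x|x]; first by rewrite QE.
by apply: Qc; [case: pP'|move=> z; rewrite !PP'].
Qed.

(** The absolute value is the square root of [A^2], so it commutes with [A]. *)
Lemma abs_opP A : bounded_op A -> selfadjoint A ->
  [/\ positive_op (abs_op A), forall x, abs_op A (abs_op A x) = A (A x) &
      forall x, abs_op A (A x) = A (abs_op A x)].
Proof.
move=> bA sA.
have pAA : positive_op (A \o A).
  split; first exact: bounded_op_comp.
    by move=> x y /=; rewrite !sA.
  by move=> x /=; rewrite sA inner_ge0.
have [Q [pQ QE Qc]] := positive_op_sqrt pAA; have [bQ sQ _] := pQ.
have abs_sq P : is_abs_op A P -> positive_op P /\ forall x, P (P x) = A (A x).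
  move=> [bP /(op_le0P bP) pP PA]; split => // x.
  by apply: inner_ext => y; rewrite PA [RHS]sA.
have : is_abs_op A (abs_op A).
  apply: xgetPex; exists Q; split => //; first exact/op_le0P.
  by move=> x y; rewrite QE /= sA.
move=> /abs_sq[pP PE].
have -> : abs_op A = Q.
  by apply: positive_op_sqrt_unique => // x; rewrite PE QE.
by split => // x; rewrite Qc.
Qed.

End SquareRoot.

(** * Projections and traces *)

Section KernelProjection.
Context {R : realType} {H : hilbertType R}.
Implicit Types (x y z : H).

Lemma parallelogram x y :
  `|x + y| ^+ 2 + `|x - y| ^+ 2 = 2 * `|x| ^+ 2 + 2 * `|y| ^+ 2.
Proof.
rewrite -!inner_norm !(innerDl, innerDr, innerNl, innerNr) [inner y x]innerC.
ring.
Qed.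

(** A minimizing sequence for the distance from [x] to the kernel is Cauchy by the
    parallelogram identity; minimality of its limit [k] says that
    [r |-> |x - k + r z|^2] is minimal at [0] for [z] in the kernel. *)
Lemma kernel_closest_point (M : H -> H) x : bounded_op M ->
  exists k, M k = 0 /\ forall z, M z = 0 -> inner (x - k) z = 0.
Proof.
move=> [lM cM].
pose S : set R := [set `|x - k| ^+ 2 | k in [set k | M k = 0]].
have S0 : S !=set0 by exists (`|x - 0| ^+ 2), 0 => //=; exact: linop0.
have lS : has_lbound S by exists 0 => _ [k _ <-]; exact: sqr_ge0.
pose delta := inf S.
have delta_le k : M k = 0 -> delta <= `|x - k| ^+ 2.
  by move=> Mk; apply: ge_inf => //; exists k.
have /choice[k kE] n : exists k,
    M k = 0 /\ `|x - k| ^+ 2 < delta + n.+1%:R^-1.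
  have [|_ [k Mk <-] h] := @inf_adherent _ S n.+1%:R^-1 _ (conj S0 lS).
    by rewrite invr_gt0.
  by exists k.
have hk n m : `|k n - k m| ^+ 2 <= 2 * n.+1%:R^-1 + 2 * m.+1%:R^-1.
  have [Mn dn] := kE n; have [Mm dm] := kE m.
  have := delta_le (2^-1 *: (k n + k m)).
  rewrite linopZ// linopD// Mn Mm addr0 scaler0 => /(_ erefl) hd.
  have := parallelogram (x - k n) (x - k m).
  have -> : x - k n - (x - k m) = k m - k n.
    by rewrite opprB addrC addrA subrK.
  have -> : x - k n + (x - k m) = 2 *: (x - 2^-1 *: (k n + k m)).
    rewrite scalerBr scalerA mulfV// scale1r scaler_nat mulr2n opprD.
    by rewrite addrACA.
  rewrite normrZ exprMn ger0_norm// => h; rewrite distrC.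
  have : 2 ^+ 2 = 4 :> R by rewrite expr2; ring.
  move=> e; rewrite e in h.
  move: n.+1%:R^-1 m.+1%:R^-1 dn dm => p q dn dm; lra.
have ck : cvgn k.
  apply: cauchy_seq_cvg => e e0.
  have e2 : 0 < e ^+ 2 / 4 by rewrite divr_gt0// exprn_gt0.
  have /cvgr0Pnorm_lt/(_ _ e2)[N _ hN] := @cvg_harmonic R.
  exists N => n m Nn Nm; rewrite -(@ltr_pXn2r _ 2)// ?nnegrE ?(ltW e0)//.
  apply: le_lt_trans (hk n m) _; have := hN n Nn; have := hN m Nm.
  rewrite /= !ger0_norm ?invr_ge0//.
  by move: n.+1%:R^-1 m.+1%:R^-1 => p q; lra.
set l := limn k in ck.
have Ml : M l = 0.
  apply: (@seq_cvg_unique _ _ (M \o k)); first exact: (continuous_cvg _ (cM _) ck).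
  rewrite (_ : _ \o _ = cst 0); first exact: cvg_cst.
  by apply/funext => n /=; have [] := kE n.
exists l; split => // z Mz.
have ld : `|x - l| ^+ 2 <= delta.
  have h : `|x - k n| ^+ 2 @[n --> \oo] --> `|x - l| ^+ 2.
    rewrite expr2; under eq_fun do rewrite expr2.
    have h : `|x - k n| @[n --> \oo] --> `|x - l|.
      by apply: cvg_norm; apply: cvgB => //; exact: cvg_cst.
    exact: cvgM.
  have h' : delta + n.+1%:R^-1 @[n --> \oo] --> delta.
    rewrite -[X in _ --> X]addr0; apply: cvgD; first exact: cvg_cst.
    exact: cvg_harmonic.
  apply: (ler_cvg_to h h'); apply: nearW => n.
  by have [_ /ltW] := kE n.
apply/eqP; rewrite -sqrf_eq0 eq_le sqr_ge0 andbT.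
rewrite -(mul0r (inner z z)); apply: quad_ge0_discr; first exact: inner_ge0.
move=> r; rewrite add0r.
have := delta_le (l - r *: z).
rewrite linopB// linopZ// Ml Mz scaler0 subr0 => /(_ erefl) /(le_trans ld).
rewrite -!inner_norm opprB addrCA !(innerDl, innerDr, innerZl, innerZr).
rewrite [inner z x]innerC [inner z (- l)]innerC !innerNl !innerNr.
rewrite -subr_ge0; congr (0 <= _); ring.
Qed.

Lemma kernel_projection (M : H -> H) : bounded_op M -> exists E,
  [/\ bounded_op E, selfadjoint E, forall x, M (E x) = 0 &
      forall x, M x = 0 -> E x = x].
Proof.
move=> bM; have [lM _] := bM.
have /choice[E EP] x := kernel_closest_point x bM.
have uniq x k : M k = 0 -> (forall z, M z = 0 -> inner (x - k) z = 0) ->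
    E x = k.
  move=> Mk xk; have [MEx xEx] := EP x.
  apply/eqP; rewrite -subr_eq0; apply/eqP/inner_eq0.
  have MEk : M (E x - k) = 0 by rewrite linopB// MEx Mk subr0.
  have -> : inner (E x - k) (E x - k) =
      inner (x - k) (E x - k) - inner (x - E x) (E x - k).
    by rewrite -[RHS]innerBl opprB [x - k + _]addrC addrA subrK.
  by rewrite xk// xEx// subrr.
have orthE x z : M z = 0 -> inner (E x) z = inner x z.
  by move=> Mz; have [_ /(_ z Mz)] := EP x; rewrite innerBl => /eqP;
    rewrite subr_eq0 => /eqP.
have lE : linear E.
  move=> a x y; apply: uniq.
    by rewrite lM (EP x).1 (EP y).1 scaler0 addr0.
  move=> z Mz; rewrite innerBl !inner_linearl !orthE// subrr//.
exists E; split => //; last 2 first.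
- by move=> x; case: (EP x).
- by move=> x Mx; apply: uniq => // z _; rewrite subrr inner0l.
- apply/bounded_opP; split => //; exists 1 => // x; rewrite mul1r.
  have := inner_CS x (E x).
  have [ME _] := EP x; rewrite -(orthE x (E x) ME) inner_norm.
  have [->|Ex0] := eqVneq (E x) 0; first by rewrite normr0.
  by rewrite ger0_norm ?sqr_ge0// expr2 ler_pM2r// normr_gt0.
- move=> x y; have [MEx _] := EP x; have [MEy _] := EP y.
  by rewrite -[RHS]orthE// innerC -[LHS]orthE// innerC.
Qed.

End KernelProjection.

Section Trace.
Context {R : realType} {H : hilbertType R}.
Implicit Types (x y z : H) (A B C D S P : H -> H).
Variable b : nat -> H.

Definition onb_seq := [/\ ortho_seq b, complete_seq b &
   forall F : H -> \bar R, (forall x, 0 <= F x)%E -> F 0 = 0%E ->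
     (\esum_(e in @onb R H) F e = \sum_(i <oo) F (b i))%E].

Hypothesis hb : onb_seq.
Let ob : ortho_seq b. Proof. by case: hb. Qed.
Let cb : complete_seq b. Proof. by case: hb. Qed.

Local Open Scope ereal_scope.

Lemma trace_positiveE A : positive_op A ->
  trace A = \sum_(i <oo) (inner (A (b i)) (b i))%:E.
Proof.
move=> [[lA _] _ A0]; rewrite /trace.
have [_ _ /(_ (fun x => (inner (A x) x)%:E)) <-] := hb; last 2 first.
- by move=> x; rewrite lee_fin A0.
- by rewrite inner0r.
set f := fun e : H => _.
rewrite [X in _ - X]esum1 ?sube0 => [|e _].
  by apply: eq_esum => e _; rewrite funeposE max_l// lee_fin A0.
by rewrite funenegE max_r// leeNl oppe0 lee_fin A0.
Qed.

Lemma trace_ge0 A : positive_op A -> 0 <= trace A.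
Proof.
move=> pA; rewrite trace_positiveE//; apply: nneseries_ge0 => n _ _.
by rewrite lee_fin; case: pA.
Qed.

Lemma traceD A B : positive_op A -> positive_op B ->
  trace (A + B)%R = trace A + trace B.
Proof.
move=> pA pB; rewrite !trace_positiveE//; last exact: positive_opD.
rewrite -nneseriesD; last 2 first.
- by move=> n _ _; rewrite lee_fin; case: pA.
- by move=> n _ _; rewrite lee_fin; case: pB.
by apply: eq_eseriesr => i _; rewrite -EFinD -innerDl.
Qed.

Lemma traceZ (a : R) A : (0 <= a)%R -> positive_op A ->
  trace (a *: A)%R = a%:E * trace A.
Proof.
move=> a0 pA; rewrite !trace_positiveE//; last exact: positive_opZ.
rewrite -nneseriesZl; last by move=> n _; rewrite lee_fin; case: pA.
by apply: eq_eseriesr => i _; rewrite -EFinM -innerZl.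
Qed.

Lemma le_trace A B : positive_op A -> positive_op B ->
  (forall x, inner (A x) x <= inner (B x) x)%R -> trace A <= trace B.
Proof.
move=> pA pB AB; rewrite !trace_positiveE//; apply: lee_nneseries => [n _ _|n _].
  by rewrite lee_fin; case: pA.
by rewrite lee_fin.
Qed.

Lemma trace_leP A (c : \bar R) : positive_op A ->
  trace A <= c <->
  forall n, (\sum_(i < n) inner (A (b i)) (b i))%:E <= c.
Proof.
move=> pA; rewrite trace_positiveE//; split => [h n|h].
  apply: le_trans h; rewrite -sumEFin -(big_mkord xpredT (fun i => (inner (A (b i)) (b i))%:E)).
  by apply: nneseries_lim_ge => k _ _; rewrite lee_fin; case: pA.
apply: lime_le.
  by apply: is_cvg_nneseries => n _ _; rewrite lee_fin; case: pA.
by apply: nearW => n; rewrite big_mkord sumEFin.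
Qed.

(** Expand both sides with Parseval's identity and exchange the two sums. *)
Lemma hilbert_schmidt_adjoint S S' :
  (forall x y, inner (S x) y = inner x (S' y)) ->
  \sum_(i <oo) (`|S (b i)| ^+ 2)%:E = \sum_(i <oo) (`|S' (b i)| ^+ 2)%:E.
Proof.
move=> SS'; under eq_eseriesr do rewrite -(parseval _ ob cb).
under [RHS]eq_eseriesr do rewrite -(parseval _ ob cb).
rewrite nneseries_interchange; last first.
  by move=> i j; rewrite lee_fin sqr_ge0.
apply: eq_eseriesr => i _; apply: eq_eseriesr => j _.
by rewrite SS' innerC.
Qed.

(** With a square root, a trace becomes a Hilbert-Schmidt norm. *)
Lemma trace_sqrt A Q : positive_op A -> selfadjoint Q ->
  (forall x, Q (Q x) = A x) -> trace A = \sum_(i <oo) (`|Q (b i)| ^+ 2)%:E.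
Proof.
move=> pA sQ QA; rewrite trace_positiveE//; apply: eq_eseriesr => i _.
by rewrite -QA sQ inner_norm.
Qed.

Lemma positive_op_le_trace A x : positive_op A ->
  (inner (A x) x)%:E <= trace A * (`|x| ^+ 2)%:E.
Proof.
move=> pA; have [Q [pQ QA _]] := positive_op_sqrt pA; have [_ sQ _] := pQ.
rewrite (trace_sqrt pA sQ QA) -QA sQ inner_norm -(parseval (Q x) ob cb).
rewrite muleC -nneseriesZl; last by move=> i _; rewrite lee_fin sqr_ge0.
apply: lee_nneseries => i _; first by rewrite lee_fin sqr_ge0.
rewrite -EFinM lee_fin sQ -exprMn -(@real_normK _ (inner _ _)) ?num_real//.
by rewrite ler_pXn2r ?nnegrE ?mulr_ge0// inner_CS.
Qed.

(** With [Q] the square root of [A] and [F = I - E], the two traces are the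
    Hilbert-Schmidt norms of [Q E] and [Q F], hence of [E Q] and [F Q], and these
    add up to that of [Q] by Pythagoras. *)
Lemma trace_pinch A E : positive_op A -> bounded_op E -> selfadjoint E ->
  (forall x, E (E x) = E x) ->
  trace ((E \o A \o E) + ((idfun - E) \o A \o (idfun - E)))%R = trace A.
Proof.
move=> pA bE sE EE; have [Q [pQ QA _]] := positive_op_sqrt pA.
have [bQ sQ _] := pQ; have [lE _] := bE.
pose F : H -> H := (idfun - E)%R.
have bF : bounded_op F by apply: bounded_opB => //; exact: bounded_op_id.
have sF : selfadjoint F by exact: selfadjointB.
have conjE G : bounded_op G -> selfadjoint G ->
    trace (G \o A \o G) = \sum_(i <oo) (`|G (Q (b i))| ^+ 2)%:E.
  move=> bG sG; rewrite trace_positiveE; last by apply: positive_op_conj.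
  rewrite -(@hilbert_schmidt_adjoint (Q \o G) (G \o Q)) => [|x y /=].
    by apply: eq_eseriesr => i _ /=; rewrite sG -QA sQ inner_norm.
  by rewrite sQ sG.
rewrite traceD; [|by apply: positive_op_conj..].
rewrite !conjE// (trace_sqrt pA sQ QA) -nneseriesD; last 2 first.
- by move=> i _ _; rewrite lee_fin sqr_ge0.
- by move=> i _ _; rewrite lee_fin sqr_ge0.
apply: eq_eseriesr => i _; set q := Q (b i); rewrite -EFinD; congr (_%:E).
rewrite -!inner_norm !fctE /= innerBl !innerBr sE EE.
by rewrite [inner (E q) q]sE; ring.
Qed.

(** Jordan decomposition: on the kernel of [|D| - D], with projection [E], the
    operators [|D|] and [D] agree, on its orthogonal complement they are
    opposite, and [|D| + D], [|D| - D] live on one of the two pieces each. *)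
Lemma abs_op_split D : bounded_op D -> selfadjoint D -> exists E,
  [/\ bounded_op E, selfadjoint E, forall x, E (E x) = E x,
    forall x, abs_op D (E x) = D (E x) /\
      abs_op D (x - E x)%R = (- D (x - E x))%R &
    forall x, inner (abs_op D x + D x)%R x = (2 * inner (D (E x)) (E x))%R /\
      inner (abs_op D x - D x)%R x =
        (- (2 * inner (D (x - E x)) (x - E x)))%R].
Proof.
move=> bD sD.
have [pP PP PD] := abs_opP bD sD; set P := abs_op D in pP PP PD *.
have [bP sP P0] := pP; have [lP _] := bP; have [lD _] := bD.
have bM : bounded_op (P - D)%R by exact: bounded_opB.
have [E [bE sE ME Eker]] := kernel_projection bM.
have EE x : E (E x) = E x by rewrite Eker.
have EN x : E (P x + D x)%R = (P x + D x)%R.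
  rewrite Eker// !fctE (linopD lP) (linopD lD) PP PD.
  by rewrite [X in (_ - X)%R]addrC subrr.
have PE x : P (E x) = D (E x).
  by apply/eqP; rewrite -subr_eq0; apply/eqP; rewrite -[RHS](ME x).
have NE z : (P (E z) + D (E z) = P z + D z)%R.
  apply: inner_ext => y; rewrite innerDl sP sD -innerDr sE EN innerDr.
  by rewrite innerDl sP sD.
have PF x : (P (x - E x) = - D (x - E x))%R.
  apply/eqP; rewrite -addr_eq0 (linopB lP) (linopB lD); apply/eqP.
  by rewrite addrACA -opprD NE subrr.
have Nxx x : (inner (P x + D x) x = 2 * inner (D (E x)) (E x))%R.
  by rewrite -NE -EN sE innerDl PE; ring.
have Mxx x : (inner (P x - D x) x = - (2 * inner (D (x - E x)) (x - E x)))%R.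
  have -> : (P x - D x = P (x - E x) - D (x - E x))%R.
    by rewrite (linopB lP) (linopB lD) PE opprB addrA subrK.
  rewrite -[X in inner _ X = _](subrK (E x)) [LHS]innerDr PF.
  have -> : inner (- D (x - E x) - D (x - E x))%R (E x) = 0%R.
    by rewrite -{1}PF innerBl sP sD PE subrr.
  by rewrite addr0 innerBl innerNl; ring.
by exists E.
Qed.

Lemma abs_op_ge D x : bounded_op D -> selfadjoint D ->
  (`|inner (D x) x| <= inner (abs_op D x) x)%R.
Proof.
move=> bD sD; have [[_ _ P0] _ _] := abs_opP bD sD.
have [E [_ _ _ /(_ x) [PE PF] /(_ x) [N M]]] := abs_op_split bD sD.
have := P0 (E x); have := P0 (x - E x)%R; rewrite PE PF => h1 h2.
move: M N; rewrite innerBl innerDl ler_norml innerNl in h1 *; lra.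
Qed.

(** With [E] as in the Jordan decomposition and [F = I - E],
    [|D| = E D E - F D F <= E S E + F S F], and pinching preserves the trace. *)
Lemma trace_norm_sandwich D S : bounded_op D -> selfadjoint D -> positive_op S ->
  (forall x, `|inner (D x) x| <= inner (S x) x)%R -> trace_norm D <= trace S.
Proof.
move=> bD sD pS DS; rewrite /trace_norm.
have [pP _ _] := abs_opP bD sD.
have [E [bE sE EE _ NM]] := abs_op_split bD sD.
have Pxx x : inner (abs_op D x) x =
    (inner (D (E x)) (E x) - inner (D (x - E x)) (x - E x))%R.
  by have [] := NM x; rewrite innerBl innerDl; lra.
rewrite -(trace_pinch pS bE sE EE); apply: le_trace => //.
  apply: positive_opD; first by apply: positive_op_conj.
  apply: positive_op_conj => //; last exact: selfadjointB.
  by apply: bounded_opB => //; exact: bounded_op_id.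
move=> x; rewrite Pxx !fctE innerDl /= innerBl !sE.
have := DS (E x); have := DS (x - E x)%R.
rewrite !ler_norml => /andP[h1 h2] /andP[h3 h4].
move: h1; rewrite innerBr; lra.
Qed.


End Trace.

(** * The trace norm *)

Section TraceNorm.
Context {R : realType} {H : hilbertType R}.
Implicit Types (x y z : H) (A B C D S P : H -> H).
Variable b : nat -> H.
Hypothesis hb : onb_seq b.

(** The trace norm as a real number.  It is locked because only its properties
    matter, never the choices of a basis and of an absolute value behind it. *)
Definition tn : (H -> H) -> R := locked (fun A => fine (trace_norm A)).

Lemma tn_fine A : tn A = fine (trace_norm A).
Proof. by rewrite /tn -lock. Qed.

Lemma trace_class_sa_bounded A : trace_class_sa H A -> bounded_op A.
Proof. by case=> -[]. Qed.

Lemma trace_class_sa_sa A : trace_class_sa H A -> selfadjoint A.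
Proof. by case. Qed.

Lemma trace_norm_ge0 A : bounded_op A -> selfadjoint A -> (0 <= trace_norm A)%E.
Proof. by move=> bA sA; have [/(trace_ge0 hb)] := abs_opP bA sA. Qed.

Lemma tnE A : trace_class_sa H A -> trace_norm A = (tn A)%:E.
Proof.
move=> [[bA A_fin] sA]; rewrite tn_fine fineK// ge0_fin_numE//.
exact: trace_norm_ge0.
Qed.

Lemma tn_ge0 A : trace_class_sa H A -> 0 <= tn A.
Proof. by move=> [[bA _] sA]; rewrite tn_fine fine_ge0// trace_norm_ge0. Qed.

(** All bounds on trace norms are obtained by exhibiting a dominating positive
    operator; [tn_witness] shows that an optimal one always exists. *)
Lemma tn_sandwich A S (c : R) : bounded_op A -> selfadjoint A -> positive_op S ->
  (forall x, `|inner (A x) x| <= inner (S x) x) -> (trace S <= c%:E)%E ->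
  trace_class_sa H A /\ tn A <= c.
Proof.
move=> bA sA pS AS Sc; have h := trace_norm_sandwich hb bA sA pS AS.
have XA : trace_class_sa H A.
  by do 2!split => //; rewrite (le_lt_trans h)// (le_lt_trans Sc)// ltry.
by split => //; rewrite -lee_fin -tnE// (le_trans h).
Qed.

Lemma tn_witness A : trace_class_sa H A ->
  [/\ positive_op (abs_op A), trace (abs_op A) = (tn A)%:E &
      forall x, `|inner (A x) x| <= inner (abs_op A x) x].
Proof.
move=> XA; have [[bA _] sA] := XA; have [pA _ _] := abs_opP bA sA.
by split => //; [rewrite -tnE|move=> x; exact: abs_op_ge].
Qed.

Lemma trace_class_sa0 : trace_class_sa H 0 /\ tn 0 = 0.
Proof.
have [|||||X0 t0] := @tn_sandwich 0 0 0.
- exact: bounded_op0.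
- exact: selfadjoint0.
- exact: positive_op0.
- by move=> x; rewrite inner0l normr0.
- rewrite (trace_positiveE hb); last exact: positive_op0.
  by rewrite eseries0// => n _ _; rewrite inner0l.
by split => //; apply/eqP; rewrite eq_le t0 tn_ge0.
Qed.

Lemma trace_class_saD A B : trace_class_sa H A -> trace_class_sa H B ->
  trace_class_sa H (A + B) /\ tn (A + B) <= tn A + tn B.
Proof.
move=> XA XB; have [[bA _] sA] := XA; have [[bB _] sB] := XB.
have [pA tA hA] := tn_witness XA; have [pB tB hB] := tn_witness XB.
apply: (@tn_sandwich _ (abs_op A + abs_op B)).
- exact: bounded_opD.
- exact: selfadjointD.
- exact: positive_opD.
- by move=> x; rewrite !innerDl (le_trans (ler_normD _ _))// lerD.
- by rewrite (traceD hb)// tA tB.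
Qed.

Lemma trace_class_saZ a A : trace_class_sa H A ->
  trace_class_sa H (a *: A) /\ tn (a *: A) <= `|a| * tn A.
Proof.
move=> XA; have [[bA _] sA] := XA; have [pA tA hA] := tn_witness XA.
apply: (@tn_sandwich _ (`|a| *: abs_op A)).
- exact: bounded_opZ.
- exact: selfadjointZ.
- exact: positive_opZ.
- by move=> x; rewrite !innerZl normrM ler_wpM2l.
- by rewrite (traceZ hb)// tA EFinM.
Qed.

Lemma trace_class_saN A : trace_class_sa H A -> trace_class_sa H (- A).
Proof. by rewrite -scaleN1r => /(trace_class_saZ (-1))[]. Qed.

Lemma tnN A : trace_class_sa H A -> tn (- A) = tn A.
Proof.
have main B : trace_class_sa H B -> tn (- B) <= tn B.
  by rewrite -scaleN1r => /(trace_class_saZ (-1))[_]; rewrite normrN1 mul1r.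
move=> XA; apply/eqP; rewrite eq_le main//=.
by rewrite -[in leLHS](opprK A) main//; exact: trace_class_saN.
Qed.

Lemma trace_class_saB A B : trace_class_sa H A -> trace_class_sa H B ->
  trace_class_sa H (A - B).
Proof.
by move=> XA /trace_class_saN XB; have [] := trace_class_saD XA XB.
Qed.

Lemma tnB_le A B : trace_class_sa H A -> trace_class_sa H B ->
  tn (A - B) <= tn A + tn B.
Proof.
move=> XA XB; rewrite -(tnN XB).
by have [] := trace_class_saD XA (trace_class_saN XB).
Qed.

Lemma tn_distC A B : trace_class_sa H A -> trace_class_sa H B ->
  tn (A - B) = tn (B - A).
Proof. by move=> XA XB; rewrite -opprB tnN//; exact: trace_class_saB. Qed.

Lemma tn_triangle A B C : trace_class_sa H A -> trace_class_sa H B ->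
  trace_class_sa H C -> tn (A - C) <= tn (A - B) + tn (B - C).
Proof.
move=> XA XB XC; have -> : A - C = (A - B) + (B - C) by rewrite addrA subrK.
by have [] := trace_class_saD (trace_class_saB XA XB) (trace_class_saB XB XC).
Qed.

Lemma tn_dist_dist A B : trace_class_sa H A -> trace_class_sa H B ->
  `|tn A - tn B| <= tn (A - B).
Proof.
move=> XA XB; rewrite ler_norml.
have [_ h1] := trace_class_saD (trace_class_saB XA XB) XB.
have [_ h2] := trace_class_saD (trace_class_saB XB XA) XA.
rewrite subrK in h1; rewrite subrK tn_distC// in h2; lra.
Qed.

(** Polarization gives [2 |<A x, y>| <= tn A (s |x|^2 + s^-1 |y|^2)] for all [s > 0];
    the choice [s = |y| / |x|] balances the two terms. *)
Lemma tn_form A x y : trace_class_sa H A ->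
  `|inner (A x) y| <= tn A * (`|x| * `|y|).
Proof.
move=> XA; have [[bA _] sA] := XA; have [pA tA hA] := tn_witness XA.
have [lA _] := bA; have [[lP _] sP P0] := pA.
have quad z : inner (abs_op A z) z <= tn A * `|z| ^+ 2.
  by have := positive_op_le_trace hb z pA; rewrite tA -EFinM lee_fin.
have main r : 0 < r -> `|inner (A x) y| <=
    2^-1 * tn A * (r * `|x| ^+ 2 + r^-1 * `|y| ^+ 2).
  move=> r0; pose s := Num.sqrt r; have s0 : 0 < s by rewrite sqrtr_gt0.
  have rE : r = s ^+ 2 by rewrite sqr_sqrtr// ltW.
  pose u := s *: x; pose v := s^-1 *: y.
  have -> : inner (A x) y = inner (A u) v.
    by rewrite /u /v linopZ// innerZl innerZr mulrA mulfV ?gt_eqF// mul1r.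
  have -> : r * `|x| ^+ 2 = `|u| ^+ 2.
    by rewrite /u normrZ exprMn ger0_norm ?(ltW s0)// -rE.
  have -> : r^-1 * `|y| ^+ 2 = `|v| ^+ 2.
    by rewrite /v normrZ exprMn ger0_norm ?invr_ge0 ?(ltW s0)// exprVn -rE.
  have -> : inner (A u) v =
      (inner (A (u + v)) (u + v) - inner (A (u - v)) (u - v)) / 4.
    rewrite linopB// linopD// !(innerDl, innerDr, innerNl, innerNr).
    by rewrite [inner (A v) u]sA [inner v (A u)]innerC; field.
  have := hA (u + v); have := hA (u - v); have := quad (u + v).
  have := quad (u - v); have := parallelogram u v.
  rewrite !ler_norml; set p := `|u + v| ^+ 2; set q := `|u - v| ^+ 2.
  move=> pq h1 h2 /andP[h3 h4] /andP[h5 h6].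
  have e : tn A * p + tn A * q = tn A * (2 * `|u| ^+ 2 + 2 * `|v| ^+ 2).
    by rewrite -mulrDr pq.
  by move: e; set w := `|u| ^+ 2; set t := `|v| ^+ 2 => e; apply/andP; split;
    nra.
have t0 := tn_ge0 XA.
have [->|x0] := eqVneq x 0; first by rewrite linop0// inner0l !normr0 mul0r mulr0.
have [->|y0] := eqVneq y 0; first by rewrite inner0r !normr0 !mulr0.
have {x0}x0 : 0 < `|x| by rewrite normr_gt0.
have {y0}y0 : 0 < `|y| by rewrite normr_gt0.
apply: (le_trans (main (`|y| / `|x|) _)); first by rewrite divr_gt0.
move: `|x| `|y| (tn A) x0 y0 => p q t p0 q0.
suff -> : 2^-1 * t * (q / p * p ^+ 2 + (q / p)^-1 * q ^+ 2) = t * (p * q) by [].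
by field; rewrite !gt_eqF.
Qed.

Lemma tn_bound A x : trace_class_sa H A -> `|A x| <= tn A * `|x|.
Proof.
move=> XA; have [->|Ax] := eqVneq (A x) 0.
  by rewrite normr0 mulr_ge0// tn_ge0.
have := tn_form x (A x) XA; rewrite inner_norm ger0_norm ?sqr_ge0// mulrA.
by rewrite expr2 ler_pM2r// normr_gt0.
Qed.

Lemma tn_eq0 A : trace_class_sa H A -> tn A = 0 -> A = 0.
Proof.
move=> XA A0; apply/funext => x; apply/eqP; rewrite -normr_le0.
by rewrite (le_trans (tn_bound x XA))// A0 mul0r.
Qed.

Lemma positive_abs_op A : positive_op A -> abs_op A = A.
Proof.
move=> pA; have [bA sA _] := pA; have [pP PA _] := abs_opP bA sA.
exact: positive_op_sqrt_unique.
Qed.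

Lemma trace_norm_positive A : positive_op A -> trace_norm A = trace A.
Proof. by move=> pA; rewrite /trace_norm positive_abs_op. Qed.

Lemma trace_class_sa_positive A (c : R) : positive_op A ->
  (trace A <= c%:E)%E -> trace_class_sa H A /\ tn A <= c.
Proof.
move=> pA Ac; have [bA sA _] := pA.
have XA : trace_class_sa H A.
  by do 2!split => //; rewrite trace_norm_positive// (le_lt_trans Ac)// ltry.
by split => //; rewrite -lee_fin -tnE// trace_norm_positive.
Qed.


Lemma cvg_subseq (T : topologicalType) (x_ : nat -> T) (l : T) (j : nat -> nat) :
  (forall n, (n <= j n)%N) -> x_ n @[n --> \oo] --> l ->
  x_ (j n) @[n --> \oo] --> l.
Proof.
move=> nj; apply: cvg_comp => A [N _ NA]; exists N => // n /= Nn.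
by apply: NA => /=; exact: leq_trans (nj n).
Qed.

(** The partial sums are bounded through their traces, so they converge strongly,
    and each finite section of the trace passes to the limit. *)
Lemma positive_series (P_ : nat -> H -> H) (c : nat -> R) :
  (forall n, positive_op (P_ n)) -> (forall n, (trace (P_ n) <= (c n)%:E)%E) ->
  cvgn (series c) -> exists S, [/\ positive_op S,
    (trace S <= (limn (series c))%:E)%E &
    forall x n, \sum_(i < n) inner (P_ i x) x <= inner (S x) x].
Proof.
move=> pP Pc cc.
have XP n : trace_class_sa H (P_ n) /\ tn (P_ n) <= c n.
  exact: trace_class_sa_positive.
pose s n x := \sum_(i < n) P_ i x.
have s_lin n : linear (s n).
  move=> a x y; rewrite /s scaler_sumr -big_split /=; apply: eq_bigr => i _.
  by have [[lPi _] _ _] := pP i; rewrite lPi.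
have s_sa n : selfadjoint (s n).
  move=> x y; rewrite inner_suml inner_sumr; apply: eq_bigr => i _.
  by have [_ sPi _] := pP i; rewrite sPi.
have s_norm n x : `|s n x| <= series c n * `|x|.
  rewrite (le_trans (ler_norm_sum _ _ _))// /series/= big_mkord mulr_suml.
  apply: ler_sum => i _; have [XPi Pci] := XP i.
  by rewrite (le_trans (tn_bound _ XPi))// ler_wpM2r.
have s_cvg x : cvgn (s ^~ x).
  apply: (@dominated_steps_cvg _ _ _ (fun n => series c n * `|x|)) => [n|].
    rewrite /s big_ord_recr/= addrC addrK -mulrBl seriesSB.
    by have [XPi Pci] := XP n; rewrite (le_trans (tn_bound _ XPi))// ler_wpM2r.
  by apply: is_cvgMl.
have c0 n : 0 <= c n by have [/tn_ge0 h] := XP n; exact: le_trans.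
have sc_le n : series c n <= limn (series c).
  apply: nondecreasing_cvgn_le => //; apply/nondecreasing_seqP => m.
  by rewrite -subr_ge0 seriesSB.
pose S x := limn (s ^~ x).
have lS : linear S.
  move=> a x y; apply: (seq_cvg_unique (s_cvg (a *: x + y))).
  under eq_fun do rewrite s_lin.
  by apply: cvgD; [apply: cvgZr|]; exact: s_cvg.
have sSE x y : inner (s n x) y @[n --> \oo] --> inner (S x) y.
  exact: (@cvg_innerl _ _ _ _ (s_cvg x)).
have S_ge x n : \sum_(i < n) inner (P_ i x) x <= inner (S x) x.
  have nd : nondecreasing_seq (fun n => inner (s n x) x).
    apply/nondecreasing_seqP => m; rewrite /s big_ord_recr/= innerDl lerDl.
    by have [_ _] := pP m; apply.
  have := nondecreasing_cvgn_le nd (cvgP _ (sSE x x)) n.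
  by rewrite (cvg_lim _ (sSE x x))// inner_suml.
have pS : positive_op S.
  split.
  - apply/bounded_opP; split => //; exists (limn (series c) + 1) => [|x].
      by rewrite ltr_wpDl// (le_trans _ (sc_le 0%N))// /series/= big_geq.
    have /cvg_norm h := s_cvg x; apply: (cvgr_to_le h); apply: nearW => n.
    rewrite (le_trans (s_norm n x))// ler_wpM2r//.
    by rewrite (le_trans (sc_le n))// lerDl.
  - move=> x y; have := sSE x y; under eq_fun do rewrite s_sa innerC.
    by move=> /cvg_lim <- //; rewrite [RHS]innerC; exact/cvg_lim/sSE.
  - by move=> x; rewrite (le_trans _ (S_ge x 0%N))// big_ord0.
exists S; split => //.
apply/(trace_leP hb) => // n; rewrite lee_fin.
have h : \sum_(i < n) inner (s m (b i)) (b i) @[m --> \oo] -->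
    \sum_(i < n) inner (S (b i)) (b i).
  elim: n => [|n IHn].
    by rewrite big_ord0; under eq_fun do rewrite big_ord0; exact: cvg_cst.
  rewrite big_ord_recr/=; under eq_fun do rewrite big_ord_recr/=.
  by apply: cvgD => //; exact: sSE.
apply: (cvgr_to_le h); apply: nearW => m; apply: le_trans (sc_le m).
rewrite /series/= big_mkord; under eq_bigr do rewrite inner_suml.
rewrite exchange_big/=; apply: ler_sum => j _.
have := (trace_leP hb (c j)%:E (pP j)).1 (Pc j) n.
by rewrite lee_fin.
Qed.

(** The strong limit [A] exists.  Along a subsequence with geometrically decreasing
    steps [D i], the form of [A - u k] is dominated by that of the sum of the
    [|D i|], whose trace is at most twice a bound for the oscillation of [u] after [k]. *)
Lemma trace_class_complete (u : nat -> H -> H) :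
  (forall n, trace_class_sa H (u n)) ->
  (forall e : R, 0 < e -> exists k, forall m n, (k <= m)%N -> (k <= n)%N ->
     tn (u m - u n) < e) ->
  exists2 A, trace_class_sa H A & tn (u n - A) @[n --> \oo] --> 0.
Proof.
move=> Xu cu.
have u_cvg x : cvgn (u ^~ x).
  apply: cauchy_seq_cvg => e e0.
  have e0' : 0 < e / (`|x| + 1) by rewrite divr_gt0// ltr_wpDl.
  have [k hk] := cu _ e0'; exists k => m n km kn.
  have XB := trace_class_saB (Xu m) (Xu n).
  rewrite (le_lt_trans (tn_bound x XB))//.
  have := hk m n km kn; rewrite ltr_pdivlMr ?ltr_wpDl// => h.
  by rewrite (le_lt_trans _ h)// ler_wpM2l ?tn_ge0// lerDl.
pose A x := limn (u ^~ x).
have uA x y : inner (u n x) y @[n --> \oo] --> inner (A x) y.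
  exact: (@cvg_innerl _ _ _ _ (u_cvg x)).
have lA : linear A.
  move=> a x y; apply: (seq_cvg_unique (u_cvg (a *: x + y))).
  under eq_fun do rewrite (bounded_op_lin (trace_class_sa_bounded (Xu _))).
  by apply: cvgD; [apply: cvgZr|]; exact: u_cvg.
have sA : selfadjoint A.
  move=> x y; have := uA x y.
  under eq_fun do rewrite (trace_class_sa_sa (Xu _)) innerC.
  by move=> /cvg_lim <- //; rewrite [RHS]innerC; exact/cvg_lim/uA.
have bA : bounded_op A.
  have [k hk] := cu 1 ltr01.
  apply/bounded_opP; split => //; exists (tn (u k) + 1) => [|x].
    by rewrite ltr_wpDl// tn_ge0.
  have /cvg_norm h := u_cvg x; apply: (cvgr_to_le h).
  exists k => // n /= kn; rewrite (le_trans (tn_bound x (Xu n)))// ler_wpM2r//.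
  have [_ h'] := trace_class_saD (Xu k) (trace_class_saB (Xu n) (Xu k)).
  by rewrite addrC subrK in h'; rewrite (le_trans h')// lerD2l ltW// hk.
have tail (e : R) k : 0 < e ->
    (forall m n, (k <= m)%N -> (k <= n)%N -> tn (u m - u n) < e) ->
    trace_class_sa H (A - u k) /\ tn (A - u k) <= 2 * e.
  move=> e0 hk.
  have /choice[K hK] i : exists k', forall m n, (k' <= m)%N -> (k' <= n)%N ->
      tn (u m - u n) < e * 2^-1 ^+ i.+1.
    by apply: cu; rewrite mulr_gt0// exprn_gt0.
  pose fix j i := if i is i'.+1 then maxn (j i').+1 (K i') else k.
  have j_S i : (j i < j i.+1)%N by rewrite /= leq_maxl.
  have jk i : (k <= j i)%N.
    by elim: i => // i IHi; rewrite (leq_trans IHi)// ltnW.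
  have ji i : (i <= j i)%N.
    by elim: i => // i IHi; rewrite (leq_ltn_trans IHi).
  pose D i := u (j i.+1) - u (j i).
  have XD i : trace_class_sa H (D i) by exact: trace_class_saB.
  have Dn i : tn (D i) <= e * 2^-1 ^+ i.
    case: i => [|i]; first by rewrite expr0 mulr1 ltW// hk// jk.
    by rewrite ltW// hK// ?leq_maxr// (leq_trans _ (ltnW (j_S _)))// leq_maxr.
  have gE : [series e * 2^-1 ^+ i]_i @ \oo --> 2 * e.
    have := @cvg_geometric_series R e 2^-1.
    rewrite ger0_norm// invf_lt1// ltr1n => /(_ isT).
    have -> : 1 - 2^-1 = 2^-1 :> R by field.
    by rewrite invrK mulrC.
  have [S [pS tS hS]] := @positive_series (fun i => abs_op (D i))
    (fun i => e * 2^-1 ^+ i) (fun i => let: And3 h _ _ := tn_witness (XD i) in h)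
    ltac:(by move=> i; have [_ -> _] := tn_witness (XD i); rewrite lee_fin)
    (cvgP _ gE).
  rewrite (cvg_lim _ gE)// in tS.
  apply: (@tn_sandwich _ S) => //.
  - by apply: bounded_opB => //; exact: trace_class_sa_bounded.
  - by apply: selfadjointB => //; exact: trace_class_sa_sa.
  move=> x.
  have h : `|inner (u (j n) x) x - inner (u k x) x| @[n --> \oo] -->
      `|inner ((A - u k) x) x|.
    rewrite fctE innerBl; apply: cvg_norm; apply: cvgB; last exact: cvg_cst.
    exact: (cvg_subseq ji (uA x x)).
  apply: (cvgr_to_le h); apply: nearW => n.
  apply: le_trans (hS x n).
  elim: n => [|n IHn]; first by rewrite /= subrr normr0 big_ord0.
  rewrite big_ord_recr/=; have [_ _ /(_ x) hD] := tn_witness (XD n).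
  have h' : inner (D n x) x = inner (u (j n.+1) x) x - inner (u (j n) x) x.
    by rewrite -innerBl.
  move: hD IHn; rewrite h' !ler_norml.
  by move=> /andP[? ?] /andP[? ?]; apply/andP; split; lra.
have XA : trace_class_sa H A.
  have [k hk] := cu 1 ltr01; have [h _] := tail 1 k ltr01 hk.
  by rewrite -(subrK (u k) A); have [] := trace_class_saD h (Xu k).
exists A => //; apply/cvgrPdist_le => e e0.
have e2 : 0 < e / 2 by rewrite divr_gt0.
have [k hk] := cu _ e2; exists k => // n /= kn.
rewrite sub0r normrN ger0_norm; last by apply: tn_ge0; exact: trace_class_saB.
rewrite tn_distC//; have [|_] := tail _ n e2.
  by move=> m m' nm nm'; apply: hk; [exact: leq_trans nm|exact: leq_trans nm'].
by rewrite mulrC divfK.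
Qed.

End TraceNorm.

(** * Tightness and countable systems of constraints *)

Section Tightness.
Context {R : realType} {H : hilbertType R}.
Implicit Types (x y z v : H) (A B D S P : H -> H).
Variable b : nat -> H.
Hypothesis hb : onb_seq b.

Lemma positive_sum n (F : nat -> H -> H) (c : nat -> R) :
  (forall i, positive_op (F i)) -> (forall i, (trace (F i) <= (c i)%:E)%E) ->
  positive_op (\sum_(i < n) F i) /\
  (trace (\sum_(i < n) F i) <= (\sum_(i < n) c i)%:E)%E.
Proof.
move=> pF tF; elim: n => [|n [IHp IHt]].
  rewrite !big_ord0; split; first exact: positive_op0.
  rewrite (trace_positiveE hb); last exact: positive_op0.
  by rewrite eseries0// => i _ _; rewrite inner0l.
rewrite !big_ord_recr/=; split; first exact: positive_opD.
by rewrite (traceD hb)// EFinD leeD.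
Qed.

Definition rank_one v : H -> H := fun x => inner x v *: v.

(** Parseval's identity. *)
Lemma rank_one_positive v :
  positive_op (rank_one v) /\ trace (rank_one v) = (`|v| ^+ 2)%:E.
Proof.
have [ob cb _] := hb.
have pv : positive_op (rank_one v).
  split.
  - apply/bounded_opP; split => [a x y|].
      by rewrite /rank_one inner_linearl scalerDl scalerA.
    exists (`|v| ^+ 2 + 1) => [|x]; first by rewrite ltr_wpDl ?sqr_ge0.
    rewrite normrZ (le_trans (ler_wpM2r _ (inner_CS x v)))//.
    by rewrite -mulrA -expr2 mulrC ler_wpM2r// lerDl.
  - by move=> x y; rewrite innerZl innerZr [inner y v]innerC mulrC.
  - by move=> x; rewrite innerZl [inner v x]innerC -expr2 sqr_ge0.
split => //; rewrite (trace_positiveE hb)// -(parseval v ob cb).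
by apply: eq_eseriesr => i _; rewrite innerZl [inner v _]innerC -expr2.
Qed.

(** Write [x = p + r] with [p = P x].  The difference is [2 <A p, r> + <A r, r>]; its
    first term is at most [eta <A p, p> + eta^-1 <A r, r>], and
    [<A p, p> <= 2 <A x, x> + 2 <A r, r>]. *)
Lemma compress_form A P (eta : R) x : positive_op A -> orthogonal_projection P ->
  0 < eta ->
  `|inner (A x) x - inner (A (P x)) (P x)| <=
  2 * eta * inner (A x) x +
  (1 + eta^-1 + 2 * eta) * inner (compress P A x) x.
Proof.
move=> [[lA _] sA A0] [bP sP PP] eta0; set p := P x; pose r := x - p.
have sR : selfadjoint (idfun - P) by exact: selfadjointB.
have -> : inner (compress P A x) x = inner (A r) r by rewrite sR.
have -> : x = p + r by rewrite /r addrCA subrr addr0.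
clearbody r p.
have form (s t : R) : inner (A (s *: p + t *: r)) (s *: p + t *: r) =
   s ^+ 2 * inner (A p) p + 2 * (s * t) * inner (A p) r + t ^+ 2 * inner (A r) r.
  rewrite (linopD lA) !(linopZ lA) !(innerDl, innerDr, innerZl, innerZr).
  by rewrite [inner (A r) p]sA [inner r (A p)]innerC; ring.
(* positivity here is [<A p, p> <= 2 <A (p + r), p + r> + 2 <A r, r>] *)
have := A0 (1 *: p + 2 *: r); rewrite form.
have := A0 (eta *: p + 1 *: r); rewrite form.
have := A0 (eta *: p + (-1) *: r); rewrite form.
have := form 1 1; rewrite !scale1r => ->.
have := A0 p; have := A0 r.
set a := inner (A p) p; set m := inner (A p) r; set c := inner (A r) r.
move=> c0 a0 h1 h2 h3.
have h1' : - (eta * a + eta^-1 * c) <= - (2 * m).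
  have : 0 <= eta^-1 * (eta ^+ 2 * a + 2 * (eta * -1) * m + (-1) ^+ 2 * c).
    by rewrite mulr_ge0// invr_ge0 ltW.
  by have -> : eta^-1 * (eta ^+ 2 * a + 2 * (eta * -1) * m + (-1) ^+ 2 * c) =
    eta * a - 2 * m + eta^-1 * c; [field; rewrite gt_eqF|lra].
have h2' : - (eta * a + eta^-1 * c) <= 2 * m.
  have : 0 <= eta^-1 * (eta ^+ 2 * a + 2 * (eta * 1) * m + 1 ^+ 2 * c).
    by rewrite mulr_ge0// invr_ge0 ltW.
  by have -> : eta^-1 * (eta ^+ 2 * a + 2 * (eta * 1) * m + 1 ^+ 2 * c) =
    eta * a + 2 * m + eta^-1 * c; [field; rewrite gt_eqF|lra].
have h3' : eta * a <= eta * (2 * a + 4 * m + 4 * c).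
  by rewrite ler_pM2l//; lra.
have h4 : 0 <= eta^-1 * c by rewrite mulr_ge0// invr_ge0 ltW.
by rewrite ler_norml; apply/andP; split; lra.
Qed.

Lemma compress_positive A P : positive_op A -> orthogonal_projection P ->
  positive_op (compress P A).
Proof.
move=> pA [bP sP _]; apply: positive_op_conj => //; last exact: selfadjointB.
by apply: bounded_opB => //; exact: bounded_op_id.
Qed.

(** This is where compactness enters: among positive operators with little mass
    outside the range of [P], the trace distance is controlled by finitely many
    matrix entries.  The form of [A - B] is dominated by that of a
    multiple of [A], [B] and their compressions, coming from [compress_form], plus
    a diagonal operator in the system [f] that dominates the finite matrix of
    [P (A - B) P], since [2 |x_i x_j| <= x_i^2 + x_j^2]. *)
Lemma tight_dist A B P n (f : nat -> H) (lam th eta : R) :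
  positive_op A -> positive_op B -> orthogonal_projection P -> ortho_seq f ->
  (forall x, P x = fourier f n x) -> 0 < eta ->
  (trace A <= lam%:E)%E -> (trace B <= lam%:E)%E ->
  (trace (compress P A) <= th%:E)%E -> (trace (compress P B) <= th%:E)%E ->
  tn (A - B) <= 2 * (2 * eta * lam + (1 + eta^-1 + 2 * eta) * th) +
    \sum_(i < n) \sum_(j < n) `|inner (A (f i)) (f j) - inner (B (f i)) (f j)|.
Proof.
move=> pA pB oP [of_ nf] Pf eta0 tA tB tPA tPB.
have [bA sA _] := pA; have [bB sB _] := pB.
have kappa0 : 0 <= 1 + eta^-1 + 2 * eta.
  by rewrite !addr_ge0// ?mulr_ge0 ?invr_ge0 ?ltW.
have eta20 : 0 <= 2 * eta by rewrite mulr_ge0// ltW.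
pose T A := (2 * eta) *: A + (1 + eta^-1 + 2 * eta) *: compress P A.
have TE A' x : inner (T A' x) x = 2 * eta * inner (A' x) x +
    (1 + eta^-1 + 2 * eta) * inner (compress P A' x) x.
  by rewrite /T !fctE innerDl !innerZl.
have hT A' : positive_op A' -> (trace A' <= lam%:E)%E ->
    (trace (compress P A') <= th%:E)%E -> positive_op (T A') /\
    (trace (T A') <= (2 * eta * lam + (1 + eta^-1 + 2 * eta) * th)%:E)%E.
  move=> pA' tA' tPA'; have pc := compress_positive pA' oP.
  split; first by apply: positive_opD; exact: positive_opZ.
  rewrite (traceD hb); [|exact: positive_opZ..].
  rewrite !(traceZ hb)// [leRHS]EFinD [(2 * eta * lam)%:E]EFinM.
  by rewrite [(_ * th)%:E]EFinM leeD// lee_wpmul2l// lee_fin.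
have [pTA tTA] := hT A pA tA tPA; have [pTB tTB] := hT B pB tB tPB.
pose w (i j : nat) := `|inner (A (f i)) (f j) - inner (B (f i)) (f j)|.
have wC i j : w i j = w j i.
  by rewrite /w sA sB [inner (f i) _]innerC [inner (f i) (B _)]innerC.
pose c i := \sum_(j < n) w i j.
have c0 i : 0 <= c i by apply: sumr_ge0 => j _; exact: normr_ge0.
have [||pF tF] := @positive_sum n (fun i => c i *: rank_one (f i)) c.
- by move=> i; apply: positive_opZ => //; case: (rank_one_positive (f i)).
- move=> i; have [pf tf] := rank_one_positive (f i).
  rewrite (traceZ hb)// tf -EFinM lee_fin ler_piMr// -inner_norm.
  by case: (nf i) => ->; rewrite ?inner0l.
set F := \sum_(i < n) _ in pF tF.
have [|||||_ //] := @tn_sandwich _ _ b hb (A - B) (T A + T B + F)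
  (2 * (2 * eta * lam + (1 + eta^-1 + 2 * eta) * th) + \sum_(i < n) c i).
- exact: bounded_opB.
- exact: selfadjointB.
- by apply: positive_opD => //; exact: positive_opD.
- move=> x.
  have FE : inner (F x) x = \sum_(i < n) c i * inner x (f i) ^+ 2.
    rewrite /F fct_sumE inner_suml; apply: eq_bigr => i _.
    by rewrite /= innerZl /rank_one innerZl [inner (f i) x]innerC -expr2.
  have DE : `|inner (A (P x)) (P x) - inner (B (P x)) (P x)| <= inner (F x) x.
    have formE A' : bounded_op A' -> inner (A' (P x)) (P x) =
      \sum_(i < n) \sum_(j < n) inner x (f i) * inner x (f j) *
         inner (A' (f i)) (f j).
      move=> [lA' _]; rewrite Pf /fourier linop_sum// inner_suml.
      apply: eq_bigr => i _; rewrite inner_sumr; apply: eq_bigr => j _.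
      by rewrite linopZ// innerZl innerZr mulrA.
    rewrite !formE// -sumrB; under eq_bigr do rewrite -sumrB.
    apply: (@le_trans _ _ (\sum_(i < n) \sum_(j < n)
      (inner x (f i) ^+ 2 / 2 * w i j + inner x (f j) ^+ 2 / 2 * w j i))).
      rewrite (le_trans (ler_norm_sum _ _ _))//; apply: ler_sum => i _.
      rewrite (le_trans (ler_norm_sum _ _ _))//; apply: ler_sum => j _.
      rewrite [w j i]wC -mulrDl -mulrBr normrM ler_wpM2r//.
      rewrite ler_norml; have := sqr_ge0 (inner x (f i) + inner x (f j)).
      have := sqr_ge0 (inner x (f i) - inner x (f j)).
      rewrite !expr2 => h1 h2; apply/andP; split; lra.
    under eq_bigr do rewrite big_split/=.
    rewrite big_split/= [X in _ + X]exchange_big/= -big_split/= FE.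
    apply: ler_sum => i _.
    rewrite -!mulr_sumr -mulrDl -/(c i) mulrC ler_wpM2l//.
    by rewrite -splitr.
  have hA := compress_form x pA oP eta0; have hB := compress_form x pB oP eta0.
  have -> : inner ((A - B) x) x = inner (A x) x - inner (B x) x.
    by rewrite -innerBl.
  have -> : inner ((T A + T B + F) x) x =
      inner (T A x) x + inner (T B x) x + inner (F x) x.
    by rewrite -!innerDl.
  move: hA hB DE; rewrite -!TE !ler_norml.
  by move=> /andP[? ?] /andP[? ?] /andP[? ?]; apply/andP; split; lra.
- rewrite (traceD hb)//; last exact: positive_opD.
  rewrite (traceD hb)// EFinD leeD//.
  by rewrite mulr_natl mulr2n EFinD leeD.
Qed.

End Tightness.

Section Constraints.
Context {R : realType} {H : hilbertType R}.
Implicit Types (x y z v : H) (A B D S P : H -> H).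

Definition qsum (s : seq (R * H)) A : R :=
  \sum_(p <- s) p.1 * inner (A p.2) p.2.

Lemma qsumZ (s : seq (R * H)) c A : qsum s (c *: A) = c * qsum s A.
Proof.
by rewrite /qsum mulr_sumr; apply: eq_bigr => p _; rewrite /= innerZl mulrCA.
Qed.

Lemma qsumB (s : seq (R * H)) A B : qsum s (A - B) = qsum s A - qsum s B.
Proof.
by rewrite /qsum -sumrB; apply: eq_bigr => p _; rewrite !fctE innerBl mulrBr.
Qed.

Lemma cvg_inner (u v : nat -> H) x y : u n @[n --> \oo] --> x ->
  v n @[n --> \oo] --> y -> inner (u n) (v n) @[n --> \oo] --> inner x y.
Proof.
move=> ux vy.
have E p q : inner p q = 4^-1 * (`|p + q| * `|p + q| - `|p - q| * `|p - q|) :> R.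
  rewrite -!expr2 -!inner_norm !(innerDl, innerDr, innerNl, innerNr).
  by rewrite [inner q p]innerC; field.
rewrite E; under eq_fun do rewrite E.
apply: cvgMl_tmp; apply: cvgB; apply: cvgM; apply: cvg_norm;
  by [apply: cvgD|apply: cvgB].
Qed.

Lemma quadratic_ge0_dense A (d : nat -> H) : bounded_op A ->
  (forall x (e : R), 0 < e -> exists n, `|x - d n| < e) ->
  (forall n, 0 <= inner (A (d n)) (d n)) -> forall x, 0 <= inner (A x) x.
Proof.
move=> [lA cA] dd Ad x.
have /choice[k kE] n : exists k, `|x - d k| < n.+1%:R^-1.
  by apply: dd; rewrite invr_gt0.
have dx : d (k n) @[n --> \oo] --> x.
  apply: (@cvg_dist_le _ _ _ _ (fun n => n.+1%:R^-1)); first by move=> n; exact: ltW.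
  exact: cvg_harmonic.
have Adx : A (d (k n)) @[n --> \oo] --> A x.
  exact: (continuous_cvg _ (cA _) dx).
by apply: (cvgr_to_ge (cvg_inner Adx dx)); exact: nearW.
Qed.

(** Such conditions can be integrated in time, survive limits, and hold for almost
    every [t] as soon as each of their inequalities does. *)
Definition countably_linear (C : (H -> H) -> R -> Prop) :=
  exists (s : nat -> seq (R * H)) (gamma : nat -> R),
    forall A c, trace_class_sa H A ->
      (C A c <-> forall k, qsum (s k) A <= gamma k * c).

Lemma countably_linear_index (I : countType) (g : I -> seq (R * H) * R)
    (C : (H -> H) -> R -> Prop) :
  (forall A c, trace_class_sa H A ->
     (C A c <-> forall i, qsum (g i).1 A <= (g i).2 * c)) ->
  countably_linear C.
Proof.
move=> gC; exists (fun k => if choice.unpickle k is Some i then (g i).1 else [::]),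
  (fun k => if choice.unpickle k is Some i then (g i).2 else 0) => A c XA.
rewrite gC//; split => [h k|h i]; last by have := h (choice.pickle i); rewrite choice.pickleK.
by case: choice.unpickle => [i|]; [exact: h|rewrite /qsum big_nil mul0r].
Qed.

(** With [c = 1] the constraints on densities; with [c = t - s] those on the
    increments of paths. *)
Definition density_cond (Lambda : R) (P : nat -> H -> H) (theta : nat -> R)
    (A : H -> H) (c : R) :=
  [/\ op_le 0 A, (trace A <= (Lambda * c)%:E)%E &
      forall m, (trace (compress (P m) A) <= (theta m * c)%:E)%E].

Lemma qsum1 (v : nat -> H) n A :
  qsum [seq (1, v i) | i <- iota 0 n] A = \sum_(i < n) inner (A (v i)) (v i).
Proof.
have e : iota 0 n = index_iota 0 n by rewrite /index_iota subn0.
rewrite /qsum big_map e big_mkord; apply: eq_bigr => i _.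
by rewrite mul1r.
Qed.

(** Positivity is tested on a dense sequence, and a trace is bounded through its
    finite sections. *)
Lemma density_cond_countable (b : nat -> H) (Lambda : R) (P : nat -> H -> H)
    (theta : nat -> R) : separable H -> onb_seq b ->
  (forall m, orthogonal_projection (P m)) ->
  countably_linear (density_cond Lambda P theta).
Proof.
move=> /separable_dense_seq[d dd] hb oP.
pose g (i : (nat + nat) + (nat * nat)) : seq (R * H) * R :=
  match i with
  | inl (inl k) => ([:: (-1, d k)], 0)
  | inl (inr n) => ([seq (1, b i) | i <- iota 0 n], Lambda)
  | inr (m, n) => ([seq (1, b i - P m (b i)) | i <- iota 0 n], theta m)
  end.
apply: (@countably_linear_index _ g) => A c XA; have [[bA _] sA] := XA.
have posE : positive_op A <-> forall k, qsum (g (inl (inl k))).1 A <= 0.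
  rewrite /g /=; split => [[_ _ A0] k|h].
    by rewrite /qsum big_seq1 /= mulN1r oppr_le0.
  split => //; apply: (quadratic_ge0_dense bA dd) => k.
  by have := h k; rewrite /qsum big_seq1 /= mulN1r oppr_le0.
have compE m n : positive_op A -> qsum (g (inr (m, n))).1 A =
    \sum_(i < n) inner (compress (P m) A (b i)) (b i).
  move=> pA; rewrite qsum1; apply: eq_bigr => i _.
  by have [_ sP _] := oP m; rewrite /compress /= !fctE /= innerBl sP -innerBr.
split => [[/(op_le0P bA) pA tA tPA]|h].
  case=> [[k|n]|[m n]].
  - by rewrite mul0r; apply: posE.1.
  - by rewrite qsum1 -lee_fin; exact: (trace_leP hb _ pA).1.
  - rewrite compE// -lee_fin.
    exact: (trace_leP hb _ (compress_positive pA (oP m))).1.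
have pA : positive_op A.
  by apply: posE.2 => k; have := h (inl (inl k)); rewrite mul0r.
split; first exact/op_le0P.
- apply/(trace_leP hb) => // n; rewrite lee_fin.
  by have := h (inl (inr n)); rewrite qsum1.
- move=> m; apply/(trace_leP hb); first exact: compress_positive.
  by move=> n; rewrite lee_fin -compE//; exact: h (inr (m, n)).
Qed.

Lemma op_order_countable G : separable H -> bounded_op G -> op_le 0 G ->
  countably_linear (fun A c => op_le 0 A /\ op_le A (c *: G)).
Proof.
move=> /separable_dense_seq[d dd] bG /(op_le0P bG)[_ sG _].
pose g (i : bool * nat) : seq (R * H) * R :=
  if i.1 then ([:: (-1, d i.2)], 0)
  else ([:: (1, d i.2)], inner (G (d i.2)) (d i.2)).
apply: (@countably_linear_index _ g) => A c XA; have [[bA _] sA] := XA.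
have bD : bounded_op (c *: G - A) by apply: bounded_opB => //; exact: bounded_opZ.
have DE x : inner ((c *: G - A) x) x = c * inner (G x) x - inner (A x) x.
  by rewrite !fctE innerBl /= innerZl.
split => [[/(op_le0P bA)[_ _ A0] [_ AG]] [[] k]|h].
- by rewrite /g /qsum big_seq1/= mulN1r mul0r oppr_le0.
- by rewrite /g /qsum big_seq1/= mul1r mulrC -subr_ge0 -DE.
split.
  apply/op_le0P => //; split => //; apply: (quadratic_ge0_dense bA dd) => k.
  by have := h (true, k); rewrite /g /qsum big_seq1/= mulN1r mul0r oppr_le0.
split; first by apply: selfadjointB => //; exact: selfadjointZ.
apply: (quadratic_ge0_dense bD dd) => k; rewrite DE subr_ge0.
by have := h (false, k); rewrite /g /qsum big_seq1/= mul1r mulrC.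
Qed.

End Constraints.

(** * Lebesgue measure on the line *)

Section AlmostEverywhere.
Context {R : realType}.
Local Notation mu := (@lebesgue_measure R).

Lemma ae_imply (P Q : R -> Prop) : (forall t, P t -> Q t) ->
  {ae mu, forall t, P t} -> {ae mu, forall t, Q t}.
Proof.
move=> PQ [N [mN N0 PN]]; exists N; split => // t /= nQ.
by apply: PN => /= p; exact/nQ/PQ.
Qed.

Lemma ae_conj (P Q : R -> Prop) : {ae mu, forall t, P t} ->
  {ae mu, forall t, Q t} -> {ae mu, forall t, P t /\ Q t}.
Proof.
move=> [N [mN N0 PN]] [M [mM M0 QM]]; exists (N `|` M); split.
- exact: measurableU.
- by apply: null_set_setU.
- move=> t /= nPQ; apply: contrapT => /not_orP[nN nM]; apply: nPQ; split.
    by apply: contrapT => nP; apply: nN; exact: PN.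
  by apply: contrapT => nQ; apply: nM; exact: QM.
Qed.

Lemma ae_forall_nat (P : nat -> R -> Prop) :
  (forall n, {ae mu, forall t, P n t}) -> {ae mu, forall t, forall n, P n t}.
Proof.
move=> hP; have /negligible_bigcup : forall n, mu.-negligible (~` [set t | P n t]).
  exact: hP.
apply: negligibleS => t /= /existsNP[n nP]; by exists n.
Qed.

Lemma ae_interior T (Q : R -> Prop) :
  {ae mu, forall t, 0 < t < T -> Q t} -> ae_on `[0, T] Q.
Proof.
move=> [N [mN N0 QN]]; have n1 (r : R) : mu.-negligible [set r].
  exists [set r]; split => //; exact: lebesgue_measure_set1.
have /negligibleS : mu.-negligible (N `|` ([set 0] `|` [set T])).
  by apply: negligibleU; [exists N; split|exact: negligibleU].
apply => t /= /not_implyP[]; rewrite in_itv/= => /andP[t0 tT] nQ.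
move: t0; rewrite le_eqVlt => /predU1P[<-|t0]; first by right; left.
move: tT; rewrite le_eqVlt => /predU1P[->|tT]; first by right; right.
by left; apply: QN => /= h; apply: nQ; apply: h; rewrite t0.
Qed.

End AlmostEverywhere.

Lemma lebesgue_integrableS (R : realType) (D E : set R) (f : R -> \bar R) :
  measurable D -> measurable E -> E `<=` D ->
  (@lebesgue_measure R).-integrable D f -> (@lebesgue_measure R).-integrable E f.
Proof. by move=> mD mE ED; apply: integrableS. Qed.

Lemma ae_le_integral (R : realType) (D : set R) (f g : R -> R) : measurable D ->
  (@lebesgue_measure R).-integrable D (EFin \o f) ->
  (@lebesgue_measure R).-integrable D (EFin \o g) ->
  ae_on D (fun t => f t <= g t) ->
  (\int[lebesgue_measure]_(t in D) (f t)%:E <=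
   \int[lebesgue_measure]_(t in D) (g t)%:E)%E.
Proof.
move=> mD fi gi fg; set mu := lebesgue_measure.
have fin h : mu.-integrable D (EFin \o h) ->
  (\int[mu]_(t in D) (h t)%:E)%E \is a fin_num by exact: integrable_fin_num.
rewrite -sube_ge0 ?fin// -integralB//.
have di : mu.-integrable D (fun t => ((g t)%:E - (f t)%:E)%E).
  exact: integrableB.
have mdi := measurable_int _ di.
have -> : (\int[mu]_(t in D) ((g t)%:E - (f t)%:E) =
    \int[mu]_(t in D) `|(g t)%:E - (f t)%:E|)%E.
  apply: ae_eq_integral => //; first exact: (measurableT_comp _ mdi).
  apply: ae_imply fg => t h Dt.
  by rewrite gee0_abs// -EFinB lee_fin subr_ge0 h.
by apply: integral_ge0 => t _; exact: abse_ge0.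
Qed.

Section Translation.
Context {R : realType}.
Local Notation mu := (@lebesgue_measure R).
Implicit Types (s t : R) (A D : set R).

Lemma measurable_shift s :
  measurable_fun [set: R] (fun x : R => s + x : measurableTypeR R).
Proof. exact: measurable_funD. Qed.

Lemma measurable_preimage_shift s A : measurable A ->
  measurable [set x | A (s + x)].
Proof.
by move=> mA; rewrite -[X in measurable X]setTI; exact: measurable_shift.
Qed.

Lemma lebesgue_measure_shift s A : measurable A ->
  mu [set x | A (s + x)] = mu A.
Proof.
move=> mA; transitivity (pushforward mu (fun x : R => s + x : measurableTypeR R) A).
  by [].
apply/esym/lebesgue_measure_unique => //=; first exact: measurable_shift.
move=> ms _ [[a c]] _ <-.
have -> : pushforward mu (fun x : R => s + x : measurableTypeR R) `]a, c] =
    mu `]a - s, c - s]%classic.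
  by congr (mu _); apply/seteqP; split => x /=; rewrite !in_itv/= => /andP[? ?];
    apply/andP; split; lra.
rewrite !lebesgue_measure_itv/= !lte_fin ltrD2r; case: ifP => // _.
by rewrite -!EFinB; congr (_%:E); ring.
Qed.

Lemma ae_shift s (Q : R -> Prop) : {ae mu, forall x, Q x} ->
  {ae mu, forall x, Q (s + x)}.
Proof.
move=> [N [mN N0 QN]]; exists [set x | N (s + x)]; split.
- exact: measurable_preimage_shift.
- by rewrite lebesgue_measure_shift.
- by move=> x /= h; exact: QN.
Qed.

Lemma eq_integral_shift s D (f : R -> \bar R) : measurable D ->
  (\int[pushforward mu (fun x : R => (s + x)%R : measurableTypeR R)]_(x in D) f x =
   \int[mu]_(x in D) f x)%E.
Proof.
move=> mD; apply: eq_measure_integral => [|ms A mA _].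
  exact: measurable_shift.
exact: lebesgue_measure_shift.
Qed.

Lemma integrable_shift s (f : R -> \bar R) :
  mu.-integrable [set: R] f -> mu.-integrable [set: R] (fun x => f (s + x)).
Proof.
move=> /integrableP[mf fi]; apply/integrableP; split.
  by apply: measurableT_comp => //; exact: measurable_shift.
have <- : (\int[pushforward mu (fun x : R => (s + x)%R : measurableTypeR R)]_x
    `|f x| = \int[mu]_x `|f (s + x)%R|)%E.
  rewrite ge0_integral_pushforward//; first exact: measurable_shift.
  exact: measurableT_comp.
by rewrite eq_integral_shift.
Qed.

Lemma integral_shift s D (f : R -> \bar R) : measurable D ->
  mu.-integrable [set: R] f ->
  (\int[mu]_(x in [set x | D (s + x)%R]) f (s + x)%R = \int[mu]_(x in D) f x)%E.
Proof.
move=> mD fi; have /integrableP[mf _] := fi.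
rewrite -[RHS](eq_integral_shift s)//.
rewrite [RHS]integral_pushforward//; first exact: measurable_shift.
apply: (integrableS measurableT) => //; last exact: integrable_shift.
exact: measurable_preimage_shift.
Qed.

End Translation.

Section LipschitzDensity.
Context {R : realType}.
Local Notation mu := (@lebesgue_measure R).

Lemma lebesgue_stieltjes_itv (F : cumulative R R) (a c : R) : a <= c ->
  lebesgue_stieltjes_measure F `]a, c]%classic = (F c - F a)%:E.
Proof.
move=> ac; rewrite /lebesgue_stieltjes_measure /measure_extension.
by rewrite measurable_mu_extE/= ?wlength_itv_bnd//; exact: is_ocitv.
Qed.

(** The Stieltjes measures of [F] and of [G = id - F] add up to Lebesgue measure. *)
Lemma stieltjes_le_lebesgue (F G : cumulative R R) :
  (forall x, F x + G x = x) ->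
  forall A : set R, measurable A ->
    (lebesgue_stieltjes_measure F A <= mu A)%E.
Proof.
move=> FG A mA.
rewrite [leRHS](_ : _ = lebesgue_stieltjes_measure F A +
    lebesgue_stieltjes_measure G A)%E; first by rewrite leeDl.
rewrite -measure_addE; apply: lebesgue_measure_unique => // _ [[a c] _ <-].
rewrite [RHS]measure_addE lebesgue_measure_itv/= lte_fin; case: ltP => ac.
  rewrite !lebesgue_stieltjes_itv ?ltW// -[RHS]EFinD -[LHS]EFinB; congr (_%:E).
  by rewrite -{1}(FG c) -{1}(FG a); ring.
by rewrite set_itv_ge ?bnd_simp -?leNgt// !measure0 adde0.
Qed.

(** The Stieltjes measure of [f] is dominated by Lebesgue measure, so that the
    Radon-Nikodym theorem provides [g]. *)
Lemma lipschitz_density (f : R -> R) (T : R) : 0 <= T ->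
  (forall x y, x <= y -> 0 <= f y - f x <= y - x) ->
  exists g : R -> R, [/\ mu.-integrable [set: R] (EFin \o g) &
    forall t, 0 <= t <= T ->
      (\int[mu]_(r in `[0%R, t]) (g r)%:E = (f t - f 0)%:E)%E].
Proof.
move=> T0 hf.
have cf (h : R -> R) : (forall x y, x <= y -> 0 <= h y - h x <= y - x) ->
    exists F : cumulative R R, F = h :> (R -> R).
  move=> hh; have nd : nondecreasing h.
    by move=> x y /hh/andP[+ _]; rewrite subr_ge0.
  have rc : right_continuous h.
    apply: right_continuousW => x; apply/cvgrPdist_le => /= e e0.
    near=> y; have [xy|yx] := leP x y.
      rewrite distrC ger0_norm; last by have /andP[] := hh _ _ xy.
      have /andP[_ h1] := hh _ _ xy; apply: (le_trans h1).
      apply: (le_trans (ler_norm _)); rewrite distrC; near: y.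
      exact: (@cvgr_dist_le _ _ _ _ _ id x cvg_id).
    have /andP[h0 h1] := hh _ _ (ltW yx).
    rewrite ger0_norm//; apply: (le_trans h1).
    apply: (le_trans (ler_norm _)); near: y.
    exact: (@cvgr_dist_le _ _ _ _ _ id x cvg_id).
  by exists (HB.pack_for (cumulative R R) h (isCumulative.Build R _ R h nd rc)).
have [F FE] := cf f hf.
have [G GE] : exists G : cumulative R R, G = (fun x => x - f x) :> (R -> R).
  by apply: cf => x y /hf /andP[h1 h2]; apply/andP; split; lra.
have FG x : F x + G x = x by rewrite FE GE addrC subrK.
have nu_mu := stieltjes_le_lebesgue FG.
pose D : set (measurableTypeR R) := `]0, T]%classic.
have mD : measurable D by exact: (@measurable_itv R).
have nuD : (lebesgue_stieltjes_measure F D < +oo)%E.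
  by rewrite lebesgue_stieltjes_itv// ltry.
pose nu : {finite_measure set (measurableTypeR R) -> \bar R} := mfrestr mD nuD.
have nu_dom : nu `<< (mu : set (measurableTypeR R) -> \bar R).
  apply/null_content_dominatesP => A mA A0; apply/eqP.
  rewrite eq_le measure_ge0 andbT -A0 /nu /= /mfrestr /mrestr.
  apply: (le_trans (nu_mu _ _)); first exact: measurableI.
  by apply: le_measure => //; rewrite inE//; exact: measurableI.
have [g [g0 gfin ig gE]] := radon_nikodym_sigma_finite nu_dom.
have gEF : g = EFin \o (fine \o g) by apply/funext => x /=; rewrite fineK.
exists (fine \o g); split; first by rewrite -gEF.
move=> t /andP[t0 tT].
transitivity (\int[mu]_(r in `[0%R, t]) g r)%E.
  by apply: eq_integral => x _ /=; rewrite fineK.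
rewrite -gE; last exact: measurable_itv.
rewrite /nu /= /mfrestr /mrestr.
have -> : `[0, t] `&` D = `]0, t]%classic.
  apply/seteqP; split => x /=; rewrite /D /= !in_itv/=.
    by move=> [/andP[_ ->] /andP[-> _]].
  by move=> /andP[x0 xt]; rewrite (ltW x0) xt x0 (le_trans xt).
by rewrite lebesgue_stieltjes_itv// FE.
Unshelve. all: by end_near. Qed.

End LipschitzDensity.

Section GridSlope.
Context {R : realType}.
Local Notation mu := (@lebesgue_measure R).
Implicit Types (T t : R) (n : nat).

(** The index of the cell containing [t] in the uniform partition of [[0, T]] into
    [n + 1] cells. *)
Definition grid_index T n t : nat := Num.truncn (t * n.+1%:R / T).
Definition grid_point T n (k : nat) : R := T * k%:R / n.+1%:R.

Definition grid_slope T n (f : R -> R) t : R :=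
  n.+1%:R / T * (f (grid_point T n (grid_index T n t).+1) -
                 f (grid_point T n (grid_index T n t))).

Lemma grid_pointS T n k : grid_point T n k.+1 = grid_point T n k + T / n.+1%:R.
Proof. by rewrite /grid_point -natr1 mulrDr mulr1 mulrDl. Qed.

Lemma grid_bounds T n t : 0 <= t < T ->
  [/\ 0 <= grid_point T n (grid_index T n t),
      grid_point T n (grid_index T n t) <= t,
      t < grid_point T n (grid_index T n t).+1,
      grid_point T n (grid_index T n t).+1 <= T & (grid_index T n t < n.+1)%N].
Proof.
move=> /andP[t0 tT]; have T0 : 0 < T by exact: le_lt_trans tT.
rewrite /grid_point; set k := grid_index T n t.
have /andP[k1 k2] : k%:R <= t * n.+1%:R / T < k.+1%:R.
  by apply: truncn_itv; rewrite divr_ge0 ?mulr_ge0// ltW.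
rewrite ler_pdivlMr// in k1; rewrite ltr_pdivrMr// in k2.
have kn : (k < n.+1)%N.
  rewrite -(ltr_nat R) -(ltr_pM2r T0); apply: (le_lt_trans k1).
  by rewrite mulrC ltr_pM2l.
split => //.
- by rewrite divr_ge0// mulr_ge0// ltW.
- by rewrite ler_pdivrMr// mulrC.
- by rewrite ltr_pdivlMr// [T * _]mulrC.
- by rewrite ler_pdivrMr// ler_pM2l// ler_nat.
Qed.

(** The cells shrink to [t], and [t] lies in each of them, so the slope of [F] over
    the cell is a convex combination of difference quotients at [t]. *)
Lemma grid_slope_cvg T (F : R -> R) t : 0 <= t < T -> derivable F t 1 ->
  grid_slope T n F t @[n --> \oo] --> derive1 F t.
Proof.
move=> tT dF; have T0 : 0 < T by case/andP: tT; exact: le_lt_trans.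
have /cvgrPdist_le dFl : h^-1 *: (F (h + t) - F t) @[h --> 0%R^'] --> derive1 F t.
  have := dF; rewrite /derivable/= => h; rewrite derive1E.
  have := h; rewrite /derive/= /GRing.scale/=; under eq_fun do rewrite mulr1.
  by [].
apply/cvgrPdist_le => /= e e0.
have [d /= d0 hd] := dFl _ e0.
have lin v : `|v - t| < d -> `|F v - F t - derive1 F t * (v - t)| <= e * `|v - t|.
  move=> vtd; have [->|vt] := eqVneq v t.
    by rewrite !subrr mulr0 subr0 normr0 mulr0.
  have vt0 : v - t != 0 by rewrite subr_eq0.
  have := hd (v - t); rewrite /= sub0r normrN subrK => /(_ vtd vt0).
  rewrite distrC => h.
  have -> : F v - F t - derive1 F t * (v - t) =
      ((v - t)^-1 *: (F v - F t) - derive1 F t) * (v - t).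
    by rewrite /GRing.scale/=; field.
  by rewrite normrM ler_wpM2r.
have d20 : 0 < d / T by rewrite divr_gt0.
have /cvgr0Pnorm_lt/(_ _ d20)[N _ hN] := @cvg_harmonic R.
exists N => // n /= Nn.
have [h0 h1 h2 h3 _] := grid_bounds n tT; move: h0 h1 h2 h3.
rewrite /grid_slope; set k := grid_index T n t; rewrite grid_pointS.
set u := grid_point T n k => u0 ut tv vT.
have Td : T / n.+1%:R < d.
  have := hN n Nn; rewrite /= ger0_norm ?invr_ge0// => h.
  by rewrite mulrC -ltr_pdivlMr.
have w0 : 0 < T / n.+1%:R by rewrite divr_gt0.
have -> : n.+1%:R / T = (T / n.+1%:R)^-1 by rewrite invf_div.
move: (T / n.+1%:R) Td w0 tv vT => w Td w0 tv vT.
have lu : `|F u - F t - derive1 F t * (u - t)| <= e * (t - u).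
  have := lin u; rewrite (_ : `|u - t| = t - u).
    by apply; clear -Td tv; lra.
  by rewrite distrC ger0_norm// subr_ge0.
have lv : `|F (u + w) - F t - derive1 F t * (u + w - t)| <= e * (u + w - t).
  have := lin (u + w); rewrite (_ : `|u + w - t| = u + w - t).
    by apply; clear -Td ut; lra.
  by rewrite ger0_norm// subr_ge0 ltW.
rewrite -(ler_pM2r w0) -[X in `|_| * X](ger0_norm (ltW w0)) -normrM.
rewrite mulrBl mulrAC mulVf ?gt_eqF// mul1r.
move: lu lv; rewrite !ler_norml => /andP[? ?] /andP[? ?].
by apply/andP; split; lra.
Qed.

(** Lebesgue's differentiation theorem. *)
Lemma grid_slope_ae T (f g : R -> R) : mu.-integrable [set: R] (EFin \o g) ->
  (forall t, 0 <= t <= T ->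
     (\int[mu]_(r in `[0%R, t]) (g r)%:E = (f t - f 0)%:E)%E) ->
  {ae mu, forall t, 0 < t < T -> grid_slope T n f t @[n --> \oo] --> g t}.
Proof.
move=> ig fg.
have iS (D : set R) : measurable D -> mu.-integrable D (EFin \o g).
  by move=> mD; exact: (integrableS measurableT).
have locg : locally_integrable [set: R] g.
  by apply: open_integrable_locally => //; exact: openT.
have := @FTC1 R g (BLeft 0) (fun y => iS _ (measurable_itv _)) locg.
apply: filterS; first exact: (ae_filter_ringOfSetsType mu).
move=> t h /andP[t_gt0 t1]; have t0 := ltW t_gt0.
have tT : 0 <= t < T by rewrite t0.
have [dF <-] := h ltac:(by rewrite /= lte_fin).
have := grid_slope_cvg tT dF; apply: cvg_trans; apply: near_eq_cvg.
apply: nearW => n; rewrite /grid_slope; congr (_ * _).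
have [h0 h1 h2 h3 _] := grid_bounds n tT.
rewrite /Rintegral !fg/=; first by rewrite opprB addrA subrK.
  by rewrite h0 (le_trans h1)// ltW.
by rewrite h3 (le_trans t0)// ltW.
Qed.

End GridSlope.

(** * Simple functions *)

Section SimpleFunctions.
Context {R : realType} {H : hilbertType R}.
Local Notation mu := (@lebesgue_measure R).
Implicit Types (u v f g : R -> H -> H) (D E : set R) (A B : H -> H).

Lemma simple_preimage u (S : set (H -> H)) : simple_fun u ->
  measurable (u @^-1` S).
Proof.
move=> [_ fu mu_]; rewrite (_ : u @^-1` S =
  \bigcup_(A in range u `&` S) u @^-1` [set A]).
  by apply: fin_bigcup_measurable => //; exact: finite_setIl.
apply/seteqP; split => [t /= St|t [A [_ SA] /= ->]//].
by exists (u t) => //; split => //; exists t.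
Qed.

Lemma simple_fun_comp2 u v (F : (H -> H) -> (H -> H) -> H -> H) :
  simple_fun u -> simple_fun v ->
  (forall A B, trace_class_sa H A -> trace_class_sa H B ->
     trace_class_sa H (F A B)) ->
  simple_fun (fun t => F (u t) (v t)).
Proof.
move=> su sv XF; have [Xu fu mu_] := su; have [Xv fv mv] := sv; split.
- by move=> t; exact: XF.
- by apply: finite_image11.
- move=> C; rewrite (_ : _ @^-1` _ = \bigcup_(A in range u)
    (u @^-1` [set A] `&` v @^-1` [set B | F A B = C])).
    apply: fin_bigcup_measurable => // A _; apply: measurableI => //.
    exact: simple_preimage.
  apply/seteqP; split => [t /= <-|t [A _ [/= -> //]]].
  by exists (u t) => //; exists t.
Qed.

(** The density operations are built from this form, with [phi] a translation. *)
Lemma simple_fun_piece u v (e : pred R) (phi : R -> R) :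
  simple_fun u -> simple_fun v -> measurable [set t | e t] ->
  (forall E, measurable E -> measurable (phi @^-1` E)) ->
  simple_fun (fun t => if e t then u (phi t) else v t).
Proof.
move=> su sv me mphi; have [Xu fu mu_] := su; have [Xv fv mv] := sv; split.
- by move=> t; case: ifP.
- apply: (@sub_finite_set _ _ (range u `|` range v)); last by rewrite finite_setU.
  by move=> _ [t _ <-]; case: ifP => _; [left; exists (phi t)|right; exists t].
- move=> C; rewrite (_ : _ @^-1` _ =
    ([set t | e t] `&` phi @^-1` (u @^-1` [set C])) `|`
    (~` [set t | e t] `&` v @^-1` [set C])).
    apply: measurableU; apply: measurableI => //; first exact: mphi.
    exact: measurableC.
  apply/seteqP; split => [t /=|t /= [[-> ->]//|[/negP/negbTE -> ->]//]].
  by case: ifPn => et ?; [left|right; split => //; exact/negP].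
Qed.

Lemma simple_fun_cst A : trace_class_sa H A -> simple_fun (fun=> A).
Proof.
move=> XA; split => //.
  apply: (@sub_finite_set _ _ [set A]); last exact: finite_set1.
  by move=> _ [t _ <-].
by move=> B; rewrite preimage_cst; case: ifP.
Qed.

Lemma simple_measurable u D (phi : (H -> H) -> R) : simple_fun u ->
  measurable_fun D (fun t => phi (u t)).
Proof.
move=> su mD Y mY; apply: measurableI => //.
exact: (simple_preimage (phi @^-1` Y) su).
Qed.

Lemma simple_integrable u D (phi : (H -> H) -> R) : simple_fun u ->
  measurable D -> (mu D < +oo)%E ->
  mu.-integrable D (fun t => (phi (u t))%:E).
Proof.
move=> su mD Doo; apply: measurable_bounded_integrable => //.
  exact: simple_measurable.
have [_ fu _] := su.
exists (\sum_(A <- fset_set (range u)) `|phi A|); split; first exact: num_real.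
move=> x hx t _ /=; apply/ltW/(le_lt_trans _ hx).
rewrite (big_fsetD1 (u t))/=; first by rewrite lerDl sumr_ge0.
by rewrite in_fset_set//; apply/mem_set; exists t.
Qed.

Lemma integral_simple u D (phi : (H -> H) -> R) : simple_fun u ->
  measurable D -> (mu D < +oo)%E ->
  (\int[mu]_(t in D) (phi (u t))%:E = (\sum_(A <- fset_set (range u))
     fine (mu (D `&` u @^-1` [set A])) * phi A)%:E)%E.
Proof.
move=> su mD Doo; have [_ fu mu_] := su.
have uE t : phi (u t) =
    \sum_(A <- fset_set (range u)) phi A * \1_(u @^-1` [set A]) t.
  rewrite (big_fsetD1 (u t))/=; last by rewrite in_fset_set//; apply/mem_set; exists t.
  rewrite indicE mem_set// mulr1 big1_fset ?addr0// => A.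
  rewrite !inE => /andP[/eqP At _] _; rewrite indicE memNset ?mulr0//.
  by move=> /= e; apply: At.
under eq_integral do rewrite uE -sumEFin.
have i1 A : mu.-integrable D (fun t => (\1_(u @^-1` [set A]) t)%:E).
  exact: (@simple_integrable u D (\1_[set A]) su).
have iA A : mu.-integrable D (fun t => (phi A * \1_(u @^-1` [set A]) t)%:E).
  under eq_fun do rewrite EFinM.
  exact: integrableZl.
rewrite integral_sum// -sumEFin; apply: eq_bigr => A _.
under eq_integral do rewrite EFinM.
rewrite integralZl//.
rewrite integral_indic; [|exact: mD|exact: mu_].
rewrite muleC setIC EFinM fineK// ge0_fin_numE//.
apply: le_lt_trans Doo; apply: le_measure; last exact: subIsetl.
  by apply/mem_set; exact: (measurableI _ _ mD (mu_ A)).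
exact/mem_set.
Qed.

End SimpleFunctions.

(** * Strong measurability and the Bochner integral *)

Section Bochner.
Context {R : realType} {H : hilbertType R}.
Local Notation mu := (@lebesgue_measure R).
Implicit Types (u v f g : R -> H -> H) (D E : set R) (A B : H -> H) (x y : H).
Variable b : nat -> H.
Hypothesis hb : onb_seq b.

Lemma squeeze_cvg0 (u_ r : nat -> R) : (forall n, 0 <= u_ n <= r n) ->
  r n @[n --> \oo] --> 0 -> u_ n @[n --> \oo] --> 0.
Proof.
move=> ur r0; apply: (squeeze_cvgr _ (cvg_cst 0) r0); exact: nearW.
Qed.

Lemma trace_norm_cvg0 (w : nat -> H -> H) : (forall n, trace_class_sa H (w n)) ->
  trace_norm (w n) @[n --> \oo] --> 0%E <-> tn (w n) @[n --> \oo] --> 0.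
Proof.
move=> Xw; under eq_fun do rewrite (tnE hb (Xw _)); split.
  by move=> /fine_cvgP[_].
by move=> h; apply: cvg_EFin => //; exact: nearW.
Qed.

Lemma tn_dist_cvg (u_ v_ : nat -> H -> H) A B :
  (forall n, trace_class_sa H (u_ n)) -> (forall n, trace_class_sa H (v_ n)) ->
  trace_class_sa H A -> trace_class_sa H B ->
  tn (u_ n - A) @[n --> \oo] --> 0 -> tn (v_ n - B) @[n --> \oo] --> 0 ->
  tn (u_ n - v_ n) @[n --> \oo] --> tn (A - B).
Proof.
move=> Xu Xv XA XB uA vB.
have s0 : tn (u_ n - A) + tn (v_ n - B) @[n --> \oo] --> 0.
  by rewrite -(addr0 (0 : R)); exact: cvgD.
have d0 : `|tn (u_ n - v_ n) - tn (A - B)| @[n --> \oo] --> 0.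
  apply: (squeeze_cvg0 _ s0) => n; rewrite normr_ge0/=.
  have h := tn_dist_dist hb (trace_class_saB hb (Xu n) (Xv n))
    (trace_class_saB hb XA XB).
  apply: (le_trans h).
  have -> : u_ n - v_ n - (A - B) = (u_ n - A) - (v_ n - B).
    by rewrite !opprB addrACA [RHS]addrACA [- v_ n + _]addrC.
  by apply: (tnB_le hb); apply: (trace_class_saB hb).
have /cvgrPdist_le d0' := d0.
apply/cvgrPdist_le => /= e /d0'; apply: filterS => n /=.
by rewrite sub0r normrN normr_id distrC.
Qed.

Lemma inner_op_cvg (u_ : nat -> H -> H) A x y :
  (forall n, trace_class_sa H (u_ n)) -> trace_class_sa H A ->
  tn (u_ n - A) @[n --> \oo] --> 0 ->
  inner (u_ n x) y @[n --> \oo] --> inner (A x) y.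
Proof.
move=> Xu XA uA.
have s0 : tn (u_ n - A) * (`|x| * `|y|) @[n --> \oo] --> 0.
  by rewrite -(mul0r (`|x| * `|y|)); exact: cvgMr_tmp.
have d0 : `|inner (u_ n x) y - inner (A x) y| @[n --> \oo] --> 0.
  apply: (squeeze_cvg0 _ s0) => n; rewrite normr_ge0/= -innerBl.
  exact: (tn_form hb x y (trace_class_saB hb (Xu n) XA)).
have /cvgrPdist_le d0' := d0.
apply/cvgrPdist_le => /= e /d0'; apply: filterS => n /=.
by rewrite sub0r normrN normr_id distrC.
Qed.


(** The Bochner integrals of this file are computed through their matrix entries,
    which are Lebesgue integrals. *)
Definition weak_int D f A := forall x y,
  mu.-integrable D (fun t => (inner (f t x) y)%:E) /\
  (\int[mu]_(t in D) (inner (f t x) y)%:E = (inner (A x) y)%:E)%E.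

Lemma weak_int_unique D f A B : weak_int D f A -> weak_int D f B -> A = B.
Proof.
move=> fA fB; apply/funext => x; apply: inner_ext => y.
have [_ hA] := fA x y; have [_ hB] := fB x y.
by move: hB; rewrite hA => -[].
Qed.

Lemma weak_intB D f g A B : measurable D ->
  weak_int D f A -> weak_int D g B -> weak_int D (f - g) (A - B).
Proof.
move=> mD fA gB x y; have [iA hA] := fA x y; have [iB hB] := gB x y.
have e t : (inner ((f - g) t x) y)%:E =
    ((inner (f t x) y)%:E - (inner (g t x) y)%:E)%E.
  by rewrite -EFinB -innerBl.
split; first by under eq_fun do rewrite e; exact: integrableB.
under eq_integral do rewrite e.
by rewrite integralB// hA hB -EFinB -innerBl.
Qed.

Lemma simple_integralE u D : simple_fun u -> simple_integral D u =
  \sum_(A <- fset_set (range u)) fine (mu (D `&` u @^-1` [set A])) *: A.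
Proof. by move=> [_ fu _]; rewrite /simple_integral fsbig_finite. Qed.

Lemma weak_int_simple u D : measurable D -> (mu D < +oo)%E -> simple_fun u ->
  weak_int D u (simple_integral D u).
Proof.
move=> mD Doo su x y.
split; first exact: (simple_integrable (fun A => inner (A x) y) su mD Doo).
rewrite (integral_simple (fun A => inner (A x) y) su mD Doo); congr (_%:E).
rewrite simple_integralE// fct_sumE inner_suml; apply: eq_bigr => A _.
by rewrite /= innerZl.
Qed.

Lemma simple_integral_tn u D : measurable D -> (mu D < +oo)%E -> simple_fun u ->
  trace_class_sa H (simple_integral D u) /\
  ((tn (simple_integral D u))%:E <= \int[mu]_(t in D) (tn (u t))%:E)%E.
Proof.
move=> mD Doo su; rewrite (integral_simple (@tn R H) su mD Doo) lee_fin.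
rewrite simple_integralE//; have [Xu fu _] := su.
have Xr A : A \in fset_set (range u) -> trace_class_sa H A.
  by rewrite in_fset_set// => /set_mem[t _ <-].
move: Xr; set r : seq _ := fset_set (range u).
change ((forall A, A \in r -> trace_class_sa H A) ->
  trace_class_sa H (\sum_(A <- r) fine (mu (D `&` u @^-1` [set A])) *: A) /\
  tn (\sum_(A <- r) fine (mu (D `&` u @^-1` [set A])) *: A) <=
  \sum_(A <- r) fine (mu (D `&` u @^-1` [set A])) * tn A).
elim: r => [_|A s IH Xr].
  by rewrite !big_nil; have [X0 t0] := trace_class_sa0 hb; rewrite t0.
have [|Xs ts] := IH.
  by move=> B Bs; apply: Xr; rewrite inE Bs orbT.
have XA : trace_class_sa H A by apply: Xr; rewrite mem_head.
set c := fun A => fine (mu (D `&` u @^-1` [set A])).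
have [XcA tcA] := trace_class_saZ hb (c A) XA.
have [XS tS] := trace_class_saD hb XcA Xs.
rewrite !big_cons; split => //; apply: (le_trans tS); apply: lerD => //.
by rewrite (le_trans tcA)// ger0_norm// fine_ge0.
Qed.

Lemma simple_funB u v : simple_fun u -> simple_fun v -> simple_fun (u - v).
Proof.
move=> su sv; apply: (simple_fun_comp2 (F := fun A B => A - B) su sv) => A B.
exact: (trace_class_saB hb).
Qed.

Lemma simple_integral_dist u v D : measurable D -> (mu D < +oo)%E ->
  simple_fun u -> simple_fun v ->
  ((tn (simple_integral D u - simple_integral D v))%:E <=
     \int[mu]_(t in D) (tn (u t - v t))%:E)%E.
Proof.
move=> mD Doo su sv; have suv := simple_funB su sv.
have -> : simple_integral D u - simple_integral D v = simple_integral D (u - v).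
  apply: (@weak_int_unique D (u - v)); last exact: weak_int_simple.
  by apply: weak_intB => //; exact: weak_int_simple.
by have [] := simple_integral_tn mD Doo suv.
Qed.


Lemma strongly_measurable_simple D u : simple_fun u -> strongly_measurable D u.
Proof.
move=> su; have [Xu _ _] := su; split=> [t _|]; first exact: Xu.
exists (fun=> u) => // t _; have [X0 t0] := trace_class_sa0 hb.
rewrite (_ : (fun n => trace_norm (u t - u t)) = cst 0%E); first exact: cvg_cst.
by apply/funext => n; rewrite subrr (tnE hb X0) t0.
Qed.

Lemma strongly_measurableS D E f : E `<=` D -> strongly_measurable D f ->
  strongly_measurable E f.
Proof.
move=> ED [Xf [u su uf]]; split=> [t /ED|]; first exact: Xf.
by exists u => // t /ED; exact: uf.
Qed.

Lemma strongly_measurableP D f : strongly_measurable D f <->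
  (forall t, D t -> trace_class_sa H (f t)) /\
  exists2 u : nat -> R -> H -> H, forall n, simple_fun (u n) &
    forall t, D t -> tn (u n t - f t) @[n --> \oo] --> 0.
Proof.
by split => -[Xf [u su uf]]; split => //; exists u => // t Dt;
  (apply/trace_norm_cvg0 => [n|]; last exact: uf);
  apply: (trace_class_saB hb) => //; [case: (su n)|exact: Xf|case: (su n)|exact: Xf].
Qed.

(** Approximate by simple functions, for which the preimages are finite unions. *)
Lemma strongly_measurable_comp D f g (phi : (H -> H) -> (H -> H) -> R) :
  strongly_measurable D f -> strongly_measurable D g ->
  (forall (u_ v_ : nat -> H -> H) A B, (forall n, trace_class_sa H (u_ n)) ->
    (forall n, trace_class_sa H (v_ n)) ->
    trace_class_sa H A -> trace_class_sa H B ->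
    tn (u_ n - A) @[n --> \oo] --> 0 -> tn (v_ n - B) @[n --> \oo] --> 0 ->
    phi (u_ n) (v_ n) @[n --> \oo] --> phi A B) ->
  measurable_fun D (fun t => phi (f t) (g t)).
Proof.
move=> /strongly_measurableP[Xf [u su uf]].
move=> /strongly_measurableP[Xg [v sv vg]] hphi.
apply: (measurable_fun_cvg (h := fun n t => phi (u n t) (v n t))).
  move=> n mD Y mY; apply: measurableI => //.
  rewrite (_ : _ @^-1` _ = \bigcup_(A in range (u n))
    (u n @^-1` [set A] `&` v n @^-1` [set B | Y (phi A B)])).
    have [_ fu mu_] := su n.
    apply: fin_bigcup_measurable => // A _; apply: measurableI => //.
    exact: simple_preimage.
  apply/seteqP; split => [t /= Yt|t [A _ [/= -> //]]].
  by exists (u n t) => //; exists t.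
move=> t Dt; apply: hphi; try by move=> n; case: (su n) (sv n) => ? ? ? [].
- exact: Xf.
- exact: Xg.
- exact: uf.
- exact: vg.
Qed.

Lemma measurable_tn_dist D f g : strongly_measurable D f ->
  strongly_measurable D g -> measurable_fun D (fun t => tn (f t - g t)).
Proof.
move=> mf mg; apply: (strongly_measurable_comp (phi := fun A B => tn (A - B)))
  => // *; exact: tn_dist_cvg.
Qed.

Lemma measurable_tn D f : strongly_measurable D f ->
  measurable_fun D (fun t => tn (f t)).
Proof.
move=> mf; have [X0 _] := trace_class_sa0 hb.
have := measurable_tn_dist mf (strongly_measurable_simple D (simple_fun_cst X0)).
by under eq_fun do rewrite subr0.
Qed.

Lemma measurable_inner D f x y : strongly_measurable D f ->
  measurable_fun D (fun t => inner (f t x) y).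
Proof.
move=> mf; apply: (strongly_measurable_comp
  (phi := fun A B => inner (A x) y) mf mf) => // *; exact: inner_op_cvg.
Qed.

Lemma strongly_measurableB D f g : strongly_measurable D f ->
  strongly_measurable D g -> strongly_measurable D (f - g).
Proof.
move=> /strongly_measurableP[Xf [u su uf]].
move=> /strongly_measurableP[Xg [v sv vg]].
apply/strongly_measurableP; split => [t Dt|].
  by apply: (trace_class_saB hb) => //; [exact: Xf|exact: Xg].
exists (fun n => u n - v n) => [n|t Dt]; first exact: simple_funB.
have s0 : tn (u n t - f t) + tn (v n t - g t) @[n --> \oo] --> 0.
  by rewrite -(addr0 (0 : R)); apply: cvgD; [exact: uf|exact: vg].
apply: (squeeze_cvg0 _ s0) => n.
have Xuf : trace_class_sa H (u n t - f t).
  by apply: (trace_class_saB hb) => //; [case: (su n)|exact: Xf].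
have Xvg : trace_class_sa H (v n t - g t).
  by apply: (trace_class_saB hb) => //; [case: (sv n)|exact: Xg].
have -> : (u n - v n) t - (f - g) t = (u n t - f t) - (v n t - g t).
  transitivity (u n t - v n t - (f t - g t)); first by [].
  exact: subrBB.
by rewrite (tnB_le hb)// andbT (tn_ge0 hb)//; apply: (trace_class_saB hb).
Qed.

Lemma L1_distE D f g : strongly_measurable D f -> strongly_measurable D g ->
  L1_dist D f g = (\int[mu]_(t in D) (tn (f t - g t))%:E)%E.
Proof.
move=> [Xf _] [Xg _]; apply: eq_integral => t /set_mem Dt.
rewrite (tnE hb)//; apply: (trace_class_saB hb) => //; [exact: Xf|exact: Xg].
Qed.


Section Bounded.
Variables (D : set R) (f : R -> H -> H) (C : R).
Hypotheses (mD : measurable D) (Doo : (mu D < +oo)%E)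
  (mf : strongly_measurable D f) (fC : ae_on D (fun t => tn (f t) <= C)).

Let Xf t : D t -> trace_class_sa H (f t). Proof. by case: mf => + _; apply. Qed.

(** Where the approximating simple functions exceed the bound [C + 1] of [f], replace
    them by [0]: this changes no limit and permits dominated convergence. *)
Lemma simple_approx_L1 : exists2 v : nat -> R -> H -> H,
  forall n, simple_fun (v n) &
  (\int[mu]_(t in D) (tn (f t - v n t))%:E)%E @[n --> \oo] --> 0%E.
Proof.
have [_ [u su uf]] := (strongly_measurableP D f).1 mf.
pose cut A : H -> H := if tn A <= C + 1 then A else 0.
have [X0 t0] := trace_class_sa0 hb.
have Xcut A : trace_class_sa H A -> trace_class_sa H (cut A).
  by rewrite /cut; case: ifP.
have sv n : simple_fun (fun t => cut (u n t)).
  exact: (simple_fun_comp2 (F := fun A _ => cut A) (su n) (su n)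
    (fun A B XA _ => Xcut A XA)).
exists (fun n t => cut (u n t)) => //.
pose g n t := (tn (f t - cut (u n t)))%:E.
have mg n : measurable_fun D (g n).
  apply/measurable_EFinP; apply: measurable_tn_dist => //.
  exact: (strongly_measurable_simple D (sv n)).
have := @dominated_convergence _ _ _ mu D mD g (cst 0%E)
  (fun t => (`|C| + (`|C| + 1))%:E) mg (measurable_cst _).
case.
- move: fC; apply: ae_imply => t fCt Dt; have {}fCt := fCt Dt.
  have uft := uf t Dt; apply: cvg_EFin; first exact: nearW.
  have fut : tn (f t - u n t) @[n --> \oo] --> 0.
    under eq_fun do rewrite (tn_distC hb (Xf Dt) (let: And3 h _ _ := su _ in h t)).
    exact: uft.
  apply: cvg_trans fut; apply: near_eq_cvg.
  have /cvgrPdist_le/(_ 1 ltr01) := uft; apply: filterS => n /=.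
  rewrite sub0r normrN => h; rewrite /cut ifT//.
  have Xun : trace_class_sa H (u n t) by case: (su n).
  have Xuf := trace_class_saB hb Xun (Xf Dt).
  have [_] := trace_class_saD hb (Xf Dt) Xuf; rewrite addrC subrK => h'.
  by rewrite (le_trans h')// lerD// (le_trans _ h)// ler_norm.
- apply/integrableP; split; first exact: measurable_cst.
  by rewrite integral_cst//= lte_mul_pinfty.
- move: fC; apply: ae_imply => t fCt n Dt; have {}fCt := fCt Dt.
  have Xun : trace_class_sa H (u n t) by case: (su n).
  have Xd := trace_class_saB hb (Xf Dt) (Xcut _ Xun).
  rewrite /g lee_fin ger0_norm; last exact: (tn_ge0 hb Xd).
  apply: (le_trans (tnB_le hb (Xf Dt) (Xcut _ Xun))); apply: lerD.
    by rewrite (le_trans fCt)// ler_norm.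
  rewrite /cut; case: ifP => [h|_]; last by rewrite t0 addr_ge0.
  by rewrite (le_trans h)// lerD2r ler_norm.
move=> _ + _; apply: cvg_trans; apply: near_eq_cvg; apply: nearW => n /=.
apply: eq_integral => t /set_mem Dt; rewrite /= subr0 ger0_norm//.
by apply: (tn_ge0 hb); apply: (trace_class_saB hb); [exact: Xf|case: (sv n)].
Qed.

Lemma bochner_integral_exists : exists A, is_bochner_integral D f A.
Proof.
have [v sv vf] := simple_approx_L1.
have mfv n : measurable_fun D (fun t => (tn (f t - v n t))%:E).
  apply/measurable_EFinP; apply: measurable_tn_dist => //.
  exact: strongly_measurable_simple.
have XS n : trace_class_sa H (simple_integral D (v n)).
  by have [] := simple_integral_tn mD Doo (sv n).
have [||A XA SA] := @trace_class_complete _ _ b hb (fun n => simple_integral D (v n)).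
- exact: XS.
- move=> e e0; have e2 : 0 < e / 2 by rewrite divr_gt0.
  have /fine_cvgP[[k1 _ hk1] /cvgr0Pnorm_lt/(_ _ e2)[k2 _ hk2]] := vf.
  exists (maxn k1 k2) => m n; rewrite !geq_max => /andP[m1 m2] /andP[n1 n2].
  have bnd p : (k1 <= p)%N -> (k2 <= p)%N ->
      (\int[mu]_(t in D) (tn (f t - v p t))%:E < (e / 2)%:E)%E.
    move=> p1 p2; rewrite -(fineK (hk1 p p1)) lte_fin.
    by apply: (le_lt_trans (ler_norm _)); exact: hk2.
  rewrite -lte_fin; apply: le_lt_trans (simple_integral_dist mD Doo (sv m) (sv n)) _.
  apply: (@le_lt_trans _ _ (\int[mu]_(t in D)
      ((tn (f t - v m t))%:E + (tn (f t - v n t))%:E))%E).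
    apply: ge0_le_integral => //.
    + move=> t Dt; rewrite lee_fin; apply: (tn_ge0 hb).
      by apply: (trace_class_saB hb); [case: (sv m)|case: (sv n)].
    + apply/measurable_EFinP; apply: measurable_tn_dist;
        exact: strongly_measurable_simple.
    + exact: (emeasurable_funD (mfv m) (mfv n)).
    + move=> t Dt; rewrite -EFinD lee_fin.
      have Xm : trace_class_sa H (v m t) by case: (sv m).
      have Xn : trace_class_sa H (v n t) by case: (sv n).
      rewrite (tn_distC hb (Xf Dt) Xm).
      exact: (tn_triangle hb Xm (Xf Dt) Xn).
  have tn0 p t : D t -> (0 <= (tn (f t - v p t))%:E)%E.
    move=> Dt; rewrite lee_fin; apply: (tn_ge0 hb).
    by apply: (trace_class_saB hb); [exact: Xf|case: (sv p)].
  rewrite ge0_integralD; [|exact: mD|by move=> t; exact: tn0|exact: mfv|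
    by move=> t; exact: tn0|exact: mfv].
  by rewrite [e]splitr EFinD lteD// bnd.
exists A; split => //; exists v; split => //.
  under eq_fun do rewrite (L1_distE mf (strongly_measurable_simple D (sv _))).
  exact: vf.
by apply/trace_norm_cvg0 => // n; apply: (trace_class_saB hb).
Qed.

(** Both claims hold for simple functions, and [r n + tn (S n - A)], where [r n] is
    the [L1] distance of [f] to the [n]-th approximation and [S n] the integral of
    the latter, bounds the error made in passing to [f]. *)
Lemma bochner_integral_weak A : is_bochner_integral D f A ->
  weak_int D f A /\ ((tn A)%:E <= \int[mu]_(t in D) (tn (f t))%:E)%E.
Proof.
move=> [_ XA [u [su uf uA]]].
have XS n : trace_class_sa H (simple_integral D (u n)).
  by have [] := simple_integral_tn mD Doo (su n).
have {}uA : tn (simple_integral D (u n) - A) @[n --> \oo] --> 0.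
  by apply/trace_norm_cvg0 => // n; apply: (trace_class_saB hb).
have mfu n : measurable_fun D (fun t => (tn (f t - u n t))%:E).
  apply/measurable_EFinP; apply: measurable_tn_dist => //.
  exact: strongly_measurable_simple.
have mtf : measurable_fun D (fun t => (tn (f t))%:E).
  by apply/measurable_EFinP; exact: measurable_tn.
have {}uf : (\int[mu]_(t in D) (tn (f t - u n t))%:E)%E @[n --> \oo] --> 0%E.
  have := uf.
  by under eq_fun do
    rewrite (L1_distE mf (strongly_measurable_simple D (su _))).
have Xu n t : trace_class_sa H (u n t) by case: (su n).
have tn0 t : D t -> 0 <= tn (f t) by move=> /Xf; exact: (tn_ge0 hb).
have Xfu n t : D t -> trace_class_sa H (f t - u n t).
  by move=> /Xf XF; exact: (trace_class_saB hb).
have if_ : mu.-integrable D (fun t => (tn (f t))%:E).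
  apply/integrableP; split => //.
  apply: (@le_lt_trans _ _ (\int[mu]_(t in D) (`|C|)%:E)%E); last first.
    by rewrite integral_cst//= lte_mul_pinfty.
  apply: ae_ge0_le_integral => //; first exact: (measurableT_comp _ mtf).
  apply: ae_imply fC => t fCt Dt.
  by rewrite gee0_abs ?lee_fin ?tn0// (le_trans (fCt Dt))// ler_norm.
have /fine_cvgP[[k _ hk] r0] := uf.
pose r n := fine (\int[mu]_(t in D) (tn (f t - u n t))%:E)%E.
have rE n : (k <= n)%N ->
    (\int[mu]_(t in D) (tn (f t - u n t))%:E = (r n)%:E)%E.
  by move=> kn; rewrite fineK//; exact: hk.
have rd0 c : (r n + tn (simple_integral D (u n) - A)) * c @[n --> \oo] --> 0.
  by rewrite -(mul0r c); apply: cvgMr_tmp; rewrite -(addr0 (0 : R)); exact: cvgD.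
clearbody r; split => [x y|].
- have mfxy : measurable_fun D (fun t => (inner (f t x) y)%:E).
    by apply/measurable_EFinP; exact: measurable_inner.
  have ifxy : mu.-integrable D (fun t => (inner (f t x) y)%:E).
    apply: (@le_integrable _ _ _ mu D mD _
      (fun t => ((`|x| * `|y|)%:E * (tn (f t))%:E)%E) mfxy); last first.
      exact: integrableZl.
    move=> t Dt; rewrite -EFinM !abse_EFin lee_fin [X in _ <= X]ger0_norm.
      by rewrite mulrC (le_trans (tn_form hb x y (Xf Dt))).
    by rewrite mulr_ge0 ?mulr_ge0 ?tn0.
  split => //.
  have fJ : (\int[mu]_(t in D) (inner (f t x) y)%:E)%E \is a fin_num.
    exact: integrable_fin_num.
  have [J JE] : exists J, J%:E = (\int[mu]_(t in D) (inner (f t x) y)%:E)%E.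
    by exists (fine (\int[mu]_(t in D) (inner (f t x) y)%:E)%E); rewrite fineK.
  rewrite -JE; congr (_%:E).
  apply/eqP; rewrite -subr_eq0 -normr_le0.
  apply: (cvgr_to_ge (rd0 (`|x| * `|y|))); exists k => // n /= kn.
  have -> : J - inner (A x) y = (J - inner (simple_integral D (u n) x) y) +
      inner ((simple_integral D (u n) - A) x) y.
    by rewrite [inner ((_ - _) x) y]innerBl addrA subrK.
  rewrite (le_trans (ler_normD _ _))// mulrDl lerD//; last first.
    by apply: (tn_form hb); exact: (trace_class_saB hb).
  have [iu hu] := weak_int_simple mD Doo (su n) x y.
  rewrite -lee_fin EFinM -(rE n kn) -abse_EFin EFinB -hu JE.
  rewrite -integralB// muleC -ge0_integralZl; last 4 first.
  + exact: mD.
  + exact: mfu.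
  + by move=> t Dt; rewrite lee_fin; apply: (tn_ge0 hb); exact: Xfu.
  + by rewrite lee_fin mulr_ge0.
  apply: (le_trans (le_abse_integral mu mD _)).
    exact: emeasurable_funB (measurable_int _ ifxy) (measurable_int _ iu).
  apply: ge0_le_integral => //.
  + by apply: measurableT_comp => //;
      exact: emeasurable_funB (measurable_int _ ifxy) (measurable_int _ iu).
  + exact: (measurable_funeM _ (mfu n)).
  move=> t Dt; rewrite -EFinB abse_EFin -EFinM lee_fin mulrC -innerBl.
  exact: (tn_form hb x y (Xfu n t Dt)).
- have fJ : (\int[mu]_(t in D) (tn (f t))%:E)%E \is a fin_num.
    exact: integrable_fin_num.
  have [J JE] : exists J, J%:E = (\int[mu]_(t in D) (tn (f t))%:E)%E.
    by exists (fine (\int[mu]_(t in D) (tn (f t))%:E)%E); rewrite fineK.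
  rewrite -JE lee_fin.
  rewrite -subr_le0; apply: (cvgr_to_ge (rd0 1)); exists k => // n /= kn.
  have [_ hu] := simple_integral_tn mD Doo (su n).
  have h1 : tn (simple_integral D (u n)) <= J + r n.
    rewrite -lee_fin EFinD -(rE n kn) JE; apply: (le_trans hu).
    rewrite -ge0_integralD; last 5 first.
    + exact: mD.
    + by move=> t Dt; rewrite lee_fin; exact: tn0.
    + exact: mtf.
    + by move=> t Dt; rewrite lee_fin (tn_ge0 hb)//; exact: Xfu.
    + exact: mfu.
    apply: ge0_le_integral => //.
    + by move=> t Dt; rewrite lee_fin (tn_ge0 hb).
    + apply/measurable_EFinP; apply: measurable_tn.
      exact: strongly_measurable_simple.
    + exact: (emeasurable_funD mtf (mfu n)).
    move=> t Dt; rewrite -EFinD lee_fin.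
    have [_] := trace_class_saD hb (Xf Dt) (trace_class_saB hb (Xu n t) (Xf Dt)).
    rewrite addrC subrK => h; apply: (le_trans h); rewrite lerD2l.
    by rewrite (tn_distC hb)//; exact: Xf.
  have := tnB_le hb (XS n) (trace_class_saB hb (XS n) XA).
  by rewrite opprB addrC subrK mulr1; lra.
Qed.

End Bounded.


End Bochner.

(** * Densities and paths *)

Section Spaces.
Context {R : realType} {H : hilbertType R}.
Local Notation mu := (@lebesgue_measure R).
Variables (T Lambda : R) (P : nat -> H -> H) (theta : nat -> R).
Hypotheses (T_gt0 : 0 < T) (H_separable : separable H) (Lambda_ge0 : 0 <= Lambda)
  (P_proj : forall m, orthogonal_projection (P m))
  (P_finite : forall m, finite_rank (P m))
  (theta_decr : nonincreasing_seq theta)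
  (theta_cvg : theta @ \oo --> (0 : R)).
Variable b : nat -> H.
Hypothesis hb : onb_seq b.
Implicit Types (a : R -> H -> H) (q : R -> H -> H) (s t : R).

Local Notation X := (trace_class_sa H).
Local Notation DS := (density_space T Lambda P theta).
Local Notation QS := (path_space T Lambda P theta).

(** Locked: only its defining property matters, never the choice of an integral. *)
Definition int_map : (R -> H -> H) -> R -> H -> H := locked (@integration_map R H).
Local Notation I := int_map.

Lemma int_mapE : int_map = @integration_map R H.
Proof. by rewrite /int_map -lock. Qed.

Local Notation cond := (density_cond Lambda P theta).

Lemma theta_ge0 m : 0 <= theta m.
Proof.
have <- : limn theta = 0 by exact/cvg_lim.
by apply: nonincreasing_cvgn_ge => //; apply/cvg_ex; exists 0.
Qed.

Lemma cond_tn A c : X A -> cond A c -> tn A <= Lambda * c.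
Proof.
move=> [[bA _] sA] [/(op_le0P bA) pA tA _].
by have [] := trace_class_sa_positive hb pA tA.
Qed.

Lemma cond0 c : 0 <= c -> cond 0 c.
Proof.
move=> c0; have p0 := @positive_op0 R H.
have tr0 : trace (0 : H -> H) = 0%E.
  by rewrite (trace_positiveE hb p0) eseries0// => i _ _; rewrite inner0l.
split.
- by apply/op_le0P => //; exact: bounded_op0.
- by rewrite tr0 lee_fin mulr_ge0.
- move=> m; have -> : compress (P m) 0 = 0.
    apply/funext => x; rewrite /compress /= /idfun /=.
    by rewrite !fctE linop0 ?subr0//; have [[]] := P_proj m.
  by rewrite tr0 lee_fin mulr_ge0// theta_ge0.
Qed.

Lemma countably_linear_closed C (u : nat -> H -> H) A c : countably_linear C ->
  (forall n, X (u n)) -> X A -> tn (u n - A) @[n --> \oo] --> 0 ->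
  (forall n, C (u n) c) -> C A c.
Proof.
move=> [s [gamma sC]] Xu XA uA uC; apply/sC => // k.
have h : qsum (s k) (u n) @[n --> \oo] --> qsum (s k) A.
  rewrite /qsum; elim: (s k) => [|p l IH].
    by rewrite big_nil; under eq_fun do rewrite big_nil; exact: cvg_cst.
  rewrite big_cons; under eq_fun do rewrite big_cons.
  by apply: cvgD => //; apply: cvgMl_tmp; exact: (inner_op_cvg hb).
by apply: (cvgr_to_le h); apply: nearW => n; have := (sC _ c (Xu n)).1 (uC n) k.
Qed.

Lemma countably_linearZ C A (k c : R) : countably_linear C -> 0 <= k -> X A ->
  C A c -> C (k *: A) (k * c).
Proof.
move=> [s [gamma sC]] k0 XA /(sC _ _ XA) h; apply/sC.
  by have [] := trace_class_saZ hb k XA.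
by move=> i; rewrite qsumZ mulrCA ler_wpM2l.
Qed.

Lemma cond_countable : countably_linear cond.
Proof. exact: (density_cond_countable Lambda theta H_separable hb P_proj). Qed.

Lemma DSP a : DS a <-> strongly_measurable `[0, T] a /\
  ae_on `[0, T] (fun t => cond (a t) 1).
Proof.
split=> -[ma ha]; split => //; move: ha; apply: ae_imply => t h Dt;
  have [h1 h2 h3] := h Dt; split=> //.
- by rewrite mulr1.
- by move=> m; rewrite mulr1.
- by move: h2; rewrite mulr1.
- by move=> m; have := h3 m; rewrite mulr1.
Qed.

Lemma density0 : DS (fun=> 0).
Proof.
have [X0 _] := trace_class_sa0 hb; apply/DSP; split.
  exact: (strongly_measurable_simple hb _ (simple_fun_cst X0)).
by apply: aeW => t _; exact: cond0.
Qed.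

Lemma DS_X a t : DS a -> 0 <= t <= T -> X (a t).
Proof. by move=> [[Xa _] _] tT; apply: Xa; rewrite /= in_itv. Qed.

Lemma DS_bound a : DS a -> ae_on `[0, T] (fun t => tn (a t) <= Lambda).
Proof.
move=> /DSP[[Xa _] ha]; move: ha; apply: ae_imply => t h Dt.
by rewrite -(mulr1 Lambda); apply: cond_tn; [exact: Xa|exact: h].
Qed.

Lemma mu_subitv (D : set R) : D `<=` `[0, T] -> measurable D ->
  (mu D < +oo)%E.
Proof.
move=> DT mD; apply: (@le_lt_trans _ _ (mu `[0, T]%classic)).
  apply: le_measure => //; apply/mem_set => //; exact: measurable_itv.
by rewrite lebesgue_measure_itv/= lte_fin T_gt0 -EFinB ltry.
Qed.

Lemma sub_itvc s t : 0 <= s -> t <= T -> [set` `[s, t]] `<=` `[0, T].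
Proof.
move=> s0 tT x /=; rewrite !in_itv/= => /andP[sx xt].
by rewrite (le_trans s0)//= (le_trans xt).
Qed.

Lemma sub_itvoc s t : 0 <= s -> t <= T -> [set` `]s, t]] `<=` `[0, T].
Proof.
move=> s0 tT x /=; rewrite !in_itv/= => /andP[sx xt].
by rewrite (le_trans s0 (ltW sx))//= (le_trans xt).
Qed.

Lemma ae_onS (D E : set R) (Q : R -> Prop) : E `<=` D -> ae_on D Q -> ae_on E Q.
Proof. by move=> ED; apply: ae_imply => t h /ED. Qed.

Lemma integration_mapP a t : DS a -> 0 <= t <= T ->
  is_bochner_integral `[0, t] a (I a t).
Proof.
move=> Da /andP[t0 tT]; rewrite int_mapE /integration_map /bochner_integral.
apply: xgetPex; have sub : [set` `[0, t]] `<=` `[0, T] by exact: sub_itvc.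
have mD : measurable [set` `[0, t]] by exact: measurable_itv.
apply: (@bochner_integral_exists _ _ _ hb _ _ Lambda) => //.
- exact: mu_subitv.
- by case: Da => /(strongly_measurableS sub).
- exact: ae_onS (DS_bound Da).
Qed.

Lemma integration_map_X a t : DS a -> 0 <= t <= T -> X (I a t).
Proof. by move=> Da /(integration_mapP Da)[]. Qed.

Lemma integration_map_weak a t : DS a -> 0 <= t <= T ->
  weak_int `[0, t] a (I a t).
Proof.
move=> Da tT; have /andP[t0 tT'] := tT.
have sub : [set` `[0, t]] `<=` `[0, T] by exact: sub_itvc.
have mD : measurable [set` `[0, t]] by exact: measurable_itv.
have h1 : (mu `[0%R, t]%classic < +oo)%E by exact: mu_subitv.
have h2 : strongly_measurable `[0, t] a.
  by case: Da => /(strongly_measurableS sub).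
have h3 := ae_onS sub (DS_bound Da).
exact: (bochner_integral_weak hb mD h1 h2 h3 (integration_mapP Da tT)).1.
Qed.

(** Subtract the integrals over [[0, s]] and [[0, t]]. *)
Lemma weak_int_increment a s t : DS a -> 0 <= s -> s <= t -> t <= T ->
  weak_int `]s, t] a (I a t - I a s).
Proof.
move=> Da s0 st tT x y.
have tI : 0 <= t <= T by rewrite (le_trans s0 st).
have sI : 0 <= s <= T by rewrite s0 (le_trans st tT).
have [it ht] := integration_map_weak Da tI x y.
have [is_ hs] := integration_map_weak Da sI x y.
have sub : [set` `]s, t]] `<=` `[0, t].
  by move=> r /=; rewrite !in_itv/= => /andP[sr ->]; rewrite (le_trans s0 (ltW sr)).
have m0t : measurable [set` `[0, t]] by exact: measurable_itv.
have mst : measurable [set` `]s, t]] by exact: measurable_itv.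
have ist := lebesgue_integrableS m0t mst sub it; split; first exact: ist.
have E : [set` `[0, t]] = [set` `[0, s]] `|` [set` `]s, t]].
  by rewrite -itv_bndbnd_setU// bnd_simp.
have := ht; rewrite E integral_setU//=; last 2 first.
- by rewrite -E; exact: measurable_int it.
- apply/disj_setPS => r /=; rewrite !in_itv/= => -[/andP[_ rs] /andP[sr _]].
  by move: (lt_le_trans sr rs); rewrite ltxx.
rewrite hs => h.
have fin : (\int[mu]_(r in `]s, t]) (inner (a r x) y)%:E)%E \is a fin_num.
  exact: integrable_fin_num.
have [J JE] : exists J : R,
    (\int[mu]_(r in `]s, t]) (inner (a r x) y)%:E)%E = J%:E.
  by exists (fine (\int[mu]_(r in `]s, t]) (inner (a r x) y)%:E)%E); rewrite fineK.
move: h; rewrite JE -EFinD => -[h]; congr (_%:E).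
have -> : inner ((I a t - I a s) x) y = inner (I a t x) y - inner (I a s x) y.
  by rewrite -innerBl.
rewrite -h.
rewrite addrC.
by rewrite addKr.
Qed.

Lemma weak_int_qsum (D : set R) a A (l : seq (R * H)) : measurable D ->
  weak_int D a A -> mu.-integrable D (fun r => (qsum l (a r))%:E) /\
  (\int[mu]_(r in D) (qsum l (a r))%:E = (qsum l A)%:E)%E.
Proof.
move=> mD wA; elim: l => [|p l [IHi IHe]].
  split.
    by under eq_fun do rewrite /qsum big_nil; exact: integrable0.
  under eq_integral do rewrite /qsum big_nil.
  by rewrite integral0 /qsum big_nil.
have [ip ep] := wA p.2 p.2.
have iZ : mu.-integrable D (fun r => (p.1%:E * (inner (a r p.2) p.2)%:E)%E).
  exact: integrableZl.
have e r : (qsum (p :: l) (a r))%:E =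
    (p.1%:E * (inner (a r p.2) p.2)%:E + (qsum l (a r))%:E)%E.
  by rewrite /qsum big_cons -EFinM -EFinD.
split; first by under eq_fun do rewrite e; exact: integrableD.
under eq_integral do rewrite e.
by rewrite integralD// integralZl// ep IHe -EFinM -EFinD /qsum big_cons.
Qed.

Lemma integration_map0 a : DS a -> I a 0 = 0.
Proof.
move=> Da; have T0 : 0 <= (0 : R) <= T by rewrite lexx ltW.
apply: (weak_int_unique (integration_map_weak Da T0)) => x y.
have [i0 _] := integration_map_weak Da T0 x y.
by split => //; rewrite inner0l set_itv1 integral_set1.
Qed.

(** Cut off outside [[0, T]], so as to be integrable on the whole line. *)
Definition qdensity (l : seq (R * H)) a : R -> R :=
  (fun r => qsum l (a r)) \_ `[0, T].

Lemma qdensity_integral l a : DS a ->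
  mu.-integrable [set: R] (EFin \o qdensity l a) /\
  forall t, 0 <= t <= T -> (\int[mu]_(r in `[0%R, t]) (qdensity l a r)%:E =
    (qsum l (I a t) - qsum l (I a 0))%:E)%E.
Proof.
move=> Da; have TT : 0 <= T <= T by rewrite lexx ltW.
have mI t : measurable [set` `[0, t]] by exact: measurable_itv.
split.
  have [i0 _] := weak_int_qsum l (mI T) (integration_map_weak Da TT).
  by rewrite /qdensity -restrict_EFin; apply/integrable_restrict => //; rewrite setTI.
move=> t tT; have /andP[t0 tT'] := tT.
have q0 : qsum l (0 : H -> H) = 0.
  by rewrite /qsum big1// => p _; rewrite inner0l mulr0.
rewrite integration_map0// q0 subr0.
have [_ <-] := weak_int_qsum l (mI t) (integration_map_weak Da tT).
apply: eq_integral => r; rewrite inE => rt; rewrite /qdensity patchE ifT//.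
by rewrite inE; exact: sub_itvc rt.
Qed.

Lemma qdensity_slope l a : DS a -> {ae mu, forall t, 0 < t < T ->
  grid_slope T n (fun t => qsum l (I a t)) t @[n --> \oo] --> qsum l (a t)}.
Proof.
move=> Da; have [iq eq_] := qdensity_integral l Da.
have := grid_slope_ae iq eq_; apply: ae_imply => t h tT.
have := h tT; rewrite /qdensity patchE ifT// inE /= in_itv/=.
by case/andP: tT => /ltW -> /ltW ->.
Qed.

(** Integrate in one direction, differentiate along the uniform partitions in the
    other; the exceptional null sets are countably many. *)
Lemma constraint_transfer C a : countably_linear C -> DS a ->
  (forall s t, 0 <= s -> s <= t -> t <= T -> C (I a t - I a s) (t - s)) <->
  ae_on `[0, T] (fun t => C (a t) 1).
Proof.
move=> [l [gamma lC]] Da.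
have Xinc s t : 0 <= s -> s <= t -> t <= T -> X (I a t - I a s).
  move=> s0 st tT; apply: (trace_class_saB hb); apply: integration_map_X => //.
    by rewrite (le_trans s0 st).
  by rewrite s0 (le_trans st).
split => [h|h].
- apply: ae_interior.
  suff : {ae mu, forall t, forall k, 0 < t < T -> qsum (l k) (a t) <= gamma k}.
    apply: ae_imply => t hk tT; apply/lC => [|k]; last by rewrite mulr1; exact: hk.
    by case/andP: tT => t0 tT; apply: DS_X => //; rewrite !ltW.
  apply: ae_forall_nat => k; have := qdensity_slope (l k) Da.
  apply: ae_imply => t ht tT; have cvg_t := ht tT.
  apply: (cvgr_to_le cvg_t); apply: nearW => n; rewrite /grid_slope -qsumB.
  have [h0 h1 h2 h3 _] : [/\ 0 <= grid_point T n (grid_index T n t),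
      grid_point T n (grid_index T n t) <= t,
      t < grid_point T n (grid_index T n t).+1,
      grid_point T n (grid_index T n t).+1 <= T & (grid_index T n t < n.+1)%N].
    by apply: grid_bounds; case/andP: tT => /ltW -> ->.
  have h01 := le_trans h1 (ltW h2).
  have := (lC _ _ (Xinc _ _ h0 h01 h3)).1 (h _ _ h0 h01 h3) k.
  rewrite grid_pointS addrAC subrr add0r => hh.
  have c0 : 0 <= n.+1%:R / T by rewrite divr_ge0// ltW.
  apply: (le_trans (ler_wpM2l c0 hh)).
  by rewrite mulrCA -[n.+1%:R / T]invf_div mulVf ?mulr1// gt_eqF// divr_gt0.
- move=> s t s0 st tT; apply/lC => [|k]; first exact: Xinc.
  have mD : measurable [set` `]s, t]] by exact: measurable_itv.
  have [i0 e0] := weak_int_qsum (l k) mD (weak_int_increment Da s0 st tT).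
  have muD : mu [set` `]s, t]] = (t - s)%:E.
    rewrite lebesgue_measure_itv/= lte_fin; case: ltP => // ts.
    by rewrite (le_anti (introT andP (conj st ts))) subrr.
  have ic : mu.-integrable `]s, t] (fun=> (gamma k)%:E).
    apply/integrableP; split; first exact: measurable_cst.
    by rewrite integral_cst//= muD -EFinM ltry.
  rewrite -lee_fin -e0.
  have -> : (gamma k * (t - s))%:E = (\int[mu]_(r in `]s, t]) (gamma k)%:E)%E.
    by rewrite integral_cst//= muD -EFinM.
  apply: ae_le_integral => //.
  have := ae_onS (sub_itvoc s0 tT) h; apply: ae_imply => r hr Dr.
  have rT : 0 <= r <= T by have := sub_itvoc s0 tT Dr; rewrite /= in_itv.
  by have := (lC _ _ (DS_X Da rT)).1 (hr Dr) k; rewrite mulr1.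
Qed.

(** * Tightness *)

Section Tight.
Variables (N : nat -> nat) (f : nat -> nat -> H).
Hypothesis Pf : forall m, ortho_seq (f m) /\ forall x, P m x = fourier (f m) (N m) x.

(** [tight_dist] with [eta] small, then [m] such that [theta m] is small. *)
Lemma tight_uniform (e : R) : 0 < e -> exists m d, 0 < d /\
  forall A B, X A -> X B -> cond A 1 -> cond B 1 ->
    (forall i j, (i < N m)%N -> (j < N m)%N ->
      `|inner (A (f m i)) (f m j) - inner (B (f m i)) (f m j)| <= d) ->
    tn (A - B) <= e.
Proof.
(* [eta] and [m] make the terms with [Lambda] and [theta m] at most [e / 4] each;
   the [c] matrix entries share the remaining [e / 2] *)
move=> e0; pose eta := e / (16 * (Lambda + 1)).
have L1 : 0 < Lambda + 1 by rewrite ltr_wpDl.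
have eta0 : 0 < eta by rewrite divr_gt0// mulr_gt0.
pose kappa := 1 + eta^-1 + 2 * eta.
have k0 : 0 < kappa.
  by rewrite /kappa !addr_gt0// ?invr_gt0// mulr_gt0.
have ek : 0 < e / (8 * kappa) by rewrite divr_gt0// mulr_gt0.
have /cvgrPdist_le/(_ _ ek)[m _ hm] := theta_cvg.
have {hm} thm : theta m <= e / (8 * kappa).
  by have := hm m (leqnn m); rewrite /= sub0r normrN ger0_norm// theta_ge0.
pose c : R := (N m * N m)%:R.
have c0 : 0 <= c by [].
exists m, (e / (2 * (c + 1))); split.
  by rewrite divr_gt0// mulr_gt0// ltr_wpDl.
move=> A B [[bA _] sA] [[bB _] sB] [/(op_le0P bA) pA tA tPA].
move=> [/(op_le0P bB) pB tB tPB] hd; have [of_ Pfm] := Pf m.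
rewrite !mulr1 in tA tB.
have tPAm := tPA m; have tPBm := tPB m; rewrite !mulr1 in tPAm tPBm.
apply: le_trans (tight_dist hb pA pB (P_proj m) of_ Pfm eta0 tA tB tPAm tPBm) _.
rewrite -/kappa.
have h1 : 2 * eta * Lambda <= e / 8.
  have -> : 2 * eta * Lambda = e / 8 * (Lambda / (Lambda + 1)).
    by rewrite /eta; field; rewrite gt_eqF.
  rewrite ler_piMr ?divr_ge0 ?(ltW e0)//.
  by rewrite ler_pdivrMr// mul1r lerDl.
have h2 : kappa * theta m <= e / 8.
  apply: (le_trans (ler_wpM2l (ltW k0) thm)).
  by rewrite le_eqVlt; apply/orP; left; apply/eqP; field; rewrite gt_eqF.
have h3 : \sum_(i < N m) \sum_(j < N m)
   `|inner (A (f m i)) (f m j) - inner (B (f m i)) (f m j)| <= e / 2.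
  apply: (@le_trans _ _ (\sum_(i < N m) \sum_(j < N m) (e / (2 * (c + 1))))).
    by apply: ler_sum => i _; apply: ler_sum => j _; exact: hd.
  rewrite !sumr_const !card_ord -mulrnA -[leLHS]mulr_natr -/c.
  have -> : e / (2 * (c + 1)) * c = e / 2 * (c / (c + 1)).
    by field; rewrite gt_eqF// ltr_wpDl.
  rewrite ler_piMr ?divr_ge0 ?(ltW e0)//.
  by rewrite ler_pdivrMr ?ltr_wpDl// mul1r lerDl.
lra.
Qed.

Lemma near_lt (n : nat) (Q : nat -> nat -> Prop) :
  (forall i, \forall p \near \oo, Q i p) ->
  \forall p \near \oo, forall i, (i < n)%N -> Q i p.
Proof.
move=> h; elim: n => [|n IH]; first by apply: nearW.
near=> p => i; rewrite ltnS leq_eqVlt => /predU1P[->|].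
  by near: p; exact: h.
by move: i; near: p; exact: IH.
Unshelve. all: by end_near. Qed.

Lemma tight_cvg (u : nat -> H -> H) B :
  (forall n, X (u n)) -> X B -> (forall n, cond (u n) 1) -> cond B 1 ->
  (forall m i j, inner (u n (f m i)) (f m j) @[n --> \oo] -->
     inner (B (f m i)) (f m j)) ->
  tn (u n - B) @[n --> \oo] --> 0.
Proof.
move=> Xu XB cu cB uB; apply/cvgrPdist_le => /= e e0.
have [m [d [d0 hd]]] := tight_uniform e0.
have : \forall p \near \oo, forall i, (i < N m)%N -> forall j, (j < N m)%N ->
    `|inner (u p (f m i)) (f m j) - inner (B (f m i)) (f m j)| <= d.
  apply: near_lt => i; apply: near_lt => j.
  have /cvgrPdist_le/(_ _ d0) := uB m i j; apply: filterS => p /=.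
  by rewrite distrC.
apply: filterS => p hp; rewrite sub0r normrN ger0_norm.
  by apply: hd => // i j im jm; exact: hp.
by apply: (tn_ge0 hb); exact: (trace_class_saB hb).
Qed.

Lemma tight_cauchy (u : nat -> H -> H) :
  (forall n, X (u n)) -> (forall n, cond (u n) 1) ->
  (forall m i j, cvgn (fun n => inner (u n (f m i)) (f m j))) ->
  forall e : R, 0 < e -> exists k, forall p p', (k <= p)%N -> (k <= p')%N ->
    tn (u p - u p') < e.
Proof.
move=> Xu cu uc e e0; have e2 : 0 < e / 2 by rewrite divr_gt0.
have [m [d [d0 hd]]] := tight_uniform e2.
have d2 : 0 < d / 2 by rewrite divr_gt0.
pose l i j := limn (fun n => inner (u n (f m i)) (f m j)).
have : \forall p \near \oo, forall i, (i < N m)%N -> forall j, (j < N m)%N ->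
    `|inner (u p (f m i)) (f m j) - l i j| <= d / 2.
  apply: near_lt => i; apply: near_lt => j.
  have /cvgrPdist_le/(_ _ d2) := uc m i j; apply: filterS => p /=.
  by rewrite distrC.
move=> [k _ hk]; exists k => p p' kp kp'.
apply: (@le_lt_trans _ _ (e / 2)); last by rewrite ltr_pdivrMr// ltr_pMr// ltr1n.
apply: hd => // i j im jm.
have := hk p kp i im j jm; have := hk p' kp' i im j jm.
by rewrite !ler_norml => /andP[? ?] /andP[? ?]; apply/andP; split; lra.
Qed.

End Tight.

Lemma projection_bases : exists (N : nat -> nat) (f : nat -> nat -> H),
  forall m, ortho_seq (f m) /\ forall x, P m x = fourier (f m) (N m) x.
Proof.
have /choice[N hN] m : exists n, exists f : nat -> H,
    ortho_seq f /\ forall x, P m x = fourier f n x.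
  exact: finite_rank_projection (P_proj m) (P_finite m).
by have /choice[f hf] := hN; exists N, f.
Qed.

(** * Slopes of a path along the uniform partitions *)

(** The slope of [q] over the cell of [t].  The set [E] stands for the good
    times; off it, the value [0] satisfies all constraints too. *)
Definition dens q (E : set R) n t : H -> H :=
  if t \in E then (n.+1%:R / T) *:
    (q (grid_point T n (grid_index T n t).+1) -
     q (grid_point T n (grid_index T n t))) else 0.

Lemma grid_point_lt n j k : grid_point T n j < grid_point T n k -> (j < k)%N.
Proof. by rewrite /grid_point ltr_pM2r ?invr_gt0// ltr_pM2l// ltr_nat. Qed.

Lemma grid_index_cell n t k : 0 <= t < T ->
  grid_point T n k <= t < grid_point T n k.+1 -> grid_index T n t = k.
Proof.
move=> tT /andP[kt tk]; have [_ h1 h2 _ _] := grid_bounds n tT.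
have a1 := grid_point_lt (le_lt_trans kt h2).
have a2 := grid_point_lt (le_lt_trans h1 tk).
by apply/eqP; rewrite eqn_leq -ltnS a2 -ltnS a1.
Qed.

Lemma grid_point_itv n k : (k <= n.+1)%N -> 0 <= grid_point T n k <= T.
Proof.
move=> kn; rewrite /grid_point; apply/andP; split.
  by rewrite divr_ge0// mulr_ge0// ltW.
by rewrite ler_pdivrMr// ler_pM2l// ler_nat.
Qed.

Lemma dens_simple q (E : set R) n : measurable E -> E `<=` `]0, T[ ->
  (forall t, 0 <= t <= T -> X (q t)) -> simple_fun (dens q E n).
Proof.
move=> mE ET Xq.
pose kap t := if t \in E then (grid_index T n t).+1 else 0%N.
pose F k := if k is k'.+1 then
  (n.+1%:R / T) *: (q (grid_point T n k'.+1) - q (grid_point T n k')) else 0.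
have dF t : dens q E n t = F (kap t) by rewrite /dens /kap; case: ifP.
have tE t : t \in E -> 0 <= t < T.
  by rewrite inE => /ET; rewrite /= in_itv/= => /andP[/ltW -> ->].
have kapn t : (kap t <= n.+1)%N.
  by rewrite /kap; case: ifPn => // /tE/(grid_bounds n)[].
split.
- move=> t; rewrite dF /kap; case: ifPn => [/tE tT|_] /=.
    have [_ _ _ _ kn] := grid_bounds n tT.
    have [] // := trace_class_saZ hb (n.+1%:R / T) (trace_class_saB hb
      (Xq _ (grid_point_itv (kn : (grid_index T n t).+1 <= n.+1)%N))
      (Xq _ (grid_point_itv (ltnW kn)))).
  by have [] := trace_class_sa0 hb.
- apply: (@sub_finite_set _ _ (F @` `I_n.+2)).
    by move=> _ [t _ <-]; rewrite dF; exists (kap t) => //=; rewrite ltnS.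
  exact/finite_image/finite_II.
- move=> A; have -> : dens q E n @^-1` [set A] =
      \bigcup_(k in `I_n.+2 `&` [set k | F k = A]) (kap @^-1` [set k]).
    apply/seteqP; split => [t /= <-|t [k [_ /= <-] /= <-]]; last exact: dF.
    by exists (kap t) => //; split; [rewrite /= ltnS|rewrite /= dF].
  apply: fin_bigcup_measurable; first exact/finite_setIl/finite_II.
  move=> [|k] [/= kn _].
    have -> : kap @^-1` [set 0%N] = ~` E.
      apply/seteqP; split => t /=; rewrite /kap; case: ifPn => //.
        by move=> /negP tE' _ Et; apply: tE'; rewrite inE.
      by rewrite inE.
    exact: measurableC.
  have -> : kap @^-1` [set k.+1] =
      E `&` `[grid_point T n k, grid_point T n k.+1[%classic.
    apply/seteqP; split => t /=; rewrite /kap; case: ifPn => //.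
    + move=> tE' [<-]; split; first by move: tE'; rewrite inE.
      by have [_ h1 h2 _ _] := grid_bounds n (tE _ tE'); rewrite in_itv/= h1.
    + by move=> tE' [_]; rewrite in_itv/= => h; rewrite (grid_index_cell (tE _ tE') h).
    + by move=> /negP tE' [Et _]; exfalso; apply: tE'; rewrite inE.
  by apply: measurableI => //; exact: measurable_itv.
Qed.

Lemma dens_slope q (E : set R) n t x : t \in E ->
  inner (dens q E n t x) x = grid_slope T n (fun t => inner (q t x) x) t.
Proof. by move=> tE; rewrite /dens tE /grid_slope -innerBl -innerZl. Qed.

Lemma dens_cond q (E : set R) n t : E `<=` `]0, T[ -> QS q ->
  X (dens q E n t) /\ cond (dens q E n t) 1.
Proof.
move=> ET [Xq _ _ hq]; rewrite /dens; case: ifPn => [|_]; last first.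
  by split; [case: (trace_class_sa0 hb)|exact: cond0].
rewrite inE => /ET; rewrite /= in_itv/= => /andP[/ltW t0 tT].
have t0T : 0 <= t < T by rewrite t0.
have [h0 h1 h2 h3 _] := grid_bounds n t0T.
have h01 := le_trans h1 (ltW h2).
have XB : X (q (grid_point T n (grid_index T n t).+1) -
     q (grid_point T n (grid_index T n t))).
  apply: (trace_class_saB hb); apply: Xq; rewrite in_itv/=.
    by rewrite h3 (le_trans h0 h01).
  by rewrite h0 (le_trans h01 h3).
have c0 : 0 <= n.+1%:R / T by rewrite divr_ge0// ltW.
split; first by have [] := trace_class_saZ hb (n.+1%:R / T) XB.
have cB := hq _ _ h0 h01 h3.
have := countably_linearZ cond_countable c0 XB cB.
rewrite grid_pointS [X in cond _ (_ * X)]addrAC subrr add0r.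
by rewrite -[n.+1%:R / T]invf_div mulVf// gt_eqF// divr_gt0.
Qed.

(** * Recovering the density of a path *)

Lemma path_X q t : QS q -> 0 <= t <= T -> X (q t).
Proof. by move=> [Xq _ _ _] tT; apply: Xq; rewrite in_itv. Qed.

Lemma path_inc q s t : QS q -> 0 <= s -> s <= t -> t <= T ->
  [/\ X (q t - q s), positive_op (q t - q s) & tn (q t - q s) <= Lambda * (t - s)].
Proof.
move=> Qq s0 st tT; have Xts : X (q t - q s).
  apply: (trace_class_saB hb); apply: path_X => //.
    by rewrite (le_trans s0 st).
  by rewrite s0 (le_trans st tT).
have [_ _ _ /(_ _ _ s0 st tT) cq] := Qq; split => //; last exact: cond_tn.
by have [[[bq _] _] [/(op_le0P bq)]] := (Xts, cq).
Qed.

(** [t |-> <q t x, x>] is nondecreasing and Lipschitz, with constant at most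
    [Lambda |x|^2].  It is scaled to be 1-Lipschitz, with [+ 1] because the
    constant may vanish, and extended to the line by clamping the time. *)
Lemma path_density q x : QS q -> exists g : R -> R,
  mu.-integrable [set: R] (EFin \o g) /\ forall t, 0 <= t <= T ->
    (\int[mu]_(r in `[0%R, t]) (g r)%:E =
       (inner (q t x) x - inner (q 0 x) x)%:E)%E.
Proof.
move=> Qq; pose K := Lambda * `|x| ^+ 2 + 1.
have K0 : 0 < K by rewrite ltr_wpDl// mulr_ge0// sqr_ge0.
pose cl t := Num.min (Num.max t 0) T.
have cl_in t : 0 <= cl t <= T.
  by rewrite /cl le_min le_max lexx orbT (ltW T_gt0) ge_min lexx orbT.
have cl_id t : 0 <= t <= T -> cl t = t.
  by move=> /andP[t0 tT]; rewrite /cl max_l// min_l.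
have cl_mono s t : s <= t -> 0 <= cl t - cl s <= t - s.
  move=> st; rewrite /cl; case: (lerP t 0); case: (lerP s 0) => s0 t0;
    rewrite /Num.min; do ?[case: ifPn; rewrite -?leNgt => ?]; apply/andP; split; lra.
have lip s t : s <= t ->
    0 <= inner (q (cl t) x) x / K - inner (q (cl s) x) x / K <= t - s.
  move=> st; have /andP[c0 cst] := cl_mono _ _ st.
  have /andP[s0 _] := cl_in s; have /andP[_ tT] := cl_in t.
  have cle : cl s <= cl t by rewrite -subr_ge0.
  have [Xi [_ _ pi] ti] := path_inc Qq s0 cle tT.
  have e : inner (q (cl t) x) x - inner (q (cl s) x) x =
      inner ((q (cl t) - q (cl s)) x) x by rewrite -innerBl.
  rewrite -mulrBl e divr_ge0 ?(ltW K0)//= ler_pdivrMr//.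
  apply: le_trans (ler_norm _) _; apply: (le_trans (tn_form hb x x Xi)).
  rewrite -expr2; apply: (@le_trans _ _ (Lambda * (cl t - cl s) * `|x| ^+ 2)).
    by rewrite ler_wpM2r// sqr_ge0.
  apply: (@le_trans _ _ (Lambda * (t - s) * `|x| ^+ 2)).
    by rewrite ler_wpM2r ?sqr_ge0// ler_wpM2l.
  by rewrite mulrAC mulrC ler_wpM2l ?subr_ge0// /K lerDl.
have [g [ig eg]] := lipschitz_density (ltW T_gt0) lip.
exists (fun t => K * g t); split.
  have -> : (EFin \o (fun t => K * g t)) = (fun t => (K%:E * (g t)%:E)%E).
    by apply/funext => t /=; rewrite EFinM.
  exact: integrableZl.
move=> t tT; under eq_integral do rewrite EFinM.
rewrite integralZl//=; last exact: (lebesgue_integrableS measurableT _ _ ig).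
rewrite eg// -EFinM; congr (_%:E).
have T0 : 0 <= (0 : R) <= T by rewrite lexx ltW.
by rewrite !cl_id// -mulrBl mulrC divfK// gt_eqF.
Qed.

(** By polarization, matrix entries of slopes reduce to slopes of scalar functions. *)
Lemma dens_entry q (E : set R) n t x y : E `<=` `]0, T[ -> QS q -> t \in E ->
  inner (dens q E n t x) y =
    (grid_slope T n (fun t => inner (q t (x + y)) (x + y)) t -
     grid_slope T n (fun t => inner (q t x) x) t -
     grid_slope T n (fun t => inner (q t y) y) t) / 2.
Proof.
move=> ET Qq tE; have [[[[lD _] _] sD] _] := dens_cond n t ET Qq.
by rewrite (inner_polar x y lD sD) !dens_slope.
Qed.

Lemma ae_polar (f : nat -> nat -> H) (Phi : H -> R -> Prop) :
  (forall x, {ae mu, forall t, 0 < t < T -> Phi x t}) ->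
  {ae mu, forall t, forall m, forall i, forall j, 0 < t < T ->
    [/\ Phi (f m i) t, Phi (f m j) t & Phi (f m i + f m j) t]}.
Proof.
move=> hPhi; apply: ae_forall_nat => m; apply: ae_forall_nat => i.
apply: ae_forall_nat => j.
have := ae_conj (hPhi (f m i)) (ae_conj (hPhi (f m j)) (hPhi (f m i + f m j))).
by apply: ae_imply => t [h1 [h2 h3]] tT; split; auto.
Qed.

(** The slopes of [q] along the uniform partitions satisfy the constraints, and for
    almost every [t] their entries in the countably many directions spanning the
    ranges of the projections converge.  By tightness they then converge in trace
    norm; the limit [a] is a density, and the scalar functions [<I a t x, x>] and
    [<q t x, x>] have almost everywhere the same derivative. *)
Lemma path_surj q : QS q -> exists2 a, DS a & forall t, 0 <= t <= T -> I a t = q t.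
Proof.
move=> Qq; have [N [f Pf]] := projection_bases.
have slope_ae x : {ae mu, forall t, 0 < t < T ->
    cvgn (fun n => grid_slope T n (fun t => inner (q t x) x) t)}.
  have [g [ig eg]] := path_density x Qq.
  have := grid_slope_ae ig eg; apply: ae_imply => t h tT.
  by apply/cvg_ex; exists (g t); exact: h.
(* [M] contains the times at which some scalar slope diverges *)
have [M [mM M0 hM]] := ae_polar f slope_ae; pose E : set R := `]0, T[ `\` M.
have mE : measurable E by apply: measurableD => //; exact: measurable_itv.
have ET : E `<=` `]0, T[ by move=> t [].
have lim t : exists A, X A /\ tn (dens q E n t - A) @[n --> \oo] --> 0.
  have Xd n : X (dens q E n t) by have [] := dens_cond n t ET Qq.
  suff [A XA dA] : exists2 A, X A & tn (dens q E n t - A) @[n --> \oo] --> 0.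
    by exists A.
  apply: (trace_class_complete hb Xd).
  have [tE|/negPf tE] := boolP (t \in E); last first.
    move=> e e0; exists 0%N => m n _ _; rewrite /dens tE subrr.
    by have [_ ->] := trace_class_sa0 hb.
  apply: (tight_cauchy Pf Xd); first by move=> n; have [] := dens_cond n t ET Qq.
  move=> m i j; under eq_fun do rewrite (dens_entry _ _ _ ET Qq tE).
  move: (tE); rewrite inE => -[/= t0T nM].
  have h := contrapT (fun nh => nM (hM _ nh)).
  have [|c1 c2 c3] := h m i j; first by move: t0T; rewrite in_itv.
  by apply: is_cvgMl; apply: is_cvgB => //; exact: is_cvgB.
have /choice[a ha] := lim.
have Da : DS a.
  apply/DSP; split.
    apply/(strongly_measurableP hb); split=> [t _|]; first by have [] := ha t.
    exists (fun n => dens q E n) => [n|t _]; last by have [] := ha t.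
    by apply: dens_simple => // t tT; exact: path_X.
  apply: aeW => t _; have [Xa dA] := ha t.
  apply: (countably_linear_closed cond_countable _ Xa dA) => n;
    by have [] := dens_cond n t ET Qq.
exists a => // t tT; have /andP[t0 tT'] := tT.
have [[[lI _] _] sI] := integration_map_X Da tT.
have [[[lq _] _] sq] := path_X Qq tT.
apply: quadratic_form_ext => // x.
have [_ eI] := integration_map_weak Da tT x x.
have [g [ig eg]] := path_density x Qq.
have q0 : q 0 = 0 by case: Qq.
have := eg _ tT; rewrite q0 inner0l subr0 => eq_.
suff : (\int[mu]_(r in `[0%R, t]) (inner (a r x) x)%:E =
        \int[mu]_(r in `[0%R, t]) (g r)%:E)%E by rewrite eI eq_ => -[].
have sub : [set` `[0, t]] `<=` `[0, T] by exact: sub_itvc.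
have mt : measurable [set` `[0, t]] by exact: measurable_itv.
apply: ae_eq_integral => //.
- apply/measurable_EFinP; apply: (measurable_inner hb).
  by case: Da => /(strongly_measurableS sub).
- have /integrableP[mg _] := ig; exact: measurable_funTS.
- suff : ae_on `[0, T] (fun r => (inner (a r x) x)%:E = (g r)%:E).
    exact: ae_onS.
  apply: ae_interior; have aM : {ae mu, forall r, ~ M r}.
    by exists M; split => // r /= /contrapT.
  have := ae_conj aM (grid_slope_ae ig eg); apply: ae_imply => r [nM hr] rT.
  have rE : r \in E by rewrite inE; split => //=; rewrite in_itv.
  have [Xa dA] := ha r; congr (_%:E).
  suff hl : grid_slope T n (fun t => inner (q t x) x) r @[n --> \oo] -->
      inner (a r x) x.
    by rewrite -(cvg_lim (@Rhausdorff R) hl); exact/cvg_lim/(hr rT).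
  under eq_fun do rewrite -(dens_slope _ _ _ rE).
  have Xd n : X (dens q E n r) by have [] := dens_cond n r ET Qq.
  exact: (@inner_op_cvg _ _ _ hb _ _ x x Xd Xa dA).
Qed.

(** * The path space *)

(** Continuity in trace norm follows from the bound on the traces of increments. *)
Lemma path_spaceI q : (forall t, 0 <= t <= T -> X (q t)) -> q 0 = 0 ->
  (forall s t, 0 <= s -> s <= t -> t <= T -> cond (q t - q s) (t - s)) -> QS q.
Proof.
move=> Xq q0 hq; split=> [t|t|//|//]; rewrite in_itv/= => tT; first exact: Xq.
have lip s r : 0 <= s <= T -> 0 <= r <= T -> tn (q s - q r) <= Lambda * `|s - r|.
  wlog rs : s r / r <= s => [hw sT rT|sT rT].
    have [rs|/ltW sr] := leP r s; first exact: hw.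
    by rewrite (tn_distC hb (Xq _ sT) (Xq _ rT)) distrC; exact: hw.
  rewrite ger0_norm ?subr_ge0//; apply: cond_tn.
    by apply: (trace_class_saB hb); exact: Xq.
  by case/andP: rT => r0 _; case/andP: sT => _ sT; exact: hq.
have Xn : \forall s \near within `[0, T] (nbhs t), X (q s - q t).
  near=> s; apply: (trace_class_saB hb); apply: Xq => //.
  suff : [set` `[0, T]] s by rewrite /= in_itv.
  by near: s; exact: withinT.
apply: cvg_EFin.
  by apply: filterS Xn => s Xs; rewrite (tnE hb Xs).
apply: (@squeeze_cvgr _ _ _ _ (fun=> 0) (fun s => Lambda * `|s - t|)).
- near=> s; have Xs : X (q s - q t) by near: s.
  rewrite /= (tnE hb Xs)/= (tn_ge0 hb Xs)/=; apply: lip => //.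
  suff : [set` `[0, T]] s by rewrite /= in_itv.
  by near: s; exact: withinT.
- exact: cvg_cst.
- have -> : (0 : R) = Lambda * `|t - t| by rewrite subrr normr0 mulr0.
  apply: cvg_within_filter; apply: cvgMl_tmp; apply: cvg_norm.
  by apply: cvgB; [exact: cvg_id|exact: cvg_cst].
Unshelve. all: by end_near. Qed.

Lemma integration_map_path a : DS a -> QS (I a).
Proof.
move=> Da; apply: path_spaceI => [t tT||].
- exact: integration_map_X.
- exact: integration_map0.
- by apply/(constraint_transfer cond_countable Da); case/DSP: Da.
Qed.


(** Apply the triangle inequality for the Bochner integral to the difference of the
    densities on [(s, t]]. *)
Lemma increment_bound a c s t : DS a -> DS c -> 0 <= s -> s <= t -> t <= T ->
  ((tn ((I a t - I c t) - (I a s - I c s)))%:E <=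
     \int[mu]_(r in `]s, t]) (tn (a r - c r))%:E)%E.
Proof.
move=> Da Dc s0 st tT.
have sub : [set` `]s, t]] `<=` `[0, T] by exact: sub_itvoc.
have mD : measurable [set` `]s, t]] by exact: measurable_itv.
have Doo : (mu `]s, t]%classic < +oo)%E by exact: mu_subitv.
have [[ma _] [mc _]] := (Da, Dc).
have mac : strongly_measurable `]s, t] (a - c).
  by apply: (strongly_measurableS sub); exact: (strongly_measurableB hb).
have bac : ae_on `]s, t] (fun r => tn ((a - c) r) <= Lambda + Lambda).
  apply: (ae_onS sub); have := ae_conj (DS_bound Da) (DS_bound Dc).
  apply: ae_imply => r [ha hc] rT.
  have rT' : 0 <= r <= T by move: rT; rewrite /= in_itv.
  apply: (le_trans (tnB_le hb (DS_X Da rT') (DS_X Dc rT'))).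
  by apply: lerD; [exact: ha|exact: hc].
have [A /(bochner_integral_weak hb mD Doo mac bac)[wA hA]] :=
  bochner_integral_exists hb mD Doo mac bac.
have := weak_intB mD (weak_int_increment Da s0 st tT) (weak_int_increment Dc s0 st tT).
have -> : (I a t - I c t) - (I a s - I c s) = (I a t - I a s) - (I c t - I c s).
  exact: subrBB.
by move=> /(weak_int_unique wA) <-.
Qed.

(** * The isometry *)

Lemma measurable_density_dist a c (D : set R) : DS a -> DS c ->
  D `<=` `[0, T] -> measurable_fun D (fun r => (tn (a r - c r))%:E).
Proof.
move=> [ma _] [mc _] sub; apply/measurable_EFinP.
by apply: (measurable_tn_dist hb); apply: (strongly_measurableS sub).
Qed.

Lemma density_dist_ge0 a c (D : set R) : DS a -> DS c -> D `<=` `[0, T] ->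
  forall r, D r -> (0 <= (tn (a r - c r))%:E)%E.
Proof.
move=> Da Dc sub r /sub; rewrite /= in_itv/= => rT.
by rewrite lee_fin; apply: (tn_ge0 hb); apply: (trace_class_saB hb); exact: DS_X.
Qed.

Lemma density_distE a c : DS a -> DS c ->
  L1_dist `[0, T] a c = (\int[mu]_(r in `[0%R, T]) (tn (a r - c r))%:E)%E.
Proof. by move=> [ma _] [mc _]; exact: (L1_distE hb ma mc). Qed.

Lemma density_dist_fin a c : DS a -> DS c -> exists2 r : R, 0 <= r &
  L1_dist `[0, T] a c = r%:E.
Proof.
move=> Da Dc; have sub : [set` `[0, T]] `<=` `[0, T] by [].
have mD : measurable [set` `[0, T]] by exact: measurable_itv.
have f0 := density_dist_ge0 Da Dc sub.
have i0 : (0 <= L1_dist `[0%R, T] a c)%E by rewrite density_distE//; exact: integral_ge0.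
suff ioo : (L1_dist `[0%R, T] a c < +oo)%E.
  exists (fine (L1_dist `[0, T] a c)); first exact: fine_ge0.
  by rewrite fineK// ge0_fin_numE.
rewrite density_distE//.
have L0 : 0 <= Lambda + Lambda by rewrite addr_ge0.
apply: (@le_lt_trans _ _ (\int[mu]_(r in `[0%R, T]) (Lambda + Lambda)%:E)%E).
  apply: ae_ge0_le_integral => //.
    exact: measurable_density_dist.
  have := ae_conj (DS_bound Da) (DS_bound Dc).
  apply: ae_imply => r [ha hc] rT; rewrite lee_fin.
  have rT' : 0 <= r <= T by move: rT; rewrite /= in_itv.
  apply: (le_trans (tnB_le hb (DS_X Da rT') (DS_X Dc rT'))).
  by apply: lerD; [exact: ha|exact: hc].
rewrite integral_cst// lte_mul_pinfty ?lee_fin//.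
by have := mu_subitv sub mD.
Qed.

Definition variation_sum (d : R -> H -> H) s (p : seq R) : \bar R :=
  (\sum_(0 <= n < size p)
     trace_norm (d (nth T (s :: p) n.+1) - d (nth T (s :: p) n))%R)%E.

Lemma variation_sum_cons d s x p : variation_sum d s (x :: p) =
  (trace_norm (d x - d s)%R + variation_sum d x p)%E.
Proof. by rewrite /variation_sum /= big_nat_recl. Qed.

Lemma one_var_sumE q q' (p : seq R) :
  (let F := (fun t => (q t - q' t)%R) \o nth T (0%R :: p) in
    \sum_(0 <= n < size p) trace_norm (F n.+1 - F n)%R)%E =
  variation_sum (fun t => q t - q' t) 0 p.
Proof. by []. Qed.

(** Add up the bounds of [increment_bound] over the cells of the partition. *)
Lemma variation_sum_le a c s p : DS a -> DS c -> 0 <= s -> path <%R s p ->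
  last s p <= T ->
  (variation_sum (fun t => (I a t - I c t)%R) s p <=
    \int[mu]_(r in `]s, last s p]) (tn (a r - c r))%:E)%E.
Proof.
move=> Da Dc; elim: p s => [|x p IH] s s0 /= => [_ sT|/andP[sx xp] lT].
  by rewrite /variation_sum big_nil; apply: integral_ge0;
    apply: density_dist_ge0 => //; exact: sub_itvoc.
have xl : x <= last x p.
  case/lastP: p xp {IH lT} => [|p y] xp //; rewrite last_rcons.
  have := order_path_min lt_trans xp; rewrite all_rcons => /andP[/ltW].
  by [].
have sxT : x <= T by exact: le_trans lT.
have x0 : 0 <= x by rewrite (le_trans s0)// ltW.
have XI r : 0 <= r <= T -> X (I a r - I c r).
  by move=> rT; apply: (trace_class_saB hb); exact: integration_map_X.
have subl := sub_itvoc s0 lT.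
have -> : [set` `]s, last x p]] = [set` `]s, x]] `|` [set` `]x, last x p]].
  by rewrite -itv_bndbnd_setU// bnd_simp// ltW.
have sub' : [set` `]s, x]] `|` [set` `]x, last x p]] `<=` `[0, T].
  by rewrite subUset; split; exact: sub_itvoc.
rewrite variation_sum_cons ge0_integral_setU//=; last 3 first.
- exact: measurable_density_dist.
- exact: density_dist_ge0.
- apply/disj_setPS => r /=; rewrite !in_itv/= => -[/andP[_ rs] /andP[sr _]].
  by move: (lt_le_trans sr rs); rewrite ltxx.
apply: leeD; last exact: IH.
rewrite (tnE hb); first by apply: increment_bound => //; exact: ltW.
apply: (trace_class_saB hb); apply: XI; first by rewrite x0.
by rewrite s0 (le_trans (ltW sx)).
Qed.

Lemma one_var_le a c : DS a -> DS c ->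
  (one_var_dist T (I a) (I c) <= L1_dist `[0%R, T] a c)%E.
Proof.
move=> Da Dc; apply: ge_ereal_sup => _ [p [pp /eqP lp] <-].
have lT : last 0 p <= T by rewrite lp.
rewrite one_var_sumE; apply: (le_trans (variation_sum_le Da Dc (lexx 0) pp lT)).
rewrite density_distE// lp; apply: ge0_subset_integral => //.
- exact: measurable_density_dist.
- exact: density_dist_ge0.
- exact: sub_itvoc.
Qed.

Lemma grid_partition n : itv_partition 0 T
  [seq grid_point T n k | k <- iota 1 n.+1].
Proof.
have g0 : grid_point T n 0 = 0 by rewrite /grid_point mulr0 mul0r.
split; last first.
  rewrite -g0 last_map -[n.+1]addn1 iotaD cats1 last_rcons add1n.
  by rewrite /grid_point mulfK.
have : sorted <%R [seq grid_point T n k | k <- iota 0 n.+2].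
  apply: (homo_sorted (e := ltn)); last exact: iota_ltn_sorted.
  by move=> i j ij; rewrite /grid_point ltr_pM2r ?invr_gt0// ltr_pM2l// ltr_nat.
by rewrite /= g0.
Qed.

Lemma variation_sum_grid d n :
  variation_sum d 0 [seq grid_point T n k | k <- iota 1 n.+1] =
  (\sum_(0 <= k < n.+1)
     trace_norm (d (grid_point T n k.+1) - d (grid_point T n k))%R)%E.
Proof.
have g0 : grid_point T n 0 = 0 by rewrite /grid_point mulr0 mul0r.
have e : 0 :: [seq grid_point T n k | k <- iota 1 n.+1] =
    [seq grid_point T n k | k <- iota 0 n.+2] by rewrite /= g0.
rewrite /variation_sum e size_map size_iota.
rewrite big_nat [RHS]big_nat; apply: eq_bigr => k /andP[_ kn].
have kn' : (k < n.+2)%N by exact: ltnW.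
by rewrite !(nth_map 0%N) ?size_iota// !nth_iota.
Qed.


(** Matrix entries of the slopes converge by differentiation of scalar functions,
    and tightness turns this into convergence in trace norm. *)
Lemma dens_cvg a : DS a -> {ae mu, forall t, 0 < t < T ->
  tn (dens (I a) `]0, T[ n t - a t) @[n --> \oo] --> 0}.
Proof.
move=> Da; have [N [f Pf]] := projection_bases.
have slope_ae x : {ae mu, forall t, 0 < t < T ->
    grid_slope T n (fun t => inner (I a t x) x) t @[n --> \oo] -->
      inner (a t x) x}.
  have := qdensity_slope [:: (1, x)] Da.
  have e A : qsum [:: (1, x)] A = inner (A x) x.
    by rewrite /qsum big_seq1 mul1r.
  by apply: ae_imply => t; rewrite e (_ : (fun t => qsum _ _) =
    (fun t => inner (I a t x) x)); last by apply/funext => r; rewrite e.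
have hs := ae_polar f slope_ae; have [_ ca] := (DSP a).1 Da; have := ae_conj hs ca.
apply: ae_imply => t [ht ct] tT.
have tI : 0 <= t <= T by case/andP: tT => /ltW -> /ltW ->.
have tE : t \in `]0, T[%classic by rewrite inE /= in_itv.
have sub : [set` `]0, T[] `<=` `]0, T[ by [].
have Qa := integration_map_path Da.
have Xa := DS_X Da tI.
apply: (tight_cvg Pf) => //.
- by move=> n; have [] := dens_cond n t sub Qa.
- by move=> n; have [] := dens_cond n t sub Qa.
- by apply: ct; rewrite /= in_itv.
move=> m i j; have [h1 h2 h3] := ht m i j tT.
under eq_fun do rewrite (dens_entry _ _ _ sub Qa tE).
have [[[la _] _] sa] := Xa; rewrite (inner_polar _ _ la sa).
by apply: cvgMr_tmp; apply: cvgB => //; exact: cvgB.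
Qed.

Lemma dens_X a n t : DS a -> X (dens (I a) `]0, T[ n t).
Proof.
move=> /integration_map_path Qa.
by have [] := dens_cond n t (fun x (h : [set` `]0, T[] x) => h) Qa.
Qed.

Lemma dens_bound a n t : DS a -> tn (dens (I a) `]0, T[ n t) <= Lambda.
Proof.
move=> Da; have Qa := integration_map_path Da.
have [Xd cd] := dens_cond n t (fun x (h : [set` `]0, T[] x) => h) Qa.
by rewrite -(mulr1 Lambda); exact: cond_tn.
Qed.

Lemma dens_dist_measurable a c n (D : set R) : DS a -> DS c ->
  measurable_fun D
    (fun t => (tn (dens (I a) `]0, T[ n t - dens (I c) `]0, T[ n t))%:E).
Proof.
have sd a' : DS a' -> simple_fun (dens (I a') `]0, T[ n).
  by move=> Da'; apply: dens_simple => // t; exact: integration_map_X.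
move=> Da Dc; apply/measurable_EFinP.
exact: (measurable_tn_dist hb (strongly_measurable_simple hb D (sd _ Da))
  (strongly_measurable_simple hb D (sd _ Dc))).
Qed.

(** On each cell the two slopes are constant inside [(0, T)], and their difference is
    the increment of [I a - I c] divided by the length of the cell. *)
Lemma dens_dist_integral a c n k : DS a -> DS c -> (k <= n.+1)%N ->
  (\int[mu]_(t in `[0%R, grid_point T n k[)
     (tn (dens (I a) `]0, T[ n t - dens (I c) `]0, T[ n t))%:E <=
   \sum_(0 <= i < k) trace_norm ((I a (grid_point T n i.+1) -
     I c (grid_point T n i.+1)) -
     (I a (grid_point T n i) - I c (grid_point T n i)))%R)%E.
Proof.
move=> Da Dc; have g0 : grid_point T n 0 = 0 by rewrite /grid_point mulr0 mul0r.
have c0 : 0 <= n.+1%:R / T by rewrite divr_ge0// ltW.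
elim: k => [|k IH] kn.
  by rewrite g0 big_nil set_itvco0 integral_set0.
have step : grid_point T n k <= grid_point T n k.+1.
  by rewrite grid_pointS lerDl divr_ge0// ltW.
have /andP[gk0 gkT] := grid_point_itv (ltnW kn).
have /andP[gk0' gkT'] := grid_point_itv kn.
have -> : [set` `[0, grid_point T n k.+1[] = [set` `[0, grid_point T n k[] `|`
    [set` `[grid_point T n k, grid_point T n k.+1[].
  by rewrite -itv_bndbnd_setU// bnd_simp.
have f0 (t : R) : (0 <= (tn (dens (I a) `]0%R, T[ n t -
    dens (I c) `]0%R, T[ n t))%:E)%E.
  by rewrite lee_fin; apply: (tn_ge0 hb); apply: (trace_class_saB hb); exact: dens_X.
rewrite ge0_integral_setU//=; last 2 first.
- exact: dens_dist_measurable.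
- apply/disj_setPS => r /=; rewrite !in_itv/= => -[/andP[_ rs] /andP[sr _]].
  by move: (lt_le_trans rs sr); rewrite ltxx.
rewrite big_nat_recr//=; apply: leeD; first by apply: IH; exact: ltnW.
set B := (_ - _ - _).
have XI r : 0 <= r <= T -> X (I a r - I c r).
  by move=> rT; apply: (trace_class_saB hb); exact: integration_map_X.
have XB : X B.
  by apply: (trace_class_saB hb); apply: XI; rewrite ?gk0 ?gk0'.
rewrite (tnE hb XB).
apply: (@le_trans _ _ (\int[mu]_(t in `[grid_point T n k, grid_point T n k.+1[)
    (n.+1%:R / T * tn B)%:E)%E).
  apply: ge0_le_integral => //.
  - exact: dens_dist_measurable.
  - move=> t; rewrite /= in_itv/= => tk; rewrite lee_fin /dens.
    have tT : 0 <= t < T.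
      case/andP: tk => tk tk'; rewrite (le_trans gk0 tk)/=.
      exact: lt_le_trans gkT'.
    rewrite (grid_index_cell tT tk); case: ifP => _; last first.
      rewrite subrr; have [_ ->] := trace_class_sa0 hb.
      by rewrite mulr_ge0// (tn_ge0 hb).
    have [_] := trace_class_saZ hb (n.+1%:R / T) XB.
    rewrite ger0_norm// => hB; rewrite -scalerBr.
    suff -> : I a (grid_point T n k.+1) - I a (grid_point T n k) -
      (I c (grid_point T n k.+1) - I c (grid_point T n k)) = B by [].
    exact: subrBB.
rewrite integral_cst//=.
rewrite lebesgue_measure_itv/= lte_fin; case: ifP => _; last first.
  by rewrite mule0 lee_fin (tn_ge0 hb).
rewrite -EFinB -EFinM lee_fin grid_pointS addrAC subrr add0r.
have e : n.+1%:R / T * (T / n.+1%:R) = 1.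
  by rewrite -[n.+1%:R / T]invf_div mulVf// gt_eqF// divr_gt0.
by rewrite mulrAC e mul1r lexx.
Qed.

(** The variation sums along the uniform partitions dominate the [L1] distances of
    the slopes, which converge to that of the densities by dominated convergence. *)
Lemma one_var_ge a c : DS a -> DS c ->
  (L1_dist `[0%R, T] a c <= one_var_dist T (I a) (I c))%E.
Proof.
move=> Da Dc; rewrite density_distE//.
have sub : [set` `[0, T[] `<=` `[0, T].
  by move=> r /=; rewrite !in_itv/= => /andP[-> /ltW].
have mD : measurable [set` `[0, T[] by exact: measurable_itv.
rewrite -integral_itv_bndo_bndc; last exact: measurable_density_dist.
pose w n t : \bar R :=
  (tn (dens (I a) `]0, T[ n t - dens (I c) `]0, T[ n t))%:E.
have w0 n t : (0 <= w n t)%E.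
  by rewrite lee_fin; apply: (tn_ge0 hb); apply: (trace_class_saB hb); exact: dens_X.
have wcvg : {ae mu, forall t, [set` `[0, T[] t ->
    w ^~ t @ \oo --> (tn (a t - c t))%:E}.
  suff : ae_on `[0, T] (fun t => w ^~ t @ \oo --> (tn (a t - c t))%:E).
    exact: ae_onS.
  apply: ae_interior; have := ae_conj (dens_cvg Da) (dens_cvg Dc).
  apply: ae_imply => t [ha hc] tT; apply: cvg_EFin; first exact: nearW.
  have tI : 0 <= t <= T by case/andP: tT => /ltW -> /ltW ->.
  have Xda n : X (dens (I a) `]0, T[ n t) by exact: dens_X.
  have Xdc n : X (dens (I c) `]0, T[ n t) by exact: dens_X.
  exact: (@tn_dist_cvg _ _ _ hb _ _ _ _ Xda Xdc (DS_X Da tI) (DS_X Dc tI)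
    (ha tT) (hc tT)).
have iL : mu.-integrable `[0, T[ (fun=> (Lambda + Lambda)%:E).
  apply/integrableP; split; first exact: measurable_cst.
  by rewrite integral_cst//= lte_mul_pinfty ?lee_fin// mu_subitv.
have wL : {ae mu, forall t, forall n, [set` `[0, T[] t ->
    (`|w n t| <= (Lambda + Lambda)%:E)%E}.
  apply: aeW => t n _; rewrite gee0_abs// lee_fin.
  apply: (le_trans (tnB_le hb (dens_X n t Da) (dens_X n t Dc))).
  by apply: lerD; exact: dens_bound.
have mw n : measurable_fun `[0, T[ (w n) by exact: dens_dist_measurable.
have mf := measurable_density_dist Da Dc sub.
have [_ _ icvg] := @dominated_convergence _ _ _ mu _ mD _ _ _ mw mf wcvg iL wL.
apply: (cvge_to_le icvg); apply: nearW => n /=.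
have gT : grid_point T n n.+1 = T by rewrite /grid_point mulfK.
have := dens_dist_integral Da Dc (leqnn n.+1); rewrite gT => h.
apply: (le_trans h); rewrite -(variation_sum_grid (fun t => (I a t - I c t)%R)).
apply: ereal_sup_ubound; exists [seq grid_point T n k | k <- iota 1 n.+1] => //.
exact: grid_partition.
Qed.

Lemma integration_isometry a c : DS a -> DS c ->
  one_var_dist T (I a) (I c) = L1_dist `[0, T] a c.
Proof.
by move=> Da Dc; apply/eqP; rewrite eq_le one_var_le// one_var_ge.
Qed.

Lemma integration_map_dist a c t : DS a -> DS c -> 0 <= t <= T ->
  ((tn (I a t - I c t))%:E <= L1_dist `[0%R, T] a c)%E.
Proof.
move=> Da Dc /andP[t0 tT]; have := increment_bound Da Dc (lexx 0) t0 tT.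
rewrite !integration_map0// subrr subr0 => h; apply: (le_trans h).
rewrite density_distE//; apply: ge0_subset_integral => //.
- exact: measurable_density_dist.
- exact: density_dist_ge0.
- exact: sub_itvoc.
Qed.

Lemma integration_map_sup_dist a c : DS a -> DS c ->
  (sup_dist T (I a) (I c) <= L1_dist `[0%R, T] a c)%E.
Proof.
move=> Da Dc; apply: ge_ereal_sup => _ [t tT <-].
have {}tT : 0 <= t <= T by move: tT; rewrite /= in_itv.
rewrite (tnE hb); first exact: integration_map_dist.
by apply: (trace_class_saB hb); exact: integration_map_X.
Qed.

(** * The metrics *)

Local Notation SM := (strongly_measurable `[0, T]).

Lemma measurable_dist (D : set R) a c : strongly_measurable D a ->
  strongly_measurable D c -> measurable_fun D (fun r => (tn (a r - c r))%:E).
Proof.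
by move=> ma mc; apply/measurable_EFinP; exact: (measurable_tn_dist hb ma mc).
Qed.

Lemma L1_dist_ge0 a c : SM a -> SM c -> (0 <= L1_dist `[0%R, T] a c)%E.
Proof.
move=> ma mc; rewrite (L1_distE hb ma mc); apply: integral_ge0 => t tT.
rewrite lee_fin; apply: (tn_ge0 hb); apply: (trace_class_saB hb).
  by case: ma => + _; apply.
by case: mc => + _; apply.
Qed.

Lemma L1_distC a c : SM a -> SM c ->
  L1_dist `[0, T] a c = L1_dist `[0, T] c a.
Proof.
move=> ma mc; rewrite (L1_distE hb ma mc) (L1_distE hb mc ma).
apply: eq_integral => t /set_mem tT; rewrite (tn_distC hb)//.
  by case: ma => + _; apply.
by case: mc => + _; apply.
Qed.

Lemma L1_dist_triangle a c e : SM a -> SM c -> SM e ->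
  (L1_dist `[0%R, T] a e <= L1_dist `[0%R, T] a c + L1_dist `[0%R, T] c e)%E.
Proof.
move=> ma mc me; rewrite (L1_distE hb ma mc) (L1_distE hb ma me) (L1_distE hb mc me).
have mX (f : R -> H -> H) t : SM f -> [set` `[0, T]] t -> X (f t) by case=> + _; apply.
have pos (f g : R -> H -> H) t : SM f -> SM g -> [set` `[0, T]] t -> (0 <= (tn (f t - g t))%:E)%E.
  move=> mf mg tT; rewrite lee_fin; apply: (tn_ge0 hb).
  by apply: (trace_class_saB hb); exact: mX.
have mT : measurable [set` `[0, T]] by exact: measurable_itv.
rewrite -ge0_integralD//; first last.
- exact: measurable_dist.
- by move=> t; exact: pos.
- exact: measurable_dist.
- by move=> t; exact: pos.
apply: ge0_le_integral => //.
- by move=> t; exact: pos.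
- exact: measurable_dist.
- by apply: emeasurable_funD; exact: measurable_dist.
- by move=> t tT; rewrite -EFinD lee_fin; apply: (tn_triangle hb); exact: mX.
Qed.

Lemma L1_dist_eq0 a c : SM a -> SM c ->
  L1_dist `[0, T] a c = 0%E <-> ae_eq mu `[0, T]%classic a c.
Proof.
move=> ma mc; rewrite (L1_distE hb ma mc).
have mT : measurable [set` `[0, T]] by exact: measurable_itv.
have mac := measurable_dist ma mc.
have Xac t : [set` `[0, T]] t -> X (a t - c t).
  by move=> tT; apply: (trace_class_saB hb); [case: ma|case: mc] => + _; apply.
have e : (\int[mu]_(t in `[0%R, T]) (tn (a t - c t))%:E =
    \int[mu]_(t in `[0%R, T]) `|(tn (a t - c t))%:E|)%E.
  apply: eq_integral => t /set_mem tT; rewrite gee0_abs// lee_fin.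
  exact: (tn_ge0 hb (Xac _ tT)).
rewrite e; split.
  move=> /(ae_eq_integral_abs mu mT mac); apply: ae_imply => t h tT.
  have [] := h tT; move=> /(tn_eq0 hb (Xac _ tT))/eqP.
  by rewrite subr_eq0 => /eqP.
move=> h; apply/(ae_eq_integral_abs mu mT mac); move: h; apply: ae_imply => t h tT.
by rewrite (h tT) subrr; have [_ ->] := trace_class_sa0 hb.
Qed.

Lemma density_metric : metric_on DS (ae_eq mu `[0, T]%classic) (L1_dist `[0, T]).
Proof.
move=> a c e Da Dc De; have [[[ma _] [mc _]] [me _]] := (Da, Dc, De).
split; [|exact: L1_dist_eq0|exact: L1_distC|exact: L1_dist_triangle].
by have [r r0 ->] := density_dist_fin Da Dc; rewrite lee_fin r0 ltry.
Qed.

Lemma partition_point s p n : path <%R s p -> (n <= size p)%N ->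
  s <= nth T (s :: p) n <= last s p.
Proof.
elim: p s n => [|x p IH] s [|n] //=; first by rewrite lexx.
  move=> /andP[sx xp] _; rewrite lexx/=.
  by have /andP[_ h] := IH x 0%N xp isT; rewrite (le_trans (ltW sx)).
move=> /andP[sx xp] np; have /andP[h1 ->] := IH x n xp np.
by rewrite (le_trans (ltW sx)).
Qed.

Lemma one_var_dist_ext q1 q2 q1' q2' :
  (forall t, 0 <= t <= T -> q1 t = q2 t) ->
  (forall t, 0 <= t <= T -> q1' t = q2' t) ->
  one_var_dist T q1 q1' = one_var_dist T q2 q2'.
Proof.
move=> e e'; congr ereal_sup; apply: eq_imagel => p [pp /eqP lp].
rewrite !one_var_sumE /variation_sum big_nat [RHS]big_nat.
apply: eq_bigr => n /andP[_ np].
have h k : (k <= size p)%N -> 0 <= nth T (0 :: p) k <= T.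
  by move=> kp; have := partition_point pp kp; rewrite lp.
by rewrite !e ?e'//; apply: h => //; exact: ltnW.
Qed.

(** Equal paths are at variation distance [0], hence so are the densities by the
    isometry; the converse is the bound of [I a - I c] at a fixed time. *)
Lemma integration_map_inj a c : DS a -> DS c ->
  (forall t, 0 <= t <= T -> I a t = I c t) <-> ae_eq mu `[0, T]%classic a c.
Proof.
move=> Da Dc; have [[ma _] [mc _]] := (Da, Dc); split => [h|/L1_dist_eq0 h t tT].
  apply/L1_dist_eq0 => //; rewrite -integration_isometry//.
  rewrite (one_var_dist_ext h (fun t _ => erefl (I c t))).
  by rewrite integration_isometry//; apply/L1_dist_eq0 => //; exact: aeW.
have XI : X (I a t - I c t).
  by apply: (trace_class_saB hb); exact: integration_map_X.
apply/eqP; rewrite -subr_eq0; apply/eqP/(tn_eq0 hb XI)/eqP.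
rewrite eq_le (tn_ge0 hb XI) andbT -lee_fin.
by have := integration_map_dist Da Dc tT; rewrite h.
Qed.

(** Transported from the densities, because the variation distance only depends on
    the values on [[0, T]]. *)
Lemma path_metric :
  metric_on QS (fun q q' => forall t, [set` `[0, T]] t -> q t = q' t)
    (one_var_dist T).
Proof.
move=> q1 q2 q3 /path_surj[a1 D1 e1] /path_surj[a2 D2 e2] /path_surj[a3 D3 e3].
have E a c q q' : DS a -> DS c -> (forall t, 0 <= t <= T -> I a t = q t) ->
    (forall t, 0 <= t <= T -> I c t = q' t) ->
    one_var_dist T q q' = L1_dist `[0, T] a c.
  by move=> Da Dc e e'; rewrite -(one_var_dist_ext e e') integration_isometry.
have E12 := E _ _ _ _ D1 D2 e1 e2; have E21 := E _ _ _ _ D2 D1 e2 e1.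
have E13 := E _ _ _ _ D1 D3 e1 e3; have E23 := E _ _ _ _ D2 D3 e2 e3.
have [h1 h2 h3 h4] := density_metric D1 D2 D3; rewrite E12 E21 E13 E23.
split; [exact: h1| |exact: h3|exact: h4].
apply: (iff_trans h2); apply: (iff_trans (iff_sym (integration_map_inj D1 D2))).
split => h t tT.
  have tT' : 0 <= t <= T by move: tT; rewrite /= in_itv.
  by rewrite -(e1 _ tT') -(e2 _ tT') (h _ tT').
have tT' : [set` `[0, T]] t by rewrite /= in_itv.
by rewrite (e1 _ tT) (e2 _ tT) (h _ tT').
Qed.

(** * Completeness *)

Lemma cvge0_le (x : nat -> \bar R) : (forall n, (0 <= x n)%E) ->
  (forall e : R, 0 < e -> exists k, forall n, (k <= n)%N -> (x n <= e%:E)%E) ->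
  x n @[n --> \oo] --> 0%E.
Proof.
move=> x0 hx; have fin (e : R) n : (x n <= e%:E)%E -> x n \is a fin_num.
  by move=> xe; rewrite ge0_fin_numE//; apply: le_lt_trans xe _; exact: ltry.
apply: cvg_EFin.
  have [k hk] := hx 1 ltr01; exists k => // n /= kn; exact: fin (hk _ kn).
apply/cvgrPdist_le => e e0; have [k hk] := hx e e0; exists k => // n /= kn.
have xe := hk n kn; rewrite sub0r normrN ger0_norm ?fine_ge0//.
by rewrite -lee_fin fineK// (fin _ _ xe).
Qed.

Lemma cvge0_lt (x : nat -> \bar R) (e : R) : x n @[n --> \oo] --> 0%E -> 0 < e ->
  exists k, forall n, (k <= n)%N -> (x n < e%:E)%E.
Proof.
move=> /fine_cvgP[[m _ xm] /cvgrPdist_lt/[apply] -[k _ xk]].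
exists (maxn m k) => n; rewrite geq_max => /andP[mn kn].
have := xk n kn; rewrite /= sub0r normrN => h.
by rewrite -(fineK (xm n mn)) lte_fin; apply: le_lt_trans h; exact: ler_norm.
Qed.

Lemma variation_sum_cvg (u : nat -> R -> H -> H) q q' s (p : seq R) :
  (forall t, 0 <= t <= T -> X (q t)) -> (forall t, 0 <= t <= T -> X (q' t)) ->
  (forall n t, 0 <= t <= T -> X (u n t)) ->
  (forall t, 0 <= t <= T -> tn (u n t - q' t) @[n --> \oo] --> 0) ->
  0 <= s -> path <%R s p -> last s p <= T ->
  variation_sum (fun t => q t - u n t) s p @[n --> \oo] -->
  variation_sum (fun t => q t - q' t) s p.
Proof.
move=> Xq Xq' Xu uq'; elim: p s => [|x p IH] s s0 pp lp.
  rewrite /variation_sum big_nil; under eq_fun do rewrite big_nil.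
  exact: cvg_cst.
have h k : (k <= size (x :: p))%N -> 0 <= nth T (s :: x :: p) k <= T.
  move=> /(partition_point pp)/andP[h1 h2].
  by rewrite (le_trans s0 h1) (le_trans h2 lp).
have sT : 0 <= s <= T := h 0%N isT.
have xT : 0 <= x <= T := h 1%N isT.
rewrite variation_sum_cons; under eq_fun do rewrite variation_sum_cons.
have Xd n t : 0 <= t <= T -> X (q t - u n t).
  by move=> tT; apply: (trace_class_saB hb); [exact: Xq|exact: Xu].
have Xd' t : 0 <= t <= T -> X (q t - q' t).
  by move=> tT; apply: (trace_class_saB hb); [exact: Xq|exact: Xq'].
have dcvg t : 0 <= t <= T ->
    tn ((q t - u n t) - (q t - q' t)) @[n --> \oo] --> 0.
  move=> tT; have hu := uq' _ tT.
  have e n : tn ((q t - u n t) - (q t - q' t)) = tn (u n t - q' t).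
    rewrite (tn_distC hb (Xu n _ tT) (Xq' _ tT)); congr tn.
    by rewrite opprB addrC subrKA.
  by under eq_fun do rewrite e.
apply: cvgeD.
- apply: ge0_adde_def; rewrite inE.
    by rewrite (tnE hb (trace_class_saB hb (Xd' _ xT) (Xd' _ sT))) lee_fin
      (tn_ge0 hb (trace_class_saB hb (Xd' _ xT) (Xd' _ sT))).
  rewrite /variation_sum big_nat; apply: sume_ge0 => n /andP[_ np].
  have XX : X (q (nth T (x :: p) n.+1) - q' (nth T (x :: p) n.+1) -
     (q (nth T (x :: p) n) - q' (nth T (x :: p) n))).
    apply: (trace_class_saB hb); apply: Xd'.
      exact: (h n.+2).
    by apply: (h n.+1); exact: ltnW.
  by rewrite (tnE hb XX) lee_fin (tn_ge0 hb XX).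
- rewrite (tnE hb (trace_class_saB hb (Xd' _ xT) (Xd' _ sT))).
  under eq_fun do rewrite (tnE hb (trace_class_saB hb (Xd _ _ xT) (Xd _ _ sT))).
  apply: cvg_EFin; first exact: nearW.
  exact: (@tn_dist_cvg _ _ _ hb _ _ _ _ (fun n => Xd n _ xT) (fun n => Xd n _ sT)
    (Xd' _ xT) (Xd' _ sT) (dcvg _ xT) (dcvg _ sT)).
- move: pp lp => /= /andP[sx xp] lp; apply: IH => //.
  by case/andP: xT.
Qed.

Lemma path_dist q q' t : QS q -> QS q' -> 0 <= t <= T ->
  ((tn (q t - q' t))%:E <= one_var_dist T q q')%E.
Proof.
move=> /path_surj[a Da ea] /path_surj[c Dc ec] tT.
rewrite -(ea _ tT) -(ec _ tT) -(one_var_dist_ext ea ec).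
by rewrite integration_isometry//; exact: integration_map_dist.
Qed.

(** The pointwise limit of a Cauchy sequence satisfies the constraints, and each
    variation sum is continuous along the sequence, so the variation distance to
    the limit is at most the Cauchy bound. *)
Lemma path_complete : complete_on QS (one_var_dist T).
Proof.
move=> u Qu cu.
have Xu n t : 0 <= t <= T -> X (u n t) by move=> tT; exact: path_X.
have lim t : exists A, 0 <= t <= T -> X A /\ tn (u n t - A) @[n --> \oo] --> 0.
  have [tT|tT] := boolP (0 <= t <= T); last by exists 0.
  have [||A XA uA] := @trace_class_complete _ _ _ hb (fun n => u n t).
  - by move=> n; exact: Xu.
  - move=> e /cu[k hk]; exists k => m n km kn.
    by rewrite -lte_fin; apply: le_lt_trans (hk _ _ km kn); exact: path_dist.
  - by exists A.
have /choice[q hq] := lim.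
have Xq t : 0 <= t <= T -> X (q t) by move=> /hq[].
have Qq : QS q.
  apply: path_spaceI => // [|s t s0 st tT].
    have T0 : 0 <= (0 : R) <= T by rewrite lexx ltW.
    have [_ h] := hq _ T0; apply: (tn_eq0 hb (Xq _ T0)).
    have e n : tn (u n 0 - q 0) = tn (q 0).
      by have [_ _ -> _] := Qu n; rewrite sub0r (tnN hb (Xq _ T0)).
    move: h; under eq_fun do rewrite e.
    exact: (cvg_unique (@Rhausdorff R) (cvg_cst (tn (q 0)))).
  have sT : 0 <= s <= T by rewrite s0 (le_trans st).
  have tT' : 0 <= t <= T by rewrite (le_trans s0).
  have [_ hs] := hq _ sT; have [_ ht] := hq _ tT'.
  have XB n : X (u n t - u n s) by apply: (trace_class_saB hb); exact: Xu.
  have XBq : X (q t - q s) by apply: (trace_class_saB hb); exact: Xq.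
  apply: (countably_linear_closed cond_countable XB XBq).
    apply: (@squeeze_cvg0 _ _ (fun n => tn (u n t - q t) + tn (u n s - q s))).
      move=> n; have Xt := trace_class_saB hb (Xu n _ tT') (Xq _ tT').
      have Xs := trace_class_saB hb (Xu n _ sT) (Xq _ sT).
      have -> : (u n t - u n s) - (q t - q s) = (u n t - q t) - (u n s - q s).
        exact: subrBB.
      by rewrite (tn_ge0 hb (trace_class_saB hb Xt Xs)) (tnB_le hb Xt Xs).
    by rewrite -[0](addr0 (0 : R)); exact: cvgD.
  by move=> n; have [_ _ _ h] := Qu n; exact: h.
exists q => //; apply: cvge0_le => [n|e e0].
  have T0 : 0 <= (0 : R) <= T by rewrite lexx ltW.
  apply: le_trans (path_dist (Qu n) Qq T0); rewrite lee_fin.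
  by apply: (tn_ge0 hb); apply: (trace_class_saB hb); [exact: Xu|exact: Xq].
have [k hk] := cu _ e0; exists k => n kn.
apply: ge_ereal_sup => _ [p [pp /eqP lp] <-]; rewrite one_var_sumE.
have uq t : 0 <= t <= T -> tn (u m t - q t) @[m --> \oo] --> 0 by move=> /hq[].
have lT : last 0 p <= T by rewrite lp.
have vc := variation_sum_cvg (fun t => Xu n t) Xq Xu uq (lexx 0) pp lT.
apply: (cvge_to_le vc); exists k => // m /= km.
apply: le_trans (ltW (hk _ _ kn km)).
by apply: ereal_sup_ubound; exists p => //; split => //; apply/eqP.
Qed.

(** Transported from the paths, where limits are taken pointwise in time: no almost
    everywhere convergent subsequence has to be extracted. *)
Lemma density_complete : complete_on DS (L1_dist `[0, T]).
Proof.
move=> a Da ca.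
have [|e e0|q Qq uq] := path_complete (u := fun n => I (a n)).
- by move=> n; exact: integration_map_path.
- have [k hk] := ca _ e0; exists k => m n km kn.
  by rewrite integration_isometry//; exact: hk.
have [c Dc ec] := path_surj Qq; exists c => //.
have e n : L1_dist `[0, T] (a n) c = one_var_dist T (I (a n)) q.
  rewrite -(integration_isometry (Da n) Dc).
  exact: one_var_dist_ext.
by under eq_fun do rewrite e.
Qed.

Lemma density_L1 a : DS a -> L1 `[0, T] a.
Proof.
move=> Da; split; first by case: Da.
have [r _ e] := density_dist_fin Da density0.
by rewrite (_ : L1_dist _ a 0 = r%:E)// ltry.
Qed.

(** Densities approximating [a] form a Cauchy sequence, whose limit in the density
    space agrees with [a] almost everywhere. *)
Lemma density_closed : closed_in DS (L1 `[0, T]) (L1_dist `[0, T]).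
Proof.
split => [a|a [ma _] ha]; first exact: density_L1.
have /choice[c hc] n : exists c, DS c /\ (L1_dist `[0%R, T] a c < n.+1%:R^-1%:E)%E.
  by have [c Dc ac] := ha n.+1%:R^-1 (ltac:(by rewrite invr_gt0)); exists c.
have Dc n : DS (c n) by have [] := hc n.
have mc n : SM (c n) by have [] := Dc n.
have ac n : (L1_dist `[0%R, T] a (c n) < n.+1%:R^-1%:E)%E by have [] := hc n.
have small (e : R) : 0 < e -> exists k, forall n, (k <= n)%N ->
    (L1_dist `[0%R, T] a (c n) < e%:E)%E.
  move=> e0; have /cvgrPdist_lt/(_ _ e0)[k _ hk] := @cvg_harmonic R.
  exists k => n kn; apply: (lt_trans (ac n)); rewrite lte_fin.
  by have := hk n kn; rewrite /= sub0r normrN ger0_norm.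
have [||d Dd cd] := density_complete (u := c) => //.
  move=> e e0; have e2 : 0 < e / 2 by rewrite divr_gt0.
  have [k hk] := small _ e2; exists k => m n km kn.
  apply: (le_lt_trans (L1_dist_triangle (mc m) ma (mc n))).
  by rewrite L1_distC// [e]splitr EFinD lteD// hk.
have md : SM d by case: Dd.
have ad : ae_eq mu `[0, T]%classic a d.
  apply/L1_dist_eq0 => //; apply/eqP; rewrite eq_le L1_dist_ge0// andbT.
  apply/lee_addgt0Pr => e e0; rewrite add0e.
  have e2 : (0 < (e / 2)%:E)%E by rewrite lte_fin divr_gt0.
  have e2' : 0 < e / 2 by rewrite divr_gt0.
  have [k hk] := small _ e2'.
  have [m hm] := cvge0_lt cd e2'.
  pose n := maxn k m.
  apply: (le_trans (L1_dist_triangle ma (mc n) md)).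
  rewrite [e]splitr EFinD; apply: leeD; apply: ltW.
    by apply: hk; exact: leq_maxl.
  by apply: hm; exact: leq_maxr.
apply/DSP; split => //; have [_ cd'] := (DSP d).1 Dd.
have := ae_conj ad cd'; apply: ae_imply => t [e hd] tT.
by rewrite (e tT); exact: hd.
Qed.

(** * Operations on densities *)

Lemma strongly_measurable_piece (e : pred R) (phi : R -> R) a c :
  SM a -> SM c -> measurable [set t | e t] ->
  (forall E, measurable E -> measurable (phi @^-1` E)) ->
  (forall t, 0 <= t <= T -> e t -> 0 <= phi t <= T) ->
  SM (fun t => if e t then a (phi t) else c t).
Proof.
move=> /(strongly_measurableP hb)[Xa [u su ua]].
move=> /(strongly_measurableP hb)[Xc [v sv vc]] me mphi ephi.
have phiT t : [set` `[0, T]] t -> e t -> [set` `[0, T]] (phi t).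
  by rewrite /= !in_itv/=; exact: ephi.
apply/(strongly_measurableP hb); split => [t tT|].
  by case: ifPn => et; [exact/Xa/phiT|exact: Xc].
exists (fun n t => if e t then u n (phi t) else v n t) => [n|t tT].
  exact: simple_fun_piece.
by case: ifPn => et; [exact/ua/phiT|exact: vc].
Qed.

Lemma integration_map_zero t : 0 <= t <= T -> I (fun=> 0) t = 0.
Proof.
move=> tT; apply: (weak_int_unique (integration_map_weak density0 tT)) => x y.
have [i0 _] := integration_map_weak density0 tT x y.
by split => //; rewrite inner0l; exact: integral0_eq.
Qed.

Lemma measurable_ltl s : measurable [set t | t < s].
Proof.
rewrite (_ : [set t | t < s] = [set` `]-oo, s[]); first exact: measurable_itv.
by apply/seteqP; split => t /=; rewrite in_itv.
Qed.

Lemma measurable_ltr s : measurable [set t | s < t].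
Proof.
rewrite (_ : [set t | s < t] = [set` `]s, +oo[]); first exact: measurable_itv.
by apply/seteqP; split => t /=; rewrite in_itv/= andbT.
Qed.

Lemma density_stop_space s a : DS a -> DS (density_stop s a).
Proof.
move=> Da; have [[ma _] [m0 _]] := (Da, density0); apply/DSP; split.
  exact: (strongly_measurable_piece (e := fun t => t < s) (phi := id) ma m0
    (measurable_ltl s)).
have [_ ca] := (DSP a).1 Da; move: ca; apply: ae_imply => t ca tT.
by rewrite /density_stop; case: ifP => _; [exact: ca|exact: cond0].
Qed.

Lemma density_shift_space s a : 0 <= s <= T -> DS a -> DS (density_shift T s a).
Proof.
move=> /andP[s0 sT] Da; have [[ma _] [m0 _]] := (Da, density0).
have inT v : 0 <= v <= T -> v < T - s -> 0 <= s + v <= T.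
  by move=> /andP[v0 vT] vs; apply/andP; split; lra.
apply/DSP; split.
  apply: (strongly_measurable_piece (e := fun v => v < T - s)
    (phi := fun v => s + v) ma m0 (measurable_ltl _)) => // E mE.
  exact: measurable_preimage_shift.
have [_ /(ae_shift s) ca] := (DSP a).1 Da; move: ca; apply: ae_imply => v ca.
rewrite /= in_itv/= => vT.
rewrite /density_shift; case: ifP => vs; last exact: cond0.
by apply: ca; rewrite /= in_itv/=; exact: inT.
Qed.

Lemma density_concatE s a c : density_concat s a c =
  fun t => if t < s then a t else if s < t then c (- s + t) else 0.
Proof.
apply/funext => t; rewrite /density_concat [- s + t]addrC.
by case: (ltgtP t s); rewrite ?addr0 ?add0r.
Qed.

Lemma density_concat_space s a c : 0 <= s <= T -> DS a -> DS c ->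
  DS (density_concat s a c).
Proof.
move=> /andP[s0 sT] Da Dc; have [[[ma _] [mc _]] [m0 _]] := (Da, Dc, density0).
rewrite density_concatE.
have inT t : 0 <= t <= T -> s < t -> 0 <= - s + t <= T.
  by move=> /andP[t0 tT] st; apply/andP; split; lra.
apply/DSP; split.
  apply: (strongly_measurable_piece (e := fun t => t < s) (phi := id)
    (c := fun t => if s < t then c (- s + t) else 0) ma _ (measurable_ltl s)) => //.
  apply: (strongly_measurable_piece (e := fun t => s < t)
    (phi := fun t => - s + t) mc m0 (measurable_ltr s)) => // E mE.
  exact: measurable_preimage_shift.
have [_ ca] := (DSP a).1 Da; have [_ /(ae_shift (- s)) cc] := (DSP c).1 Dc.
have := ae_conj ca cc; apply: ae_imply => t [{}ca {}cc].
rewrite /= in_itv/= => tT; case: ifP => _.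
  by apply: ca; rewrite /= in_itv.
case: ifP => st; last exact: cond0.
by apply: cc; rewrite /= in_itv/=; exact: inT.
Qed.

(** A translation of the line in the weak integrals.  This covers the three
    operations, with [c] the zero density where the new density vanishes. *)
Lemma increment_shift a c s t s' t' : DS a -> DS c ->
  0 <= s -> s <= t -> t <= T -> 0 <= s' -> s' <= t' -> t' <= T ->
  t - s = t' - s' -> (forall r, s < r < t -> a r = c (s' - s + r)) ->
  I a t - I a s = I c t' - I c s'.
Proof.
move=> Da Dc s0 st tT s0' st' tT' e ac.
have wa := weak_int_increment Da s0 st tT.
have wc := weak_int_increment Dc s0' st' tT'.
apply: (weak_int_unique wa) => x y; have [ia ea] := wa x y.
split; first exact: ia.
have [ic <-] := wc x y.
have mD' : measurable [set` `]s', t']] by exact: measurable_itv.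
have moo : measurable [set` `]s, t[] by exact: measurable_itv.
have moc : measurable [set` `]s, t]] by exact: measurable_itv.
have sub : [set` `]s, t[] `<=` `]s, t].
  by move=> r /=; rewrite !in_itv/= => /andP[-> /ltW].
pose h : R -> R := (fun r => inner (c r x) y) \_ `]s', t'].
have ih : mu.-integrable [set: R] (EFin \o h).
  by rewrite /h -restrict_EFin; apply/integrable_restrict => //; rewrite setTI.
have ihs := integrable_shift (s' - s) ih.
have hE : (\int[mu]_(r in `]s', t']) (inner (c r x) y)%:E =
    \int[mu]_(r in `]s', t']) (h r)%:E)%E.
  by apply: eq_integral => r rD; rewrite /h patchE rD.
rewrite hE -(integral_shift (s' - s) mD' ih).
have -> : [set r | `]s', t']%classic (s' - s + r)] = [set` `]s, t]].
  by apply/seteqP; split => r /=; rewrite !in_itv/= => /andP[? ?];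
    apply/andP; split; lra.
rewrite -[LHS]integral_itv_bndo_bndc; last first.
  by have /integrableP[ma _] := lebesgue_integrableS moc moo sub ia.
rewrite -[RHS]integral_itv_bndo_bndc; last first.
  by have /integrableP[mh _] := ihs; exact: measurable_funTS.
apply: eq_integral => r /set_mem; rewrite /= in_itv/= => sr.
rewrite ac// /h patchE ifT// inE /= in_itv/=.
by case/andP: sr => ? ?; apply/andP; split; lra.
Qed.

Lemma increment0 a s t : DS a -> 0 <= s -> s <= t -> t <= T ->
  (forall r, s < r < t -> a r = 0) -> I a t = I a s.
Proof.
move=> Da s0 st tT h; apply/eqP; rewrite -subr_eq0; apply/eqP.
rewrite (@increment_shift a (fun=> 0) s t s t)//; last exact: density0.
by rewrite !integration_map_zero ?subrr// ?s0 ?(le_trans st)// (le_trans s0).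
Qed.

Lemma increment_from0 a c s t : DS a -> DS c -> 0 <= t -> 0 <= s -> s + t <= T ->
  (forall r, 0 < r < t -> a r = c (s + r)) -> I a t = I c (s + t) - I c s.
Proof.
move=> Da Dc t0 s0 stT h; rewrite -(@increment_shift a c 0 t s (s + t))//.
- by rewrite integration_map0// subr0.
- by rewrite (le_trans _ stT)// lerDr.
- by rewrite lerDl.
- by rewrite subr0 addrAC subrr add0r.
- by move=> r; rewrite subr0; exact: h.
Qed.

Lemma integration_map_stop s a t : 0 <= s <= T -> DS a -> 0 <= t <= T ->
  I (density_stop s a) t = path_stop s (I a) t.
Proof.
move=> /andP[s0 sT] Da /andP[t0 tT]; have Ds := density_stop_space s Da.
have low r : 0 <= r -> r <= s -> I (density_stop s a) r = I a r.
  move=> r0 rs; have rT := le_trans rs sT.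
  rewrite (@increment_from0 _ a 0 r)// ?add0r ?integration_map0 ?subr0// => x.
  by move=> /andP[x0 xr]; rewrite add0r /density_stop (lt_le_trans xr rs).
rewrite /path_stop; have [ts|st] := leP t s; first exact: low.
rewrite -(low s)//; apply: increment0 => //; first exact: ltW.
by move=> r /andP[sr _]; rewrite /density_stop ltNge (ltW sr).
Qed.

Lemma integration_map_shift s a t : 0 <= s <= T -> DS a -> 0 <= t <= T ->
  I (density_shift T s a) t = path_shift T s (I a) t.
Proof.
move=> sI Da /andP[t0 tT]; have Ds := density_shift_space sI Da.
have /andP[s0 sT] := sI.
have low r : 0 <= r -> r <= T - s ->
    I (density_shift T s a) r = I a (s + r) - I a s.
  move=> r0 rs; apply: increment_from0 => //; first lra.
  by move=> x /andP[x0 xr]; rewrite /density_shift (lt_le_trans xr rs).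
rewrite /path_shift; have [ts|st] := leP t (T - s); first exact: low.
have Ts : 0 <= T - s by rewrite subr_ge0.
rewrite -(low (T - s))//; apply: increment0 => //; first exact: ltW.
by move=> r /andP[sr _]; rewrite /density_shift ltNge (ltW sr).
Qed.

Lemma integration_map_concat s a c t : 0 <= s <= T -> DS a -> DS c ->
  0 <= t <= T ->
  I (density_concat s a c) t = path_concat s (I a) (I c) t.
Proof.
move=> sI Da Dc /andP[t0 tT]; have Ds := density_concat_space sI Da Dc.
have /andP[s0 sT] := sI.
have low r : 0 <= r -> r <= s -> I (density_concat s a c) r = I a r.
  move=> r0 rs; have rT := le_trans rs sT.
  rewrite (@increment_from0 _ a 0 r)// ?add0r ?integration_map0 ?subr0// => x.
  by move=> /andP[x0 xr]; rewrite add0r density_concatE (lt_le_trans xr rs).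
rewrite /path_concat; have [ts|st] := leP t s.
  by rewrite max_r ?subr_le0// integration_map0// addr0 low.
have ts0 : 0 <= t - s by rewrite subr_ge0 ltW.
rewrite max_l// -(low s)//; apply/eqP; rewrite addrC -subr_eq; apply/eqP.
have tsT : t - s <= T by rewrite lerBlDr (le_trans tT)// lerDl.
rewrite (increment_shift Ds Dc s0 (ltW st) tT (lexx 0) ts0 tsT).
- by rewrite integration_map0// subr0.
- by rewrite subr0.
- move=> r /andP[sr _]; rewrite density_concatE sr ltNge (ltW sr) /=.
  by rewrite sub0r.
Qed.

(** The order interval between [0] and [G] is another countable system of linear
    constraints. *)
Lemma operator_bound_transfer G a : trace_class H G -> op_le 0 G -> DS a ->
  (forall s t, 0 <= s -> s <= t -> t <= T ->
     op_le 0 (I a t - I a s) /\ op_le (I a t - I a s) ((t - s) *: G)) <->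
  ae_on `[0, T] (fun t => op_le 0 (a t) /\ op_le (a t) G).
Proof.
move=> [bG _] pG Da.
have := constraint_transfer (op_order_countable H_separable bG pG) Da.
by rewrite scale1r.
Qed.

End Spaces.

(** * Integration as an isometric bijection *)
Theorem proposition6p7 (R : realType) (H : hilbertType R) (T Lambda : R)
    (P : nat -> H -> H) (theta : nat -> R)
    (T_gt0 : 0 < T) (H_separable : separable H) (Lambda_ge0 : 0 <= Lambda)
    (P_proj : forall m, orthogonal_projection (P m))
    (P_finite : forall m, finite_rank (P m))
    (P_incr : forall m n, (m <= n)%N -> op_le (P m) (P n))
    (P_cvg : forall x, P m x @[m --> \oo] --> x)
    (theta_decr : nonincreasing_seq theta)
    (theta_cvg : theta @ \oo --> (0 : R)) :
  let A := density_space T Lambda P theta in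
  let Q := path_space T Lambda P theta in
  let I := @integration_map R H in
  let I_T := `[0, T]%classic in
  let dA := L1_dist I_T in
  let dQ := one_var_dist T in
  let aeq (a b : R -> H -> H) := ae_eq lebesgue_measure I_T a b in
  let peq (q q' : R -> H -> H) := forall t, I_T t -> q t = q' t in
  (metric_on A aeq dA /\ closed_in A (L1 I_T) dA /\ complete_on A dA) /\
  ((forall a t, A a -> I_T t -> is_bochner_integral `[0, t] a (I a t)) /\
   (forall a, A a -> Q (I a)) /\
   (forall a b, A a -> A b -> peq (I a) (I b) <-> aeq a b) /\
   (forall q, Q q -> exists2 a, A a & peq (I a) q)) /\
  (metric_on Q peq dQ /\ complete_on Q dQ /\
   (forall a b, A a -> A b ->
      dQ (I a) (I b) = dA a b /\ (sup_dist T (I a) (I b) <= dA a b)%E)) /\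
  (forall s a b, I_T s -> A a -> A b ->
     (peq (I (density_stop s a)) (path_stop s (I a)) /\
      peq (I (density_shift T s a)) (path_shift T s (I a)) /\
      peq (I (density_concat s a b)) (path_concat s (I a) (I b))) /\
     (A (density_stop s a) /\ A (density_shift T s a) /\
      A (density_concat s a b))) /\
  (forall G : H -> H, trace_class H G -> op_le 0 G ->
   forall a, A a ->
     (forall s t : R, 0 <= s -> s <= t -> t <= T ->
        op_le 0 (I a t - I a s) /\ op_le (I a t - I a s) ((t - s) *: G)) <->
     ae_on I_T (fun t => op_le 0 (a t) /\ op_le (a t) G)).
Proof.
move=> A Q I I_T dA dQ aeq peq.
have [b hb] := onb_enum H_separable.
have IE : I = int_map by rewrite int_mapE.
have inT t : I_T t <-> 0 <= t <= T by rewrite /I_T /= in_itv.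
rewrite IE; split; [split|split; [|split; [|split]]].
- exact: (density_metric T_gt0 Lambda_ge0 hb).
- split; first exact: (density_closed T_gt0 H_separable Lambda_ge0 P_proj
    P_finite theta_decr theta_cvg hb).
  exact: (density_complete T_gt0 H_separable Lambda_ge0 P_proj
    P_finite theta_decr theta_cvg hb).
- split=> [a t Aa /inT tT|]; first exact: (integration_mapP T_gt0 hb Aa tT).
  split=> [a Aa|].
    exact: (integration_map_path T_gt0 H_separable P_proj hb Aa).
  split=> [a c Aa Ac|q Qq].
    apply: iff_trans (integration_map_inj T_gt0 H_separable Lambda_ge0 P_proj
      P_finite theta_decr theta_cvg hb Aa Ac).
    by split=> h t /inT; exact: h.
  have [a Aa ea] := path_surj T_gt0 H_separable Lambda_ge0 P_proj
      P_finite theta_decr theta_cvg hb Qq.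
  by exists a => // t /inT; exact: ea.
- split; first exact: (path_metric T_gt0 H_separable Lambda_ge0 P_proj
    P_finite theta_decr theta_cvg hb).
  split; first exact: (path_complete T_gt0 H_separable Lambda_ge0 P_proj
    P_finite theta_decr theta_cvg hb).
  move=> a c Aa Ac; split.
    exact: (integration_isometry T_gt0 H_separable Lambda_ge0 P_proj
      P_finite theta_decr theta_cvg hb Aa Ac).
  exact: (integration_map_sup_dist T_gt0 hb Aa Ac).
- move=> s a c /inT sT Aa Ac; split; [split=> [t /inT tT|]|split].
  + exact: (integration_map_stop T_gt0 Lambda_ge0 P_proj theta_decr theta_cvg
      hb sT Aa tT).
  + split=> t /inT tT.
      exact: (integration_map_shift T_gt0 Lambda_ge0 P_proj theta_decr
        theta_cvg hb sT Aa tT).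
    exact: (integration_map_concat T_gt0 Lambda_ge0 P_proj theta_decr
      theta_cvg hb sT Aa Ac tT).
  + exact: (density_stop_space Lambda_ge0 P_proj theta_decr theta_cvg hb s Aa).
  + split.
      exact: (density_shift_space Lambda_ge0 P_proj theta_decr theta_cvg hb sT Aa).
    exact: (density_concat_space Lambda_ge0 P_proj theta_decr theta_cvg hb sT
      Aa Ac).
- move=> G tG pG a Aa.
  exact: (operator_bound_transfer T_gt0 H_separable hb tG pG Aa).
Qed.
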